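(* Let $N$ be a compact Calabi--Yau $3$-manifold (real dimension $6$) with Kähler form $\omega$ and nowhere-vanishing holomorphic $(3,0)$-form $\Upsilon$, let $M^7=N\times S^1$, and let $A\in\mathbb{R}$. Let $(\omega_t,\Upsilon_t)$ be a smooth family of compatible $\mathrm{SU}(3)$-structures on $N$ with $\omega_0=\omega$, $\Upsilon_0=\Upsilon$, satisfying $$\frac{\partial}{\partial t}\omega_t=-\mathcal{L}_{\nabla_t(\log|\Upsilon_t|_{\omega_t})}\omega_t+\beta_t,\qquad \frac{\partial}{\partial t}\Upsilon_t=\mathcal{L}_{\nabla_t(\log|\Upsilon_t|_{\omega_t})}\Upsilon_t+\gamma_t,$$ with $\beta_t\in\Omega^2(N)$ and $\gamma_t\in\Omega^3(N)$ (complex-valued in the case of $\gamma_t$), and suppose that $$\varphi_t=\mathrm{Re}\left(\frac{1}{|\Upsilon_t|_{\omega_t}}\Upsilon_t\right)+|\Upsilon_t|_{\omega_t}\,dr\wedge\omega_t$$ is a solution to the modified Laplacian coflow with constant $A$ on $M$. If the complex structure $J$ on $N$ remains fixed along the flow, then $$\beta_t^{(1,1)}=0\qquad\text{and}\qquad \mathrm{Im}(\gamma_t)^{(0,3)\oplus(3,0)}=0 .$$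
   Context: Calabi--Yau $3$-manifold here means a complex $3$-fold with a Kähler form $\omega$ and a nowhere-vanishing holomorphic $(3,0)$-form $\Upsilon$ (so $d\omega=0$, $d\Upsilon=0$); $\omega$ is not assumed Ricci-flat. The function $|\Upsilon|_\omega>0$ is defined by $\frac{\omega^3}{3!}=\frac{i}{8}\frac{1}{|\Upsilon|_\omega^2}\Upsilon\wedge\overline{\Upsilon}$. A family of compatible $\mathrm{SU}(3)$-structures $(\omega_t,\Upsilon_t)$ means: for each $t$ there is a complex structure $J_t$ on $N$ for which $\omega_t$ is a Kähler form and $\Upsilon_t$ is a nowhere-vanishing holomorphic $(3,0)$-form; ''the complex structure remains fixed'' means $J_t=J$ for all $t$. Superscripts $(p,q)$ denote the components of a form of that type with respect to $J$. $\nabla_t f$ denotes the gradient of $f$ with respect to the Kähler metric of $\omega_t$ and $\mathcal{L}$ is the Lie derivative. $r$ is the angle coordinate on $S^1$, $dr$ the standard $1$-form; forms on $N$ and $S^1$ are pulled back to $M$. A $\mathrm{G}_2$-structure $\varphi\in\Omega^3(M^7)$ determines a metric $g_\varphi$ and volume form $\mathrm{vol}_\varphi$ by $(X\lrcorner\varphi)\wedge(Y\lrcorner\varphi)\wedge\varphi=6g_\varphi(X,Y)\mathrm{vol}_\varphi$, a Hodge star $\ast_\varphi$, the dual $4$-form $\psi=\ast_\varphi\varphi$, and the scalar torsion $\tau_0=\frac17\ast_\varphi(\varphi\wedge d\varphi)$. A family $\varphi_t$ solves the modified Laplacian coflow with constant $A\in\mathbb{R}$ if $\psi_t=\ast_t\varphi_t$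 satisfies $$\frac{\partial}{\partial t}\psi_t=\Delta_t\psi_t+d\Big(\big(A-\tfrac72(\tau_0)_t\big)\varphi_t\Big),$$ where $\Delta_t=dd^{\ast_t}+d^{\ast_t}d$ is the Hodge Laplacian of $g_{\varphi_t}$. *)

(* Defs.v *)
From HB Require Import structures.
From mathcomp Require Import all_boot all_order all_algebra fingroup perm.
From mathcomp Require Import complex.
From mathcomp Require Import all_classical all_reals all_analysis.

Set Implicit Arguments.
Unset Strict Implicit.
Unset Printing Implicit Defensive.

Import Order.TTheory GRing.Theory Num.Theory.
Import numFieldNormedType.Exports.

Local Open Scope classical_set_scope.
Local Open Scope complex_scope.
Local Open Scope ring_scope.

(* -------------------------- Smooth functions ---------------------------- *)

Fixpoint classC (R : realType) (V : normedModType R) (k : nat) (W : set V)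
    (f : V -> R) : Prop :=
  (forall x, W x -> {for x, continuous f}) /\
  if k is k'.+1 then
    forall v, (forall x, W x -> derivable f x v) /\
              classC k' W (fun x => 'D_v f x)
  else True.

(* The set S need not be open: smooth on S means that f is, on S, equal to a
   smooth function defined on an open set containing S. *)
Definition smooth_on (R : realType) (V : normedModType R) (S : set V)
    (f : V -> R) : Prop :=
  exists W : set V, [/\ open W, S `<=` W &
    exists2 h : V -> R, (forall k, classC k W h) &
                        (forall x, S x -> h x = f x)].

Definition smooth_map_on (R : realType) (V : normedModType R) m (S : set V)
    (F : V -> 'rV[R]_m) : Prop :=
  forall j, smooth_on S (fun x => F x 0 j).

(* Derivative at t of a function on the interval I, hence one-sided when t is
   an endpoint of I; the values of f outside I are irrelevant. *)
Definition has_ddt (R : realType) (I : set R) (f : R -> R) (t l : R) : Prop :=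
  (fun s => (f s - f t) / (s - t)) @ within I t^' --> l.

(* ------------------------------ Manifolds ------------------------------- *)

(* A set of points with a family of parametrizations [par i] of parts of it,
   each used only on [dom i] (an injective map on an open subset of R^n, see
   [smooth_manifold]). The charts are the inverses of the [par i]. *)
Record atlas (R : realType) (n : nat) := Atlas {
  point : choiceType;
  idx : Type;
  dom : idx -> set 'rV[R]_n;
  par : idx -> 'rV[R]_n -> point }.

Definition mspace (R : realType) n (M : atlas R n) : Type := point M.

Section Topology.
Variables (R : realType) (n : nat) (M : atlas R n).

HB.instance Definition _ := Choice.on (mspace M).

(* A is open iff its preimage by each [par i] is open in [dom i]. *)
Definition mspace_open (A : set (mspace M)) : Prop :=
  forall (i : idx M) x, dom i x -> A (par i x) ->
    \forall y \near x, dom i y -> A (par i y).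

Lemma mspace_openT : mspace_open setT.
Proof. by move=> i x _ _; apply: filterE. Qed.

Lemma mspace_openI : setI_closed mspace_open.
Proof.
move=> A B oA oB i x ix [Ax Bx].
apply: filterS2 (oA i x ix Ax) (oB i x ix Bx) => y Ay By iy.
by split; [exact: Ay | exact: By].
Qed.

Lemma mspace_open_bigU (K : Type) (f : K -> set (mspace M)) :
  (forall k, mspace_open (f k)) -> mspace_open (\bigcup_k f k).
Proof.
move=> of_ i x ix [k _ fkx].
by apply: filterS (of_ k i x ix fkx) => y fky iy; exists k => //; exact: fky.
Qed.

HB.instance Definition _ := isOpenTopological.Build (mspace M)
  mspace_openT mspace_openI mspace_open_bigU.

End Topology.

Section Manifold.
Variables (R : realType) (n : nat).
Implicit Type M : atlas R n.

Definition overlap M (i j : idx M) : set 'rV[R]_n :=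
  [set x | dom i x /\ exists2 y, dom j y & par j y = par i x].

Definition trans M (i j : idx M) (x : 'rV[R]_n) : 'rV[R]_n :=
  xget 0 [set y | dom j y /\ par j y = par i x].

Definition smooth_manifold M : Prop :=
  [/\ forall i : idx M, open (dom i) /\ set_inj (dom i) (par i),
      forall p : point M, exists i x, dom i x /\ par i x = p,
      forall i j : idx M,
        open (overlap i j) /\ smooth_map_on (overlap i j) (trans i j),
      hausdorff_space (mspace M)
    & @second_countable (mspace M)].

(* Tensor fields are given by their local expression in each chart; the value
   of [a i x] matters only for x in [dom i]. *)
Definition field M (T : Type) := idx M -> 'rV[R]_n -> T.

Definition eq_field M T (a b : field M T) : Prop :=
  forall i x, dom i x -> a i x = b i x.

Definition bracket (X Y : 'rV[R]_n -> 'rV[R]_n) (x : 'rV[R]_n) : 'rV[R]_n :=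
  'D_(X x) Y x - 'D_(Y x) X x.

End Manifold.

Section Product.
Variables (R : realType) (m n : nat) (M : atlas R m) (N : atlas R n).

Definition prod_atlas : atlas R (m + n) :=
  @Atlas R (m + n) (point M * point N)%type (idx M * idx N)%type
    (fun p => [set x | dom p.1 (lsubmx x) /\ dom p.2 (rsubmx x)])
    (fun p x => (par p.1 (lsubmx x), par p.2 (rsubmx x))).

End Product.

(* The circle, each interval ]a, a + 2 pi[ of values of the angle giving a
   chart. *)
Definition circle_point (R : realType) : Type :=
  {z : R * R | z.1 ^+ 2 + z.2 ^+ 2 == 1}.

Definition circle_par (R : realType) (r : R) : circle_point R :=
  exist _ (cos r, sin r) (introT eqP (cos2Dsin2 r)).

Definition circle (R : realType) : atlas R 1 :=
  @Atlas R 1 (circle_point R) R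
    (fun a => [set x | a < x 0 0 < a + 2 * pi])
    (fun _ x => circle_par (x 0 0)).

(* -------------------------- Differential forms -------------------------- *)

(* k-covectors on R^n with values in K = R or R[i] *)
Definition kform (R : realType) (K : Type) (n k : nat) : Type :=
  ('I_k -> 'rV[R]_n) -> K.

Section Covectors.
Variables (R : realType) (n : nat).
Local Notation V := 'rV[R]_n.

Definition alternating k (a : kform R R n k) : Prop :=
  (forall (v : 'I_k -> V) j (c : R) (u w : V),
     a [eta v with j |-> c *: u + w] =
     c * a [eta v with j |-> u] + a [eta v with j |-> w]) /\
  (forall (v : 'I_k -> V) i j, i != j -> v i = v j -> a v = 0).

Definition wedge (K : fieldType) k l (a : kform R K n k) (b : kform R K n l) :
    kform R K n (k + l) :=
  fun v => (k`!%:R * l`!%:R)^-1 *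
    \sum_(s : 'S_(k + l)) (-1) ^+ s *
      (a (fun j => v (s (lshift l j))) * b (fun j => v (s (rshift k j)))).

Definition vcons k (X : V) (v : 'I_k -> V) : 'I_k.+1 -> V :=
  fun i => oapp v X (unlift ord0 i).

Definition vcat k l (u : 'I_k -> V) (v : 'I_l -> V) : 'I_(k + l) -> V :=
  fun i => match fintype.split i with inl j => u j | inr j => v j end.

Definition contract (K : Type) k (X : V) (a : kform R K n k.+1) :
  kform R K n k := fun v => a (vcons X v).

Definition ebase (i : 'I_n) : V := delta_mx 0 i.

Definition gram (g : V -> V -> R) : 'M[R]_n :=
  \matrix_(i, j) g (ebase i) (ebase j).

Definition inner_product (g : V -> V -> R) : Prop :=
  [/\ forall c u v w, g (c *: u + v) w = c * g u w + g v w,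
      forall u v, g u v = g v u
    & forall u, u != 0 -> 0 < g u u].

(* vol takes the values +1 and -1 on g-orthonormal bases *)
Definition volume_form (g : V -> V -> R) (vol : kform R R n n) : Prop :=
  alternating vol /\ vol ebase ^+ 2 = \det (gram g).

(* ( *a)_{j_1 ... j_l} = 1/k! a^{i_1 ... i_k} vol_{i_1 ... i_k j_1 ... j_l},
   i.e. b /\ *a = <b, a> vol *)
Definition star k l (E : (k + l)%N = n) (g : V -> V -> R) (vol : kform R R n n)
    (a : kform R R n k) : kform R R n l :=
  fun w => (k`!%:R)^-1 *
    \sum_(f : {ffun 'I_k -> 'I_n}) \sum_(h : {ffun 'I_k -> 'I_n})
      (\prod_j invmx (gram g) (f j) (h j)) *
      a (fun j => ebase (f j)) *
      vol (fun i => vcat (fun j => ebase (h j)) w (cast_ord (esym E) i)).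

End Covectors.

Section Calculus.
Variables (R : realType) (n : nat).
Local Notation V := 'rV[R]_n.

(* The v j are extended as constant vector fields, which commute. *)
Definition extd k (a : V -> kform R R n k) : V -> kform R R n k.+1 :=
  fun x v => \sum_(i < k.+1)
    (-1) ^+ i * 'D_(v i) (fun y => a y (fun j => v (lift i j))) x.

(* (L_X a)(Y_1, ..., Y_k) =
     X (a(Y_1, ..., Y_k)) - \sum_j a(Y_1, ..., [X, Y_j], ..., Y_k)
   with Y_j the constant vector field v j; the result is tensorial. *)
Definition lie k (X : V -> V) (a : V -> kform R R n k) : V -> kform R R n k :=
  fun x v => 'D_(X x) (fun y => a y v) x -
    \sum_j a x [eta v with j |-> bracket X (fun=> v j) x].

Definition gradient (g : V -> V -> V -> R) (f : V -> R) : V -> V :=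
  fun x => (\row_j 'D_(ebase R j) f x) *m invmx (gram (g x)).

(* d^* = (-1)^(n (p + 1) + 1) * d * on p-forms, here with p = k + 1 *)
Definition codiff k l (E : (k.+1 + l)%N = n) (E' : (l.+1 + k)%N = n)
    (g : V -> V -> V -> R) (vol : V -> kform R R n n)
    (a : V -> kform R R n k.+1) : V -> kform R R n k :=
  fun x v => (-1) ^+ (n * k.+2 + 1) *
    star E' (g x) (vol x)
      (extd (fun y => star E (g y) (vol y) (a y)) x) v.

End Calculus.

Section FormsOnManifolds.
Variables (R : realType) (n : nat) (M : atlas R n).

Definition is_form k (a : field M (kform R R n k)) : Prop :=
  [/\ forall i x, dom i x -> alternating (a i x),
      forall i v, smooth_on (dom i) (fun x => a i x v)
    & forall i j x v, overlap i j x ->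
        a i x v = a j (trans i j x) (fun l => 'D_(v l) (trans i j) x)].

Definition smooth_family k (I : set R) (a : R -> field M (kform R R n k)) :
    Prop :=
  (forall t, I t -> is_form (a t)) /\
  (forall i v, smooth_on (V := (R * 'rV[R]_n)%type) (I `*` dom i)
                 (fun p => a p.1 i p.2 v)).

(* d/dt a = b at time t *)
Definition evolves k (I : set R) (a : R -> field M (kform R R n k)) (t : R)
    (b : field M (kform R R n k)) : Prop :=
  forall i x v, dom i x -> has_ddt I (fun s => a s i x v) t (b i x v).

End FormsOnManifolds.

(* --------------------------- Complex forms ------------------------------ *)

Section ComplexForms.
Variables (R : realType) (n : nat).
Local Notation V := 'rV[R]_n.

Definition cx k (a : kform R R n k) : kform R R[i] n k := fun v => (a v)%:C.
Definition re k (a : kform R R[i] n k) : kform R R n k :=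
  fun v => complex.Re (a v).
Definition im k (a : kform R R[i] n k) : kform R R n k :=
  fun v => complex.Im (a v).
Definition conjf k (a : kform R R[i] n k) : kform R R[i] n k :=
  fun v => ((a v)^*)%C.

Definition extdC k (a : V -> kform R R[i] n k) : V -> kform R R[i] n k.+1 :=
  fun x v => (extd (fun y => re (a y)) x v) +i* (extd (fun y => im (a y)) x v).

(* Endomorphisms J of the tangent space act on row vectors: J v is v *m J. A
   pair (u, w) stands for the complexified vector u + i w. *)
Definition proj10 (J : 'M[R]_n) (v : V) : V * V :=
  (2^-1 *: v, - 2^-1 *: (v *m J)).
Definition proj01 (J : 'M[R]_n) (v : V) : V * V :=
  (2^-1 *: v, 2^-1 *: (v *m J)).

(* complex multilinear extension of a to complexified vectors *)
Definition cext k (a : kform R R[i] n k) (w : 'I_k -> V * V) : R[i] :=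
  \sum_(T : {set 'I_k}) 'i%C ^+ #|T| *
    a (fun j => if j \in T then (w j).2 else (w j).1).

(* The (p, q) component of a: the part of a(v_1, ..., v_k) with p of the
   arguments in T^{1,0} and the q others in T^{0,1}. *)
Definition component (J : 'M[R]_n) (p q : nat) k (a : kform R R[i] n k) :
    kform R R[i] n k :=
  fun v => \sum_(S : {set 'I_k} | (#|S| == p) && (#|~: S| == q))
    cext a (fun j => if j \in S then proj10 J (v j) else proj01 J (v j)).

Definition dbar (J : V -> 'M[R]_n) (p q : nat) k (a : V -> kform R R[i] n k) :
    V -> kform R R[i] n k.+1 :=
  fun x => component (J x) p q.+1 (extdC a x).

End ComplexForms.

Section ComplexStructures.
Variables (R : realType) (n : nat) (M : atlas R n).
Local Notation V := 'rV[R]_n.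

Definition is_cform k (a : field M (kform R R[i] n k)) : Prop :=
  is_form (fun i x => re (a i x)) /\ is_form (fun i x => im (a i x)).

Definition smooth_cfamily k (I : set R) (a : R -> field M (kform R R[i] n k)) :
    Prop :=
  smooth_family I (fun t i x => re (a t i x)) /\
  smooth_family I (fun t i x => im (a t i x)).

Definition evolvesC k (I : set R) (a : R -> field M (kform R R[i] n k)) (t : R)
    (b : field M (kform R R[i] n k)) : Prop :=
  evolves I (fun s i x => re (a s i x)) t (fun i x => re (b i x)) /\
  evolves I (fun s i x => im (a s i x)) t (fun i x => im (b i x)).

Definition almost_complex (J : field M 'M[R]_n) : Prop :=
  [/\ forall i x, dom i x -> J i x *m J i x = - 1%:M,
      forall i a b, smooth_on (dom i) (fun x => J i x a b)
    & forall i j x v, overlap i j x ->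
        'D_v (trans i j) x *m J j (trans i j x) =
        'D_(v *m J i x) (trans i j) x].

Definition nijenhuis (J : V -> 'M[R]_n) (X Y : V -> V) : V -> V :=
  let JX y := X y *m J y in let JY y := Y y *m J y in
  fun x => bracket X Y x + bracket JX Y x *m J x + bracket X JY x *m J x
           - bracket JX JY x.

Definition complex_structure (J : field M 'M[R]_n) : Prop :=
  almost_complex J /\
  forall i X Y, smooth_map_on (dom i) X -> smooth_map_on (dom i) Y ->
    forall x, dom i x -> nijenhuis (J i) X Y x = 0.

Definition kahler_metric (J : 'M[R]_n) (w : kform R R n 2) (u v : V) : R :=
  w (vcons u (fun=> v *m J)).

Definition kahler_form (J : field M 'M[R]_n) (w : field M (kform R R n 2)) :
    Prop :=
  is_form w /\ forall i x, dom i x ->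
    [/\ component (J i x) 1 1 (cx (w i x)) = cx (w i x),
        forall u, u != 0 -> 0 < kahler_metric (J i x) (w i x) u u
      & forall v, extd (w i) x v = 0].

(* nowhere-vanishing holomorphic (p, 0)-form *)
Definition holomorphic_nonvanishing p (J : field M 'M[R]_n)
    (U : field M (kform R R[i] n p)) : Prop :=
  is_cform U /\ forall i x, dom i x ->
    [/\ component (J i x) p 0 (U i x) = U i x,
        forall v, dbar (J i) p 0 (U i) x v = 0
      & exists v, U i x v != 0].

(* L_{grad f} for the gradient of f with respect to the Kahler metric of w *)
Definition lie_grad (J : field M 'M[R]_n) (w : field M (kform R R n 2))
    (f : field M R) k (a : field M (kform R R n k)) : field M (kform R R n k) :=
  fun i => lie (gradient (fun x => kahler_metric (J i x) (w i x)) (f i)) (a i).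

Definition lie_gradC (J : field M 'M[R]_n) (w : field M (kform R R n 2))
    (f : field M R) k (a : field M (kform R R[i] n k)) :
    field M (kform R R[i] n k) :=
  fun i x v => (lie_grad J w f (fun i y => re (a i y)) i x v) +i*
               (lie_grad J w f (fun i y => im (a i y)) i x v).

End ComplexStructures.

(* ------------------------- Calabi-Yau 3-folds --------------------------- *)

Section CalabiYau.
Variables (R : realType) (N : atlas R 6).

Definition calabi_yau (J : field N 'M[R]_6) (w : field N (kform R R 6 2))
    (U : field N (kform R R[i] 6 3)) : Prop :=
  [/\ complex_structure J, kahler_form J w & holomorphic_nonvanishing J U].

(* nu = |U|_w *)
Definition is_norm (w : field N (kform R R 6 2)) (U : field N (kform R R[i] 6 3))
    (nu : field N R) : Prop :=
  forall i x, dom i x -> 0 < nu i x /\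
    forall v : 'I_6 -> 'rV[R]_6,
      (3`!%:R)^-1 *
        wedge (cx (w i x)) (wedge (cx (w i x)) (cx (w i x))) v =
      'i%C / 8 * ((nu i x ^+ 2)^-1)%:C * wedge (U i x) (conjf (U i x)) v.

End CalabiYau.

(* --------------------------- G2-structures ------------------------------ *)

Section G2.
Variables (R : realType) (M : atlas R 7).
Local Notation V := 'rV[R]_7.
Implicit Types (phi : field M (kform R R 7 3)) (g : field M (V -> V -> R))
  (vol : field M (kform R R 7 7)).

(* phi is a G2-structure, with metric g and volume form vol *)
Definition G2_structure phi g vol : Prop :=
  is_form phi /\ forall i x, dom i x ->
    [/\ inner_product (g i x), volume_form (g i x) (vol i x)
      & forall (X Y : V) (v : 'I_7 -> V),
          wedge (contract X (phi i x))
                (wedge (contract Y (phi i x)) (phi i x)) v =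
          6 * g i x X Y * vol i x v].

Definition dual4 phi g vol : field M (kform R R 7 4) :=
  fun i x => @star R 7 3 4 erefl (g i x) (vol i x) (phi i x).

Definition tau0 phi g vol : field M R :=
  fun i x => 7^-1 * @star R 7 7 0 erefl (g i x) (vol i x)
    (wedge (phi i x) (extd (phi i) x)) (fun=> 0).

Definition laplacian4 g vol (a : field M (kform R R 7 4)) :
    field M (kform R R 7 4) :=
  fun i x v =>
    extd (@codiff R 7 3 3 erefl erefl (g i) (vol i) (a i)) x v +
    @codiff R 7 4 2 erefl erefl (g i) (vol i) (extd (a i)) x v.

Definition modified_laplacian_coflow (I : set R) (A : R)
    (phi : R -> field M (kform R R 7 3)) : Prop :=
  exists (g : R -> field M (V -> V -> R)) (vol : R -> field M (kform R R 7 7)),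
    (forall t, I t -> G2_structure (phi t) (g t) (vol t)) /\
    let psi t := dual4 (phi t) (g t) (vol t) in
    let tau t := tau0 (phi t) (g t) (vol t) in
    forall t, I t ->
      evolves I psi t (fun i x v =>
        laplacian4 (g t) (vol t) (psi t) i x v +
        extd (fun y u => (A - 7 / 2 * tau t i y) * phi t i y u) x v).

End G2.

Section Pullbacks.
Variables (R : realType) (m n : nat) (M : atlas R m) (N : atlas R n).

(* pullbacks by the two projections, in product charts *)
Definition pull1 k (a : field M (kform R R m k)) :
    field (prod_atlas M N) (kform R R (m + n) k) :=
  fun p x v => a p.1 (lsubmx x) (fun j => lsubmx (v j)).
Definition pull2 k (a : field N (kform R R n k)) :
    field (prod_atlas M N) (kform R R (m + n) k) :=
  fun p x v => a p.2 (rsubmx x) (fun j => rsubmx (v j)).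

End Pullbacks.

(* r is the parameter of the charts of the circle *)
Definition dr (R : realType) : field (circle R) (kform R R 1 1) :=
  fun _ _ v => v 0 0 0.

(* Re (nu^-1 U) + nu dr /\ w *)
Definition product_phi (R : realType) (N : atlas R 6)
    (w : field N (kform R R 6 2)) (U : field N (kform R R[i] 6 3))
    (nu : field N R) : field (prod_atlas N (circle R)) (kform R R (6 + 1) 3) :=
  fun p x v =>
    pull1 (fun i y => re (fun u => ((nu i y)^-1)%:C * U i y u)) p x v +
    nu p.1 (lsubmx x) *
      wedge (pull2 (@dr R) p x) (pull1 w p x) v.

(* Main.v *)
Require Import Defs.
From Stdlib Require Import ZArith.
From mathcomp Require Import all_boot all_order all_algebra fingroup perm.
From mathcomp Require Import complex ssrZ ring lra zify.
From mathcomp Require Import all_classical all_reals all_analysis.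

(* Let [f = ln |U|] and [X = grad f]. The dual of [phi] is
   [psi = w^2 / 2 - dr /\ Im U], which is closed, and [tau0 = 0]; hence the flow
   reads [d psi / dt = d * d phi + A d phi], with
   [* d phi = - (X _| w) /\ w + dr /\ (X _| Im U)]. By Cartan's formula
   [d * d phi = - (L_X w) /\ w - dr /\ L_X (Im U)], which is what the Lie
   derivatives in the equations for [w] and [U] contribute to [d psi / dt].
   Comparing the remaining terms, [w /\ beta = - A |U|^-1 df /\ Re U] and
   [Im gamma = A |U| df /\ w]. The right-hand sides have no component of type
   [(2, 2)], respectively [(3, 0)] or [(0, 3)], and [w /\ _] is injective on
   [(1, 1)]-forms in complex dimension 3.

   The identities between forms at a point are checked in a unitary frame
   adapted to [w], [U] and [X]. In it the metric of [phi] is the standard one,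
   and Hodge stars are computed from tables of integers. *)

(** Frames and derivatives are kept apart. A frame adapted to the gradient is chosen at one point
    and need not vary smoothly (the gradient may vanish), so nothing is differentiated in it. It
    only turns the stars of [phi], [psi] and [d phi] into frame-free expressions in [w], [U] and
    [grad f], valid over a whole chart; these are then differentiated along constant coordinate
    fields. Three facts not granted by the definitions have to be supplied. [|U|] is given
    pointwise, so its smoothness is extracted from the normalization equation. Holomorphic means
    [dbar U = 0]; the (2,2) part of [dU] vanishes by integrability and its (4,0) part by dimension,
    which makes [U] closed. The metric and the volume form of [phi] are constrained only through
    their product; a comparison of determinants, in which a ninth power equals 1, fixes both. With
    respect to [dr], [psi] splits into a horizontal part that evolves with [w] and a vertical part
    that evolves with [Im U], so the two conclusions decouple. *)

Set Implicit Arguments.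
Unset Strict Implicit.
Unset Printing Implicit Defensive.

Import Order.TTheory GRing.Theory Num.Theory.
Import numFieldNormedType.Exports.

Local Open Scope classical_set_scope.
Local Open Scope complex_scope.
Local Open Scope ring_scope.
Local Notation alternating := Defs.alternating.
Local Notation contract := Defs.contract.

(** * Signs, alternating forms and wedge products *)

(* The arguments of a form as a list, padded with [0]. *)
Definition tv (R : realType) n k (s : seq 'rV[R]_n) : 'I_k -> 'rV[R]_n :=
  fun i => s`_i.
Arguments tv {R n k} s.

Lemma eq_tv (R : realType) n k (v : 'I_k -> 'rV[R]_n) s :
  (forall i : 'I_k, v i = s`_i) -> v = tv s.
Proof. by move=> vs; apply/funext. Qed.

Lemma tv_codom (R : realType) n k (v : 'I_k -> 'rV[R]_n) :
  v = tv [seq v i | i <- enum 'I_k].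
Proof.
by apply: eq_tv => i; rewrite (nth_map i) ?size_enum_ord// nth_ord_enum.
Qed.

(* Coefficients are binary integers, so that [vm_compute] can compare them. *)
Definition zr (K : pzRingType) (z : Z) : K := (int_of_Z z)%:~R.
Arguments zr {K} z : simpl never.

Section ZR.
Variable K : pzRingType.
Lemma zr0 : zr Z0 = 0 :> K. Proof. by []. Qed.
Lemma zr1 : zr (Zpos xH) = 1 :> K. Proof. by []. Qed.
Lemma zrN z : zr (Z.opp z) = - zr z :> K.
Proof. by rewrite /zr (raddfN int_of_Z) mulrNz. Qed.
Lemma zrD y z : zr (Z.add y z) = zr y + zr z :> K.
Proof. by rewrite /zr (raddfD int_of_Z) mulrzDr. Qed.
Lemma zrM y z : zr (Z.mul y z) = zr y * zr z :> K.
Proof. by rewrite /zr (rmorphM int_of_Z) intrM. Qed.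
End ZR.

(* [nins x l] inserts [x] in the sorted list [l] by adjacent transpositions and
   records the sign, which is [0] as soon as two entries coincide. *)
Fixpoint nins (x : nat) (l : seq nat) : Z * seq nat :=
  if l is y :: l' then
    if (x < y)%N then (Zpos xH, x :: l) else
    if x == y then (Z0, x :: l) else
    let: (s, m) := nins x l' in (Z.opp s, y :: m)
  else (Zpos xH, [:: x]).

Fixpoint nsort (l : seq nat) : Z * seq nat :=
  if l is x :: l' then
    let: (s, m) := nsort l' in let: (s', m') := nins x m in (Z.mul s' s, m')
  else (Zpos xH, [::]).

Lemma nins_perm x l : perm_eq (nins x l).2 (x :: l).
Proof.
elim: l => //= y l IH; case: ifP => // _; case: ifP => // _.
case: (nins x l) IH => s m /= IH.
by rewrite -(perm_cons y) in IH; apply: perm_trans IH _; rewrite (perm_catCA [:: y] [:: x] l).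
Qed.

Lemma nins_sorted x l : sorted leq l -> sorted leq (nins x l).2.
Proof.
elim: l => //= y l IH; case: ltnP => /= [xy ->|yx]; first by rewrite ltnW.
case: eqP => [->|xy] /= yl; first by rewrite leqnn.
have := IH (path_sorted yl); have := nins_perm x l.
case: (nins x l) => s m /= mp ms.
rewrite path_sortedE ?ms ?andbT; last exact: leq_trans.
apply/allP => z; rewrite (perm_mem mp) inE => /orP[/eqP->//|zl].
by move: yl; rewrite path_sortedE; [case/andP => /allP/(_ _ zl)|exact: leq_trans].
Qed.

Lemma nsort_sorted l : sorted leq (nsort l).2.
Proof.
elim: l => //= x l; case: (nsort l) => s m /= /(nins_sorted x).
by case: (nins x m).
Qed.

Lemma nsort_perm l : perm_eq (nsort l).2 l.
Proof.
elim: l => //= x l; case: (nsort l) => s m /=.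
have := nins_perm x m; case: (nins x m) => s' m' /= h1 h2.
by apply: perm_trans h1 _; rewrite perm_cons.
Qed.

(** Antisymmetry is asked only for adjacent entries, the moves made by [nins]. The second clause is
    separate because [K] may have 2-torsion. *)
Definition skewl (T : Type) (K : zmodType) k (A : seq T -> K) : Prop :=
  (forall p x y q, size (p ++ x :: y :: q) = k ->
    A (p ++ x :: y :: q) = - A (p ++ y :: x :: q)) /\
  (forall p x q, size (p ++ x :: x :: q) = k -> A (p ++ x :: x :: q) = 0).

Lemma skew_nins (K : pzRingType) (A : seq nat -> K) k p x l :
  skewl k A -> size (p ++ x :: l) = k ->
  A (p ++ x :: l) = zr (nins x l).1 * A (p ++ (nins x l).2).
Proof.
move=> [Asw A0]; elim: l p => [|y l IH] p /=; first by rewrite zr1 mul1r.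
case: ifP => [_|_]; first by rewrite zr1 mul1r.
case: eqP => [-> sz|_ sz]; first by rewrite A0// zr0 mul0r.
rewrite Asw// -cat_rcons IH ?cat_rcons; last first.
  by move: sz; rewrite !size_cat /= => <-; rewrite ?addnS.
by case: (nins x l) => s m /=; rewrite zrN mulNr.
Qed.

Lemma skew_nsort (K : comPzRingType) (A : seq nat -> K) k l :
  skewl k A -> size l = k -> A l = zr (nsort l).1 * A (nsort l).2.
Proof.
move=> skA.
suff H p : size (p ++ l) = k -> A (p ++ l) = zr (nsort l).1 * A (p ++ (nsort l).2).
  by move=> sz; exact: (H [::]).
elim: l p => [|x l IH] p /=; first by rewrite zr1 mul1r.
rewrite -cat_rcons => sz; rewrite IH//; have := perm_size (nsort_perm l).
case: (nsort l) => s m /= szm; rewrite !cat_rcons.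
rewrite (skew_nins (k := k) skA); last first.
  by rewrite -sz !size_cat size_rcons /= szm addnS addSn.
by case: (nins x m) => s' m' /=; rewrite zrM mulrCA mulrA.
Qed.

Definition ordlist n (s : 'S_n) : seq nat := [seq val (s i) | i <- enum 'I_n].

Lemma size_ordlist n (s : 'S_n) : size (ordlist s) = n.
Proof. by rewrite size_map size_enum_ord. Qed.

Lemma nth_ordlist n (s : 'S_n) x (i : 'I_n) : nth x (ordlist s) i = s i.
Proof. by rewrite (nth_map i) ?size_enum_ord// nth_ord_enum. Qed.

Lemma ordlist_perm n (s : 'S_n) : perm_eq (ordlist s) (iota 0 n).
Proof.
rewrite -val_enum_ord /ordlist (map_comp val s); apply: perm_map.
apply: uniq_perm; [by rewrite map_inj_uniq ?enum_uniq//; exact: perm_inj|exact: enum_uniq|].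
by move=> i; rewrite [RHS]mem_enum inE; apply/mapP; exists ((s^-1)%g i); rewrite ?mem_enum ?permKV.
Qed.

Lemma ordlist_inj n : injective (@ordlist n).
Proof.
move=> s t st; apply/permP => i; apply: val_inj.
by rewrite /= -(nth_ordlist s 0%N) st nth_ordlist.
Qed.

Lemma nsort_ordlist n (s : 'S_n) : (nsort (ordlist s)).2 = iota 0 n.
Proof.
apply: (sorted_eq leq_trans anti_leq (nsort_sorted _)) (iota_sorted _ _) _.
exact: perm_trans (nsort_perm _) (ordlist_perm s).
Qed.

(** A test function for [skew_nsort]: this determinant is 1 on [iota 0 n] and the parity on a
    permutation, so the sign computed by [nsort] is the parity. *)
Lemma skew_det (K : comPzRingType) n :
  skewl n (fun l : seq nat => \det (\matrix_(i < n, j < n) ((nth 0 l i == j)%:R : K))).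
Proof.
have ij (p q : seq nat) x y : size (p ++ x :: y :: q) = n ->
    ((size p < n)%N * ((size p).+1 < n)%N)%type.
  by rewrite size_cat /= => <-; split; lia.
split=> [p x y q sz|p x q sz]; have [h1 h2] := ij _ _ _ _ sz.
  set i := Ordinal h1; set j := Ordinal h2; rewrite -mulN1r.
  have -> : (-1 : K) = (-1) ^+ (tperm i j : bool).
    by rewrite odd_tperm -val_eqE /= ltn_eqF// expr1.
  rewrite -det_perm -det_mulmx -row_permE; congr (\det _); apply/matrixP => a b.
  rewrite !mxE !nth_cat; case: tpermP => [->|->|/eqP/negPf ai /eqP/negPf aj] /=.
  - by rewrite ltnn subnn /= ltnNge leqnSn /= subSnn.
  - by rewrite ltnn subnn /= ltnNge leqnSn /= subSnn.
  - case: ltnP => // pa.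
    move: ai aj; rewrite -!val_eqE /= => ai aj.
    case E: (a - size p)%N => [|[|r]] //=.
      by have := eqn_leq a (size p); rewrite ai pa andbT -subn_eq0 E.
    have : (a = (size p).+1 :> nat) by rewrite -(subnKC pa) E addn1.
    by move/eqP; rewrite aj.
apply: (@determinant_alternate _ _ _ (Ordinal h1) (Ordinal h2)).
  by rewrite -val_eqE /= ltn_eqF.
by move=> b; rewrite !mxE /= !nth_cat ltnn subnn ltnNge leqnSn /= subSnn.
Qed.

Lemma sgn_ordlist (K : comPzRingType) n (s : 'S_n) :
  (-1) ^+ s = zr (nsort (ordlist s)).1 :> K.
Proof.
have := skew_nsort (skew_det K n) (size_ordlist s); rewrite nsort_ordlist.
have -> : \matrix_(i < n, j < n) ((nth 0 (iota 0 n) i == j)%:R : K) = 1%:M.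
  by apply/matrixP => i j; rewrite !mxE nth_iota.
rewrite det1 mulr1 => <-; rewrite -det_perm; congr (\det _).
by apply/matrixP => i j; rewrite !mxE nth_ordlist.
Qed.

(** Replaces the sum over the symmetric group in [wedge] by a sum over an explicit list, which can
    be evaluated. *)
Lemma big_permE (K : comPzRingType) n (F : 'S_n -> K) (H : seq nat -> K) :
  (forall s, F s = H (ordlist s)) ->
  \sum_(s : 'S_n) (-1) ^+ s * F s =
  \sum_(l <- permutations (iota 0 n)) zr (nsort l).1 * H l.
Proof.
move=> FH.
have pe : perm_eq [seq ordlist s | s <- index_enum 'S_n] (permutations (iota 0 n)).
  have us : uniq [seq ordlist s | s <- index_enum 'S_n].
    by rewrite map_inj_uniq ?index_enum_uniq//; exact: ordlist_inj.
  have sub : {subset [seq ordlist s | s <- index_enum 'S_n] <= permutations (iota 0 n)}.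
    by move=> l /mapP[s _ ->]; rewrite mem_permutations ordlist_perm.
  apply: uniq_perm => //; first exact: permutations_uniq.
  (* Both lists have [n!] entries, so the inclusion is an equality of sets. *)
  apply: (uniq_min_size us sub _).2.
  rewrite size_permutations ?iota_uniq// size_iota size_map.
  have -> : index_enum {perm (ordinal n)} = enum {perm (ordinal n)} by rewrite enumT /index_enum unlock.
  by rewrite -cardE card_Sn.
rewrite -(perm_big _ pe) big_map; apply: eq_bigr => s _.
by rewrite FH sgn_ordlist.
Qed.

Section AltForms.
Variables (R : realType) (n : nat).
Local Notation V := 'rV[R]_n.

Definition skewf (K : zmodType) k (a : kform R K n k) : Prop :=
  skewl k (fun l : seq V => a (tv l)).

Lemma skew_map (T U : Type) (K : zmodType) k (e : U -> T) (A : seq T -> K) :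
  skewl k A -> skewl k (fun l => A (map e l)).
Proof.
move=> [h1 h2]; split=> [p x y q|p x q] sz; rewrite !map_cat /=.
  by apply: h1; rewrite -sz !size_cat /= !size_map.
by apply: h2; rewrite -sz !size_cat /= !size_map.
Qed.

Lemma alternating_swap k (a : kform R R n k) (v : 'I_k -> V) i j u w :
  alternating a -> i != j ->
  a [eta v with i |-> u, j |-> w] = - a [eta v with i |-> w, j |-> u].
Proof.
move=> [lin alt0] ij.
have ji : (j == i) = false by rewrite eq_sym (negPf ij).
pose f x y := a [eta v with i |-> x, j |-> y].
have fl x x' y : f (x + x') y = f x y + f x' y.
  have fE z : f z y = a [eta [eta v with j |-> y] with i |-> z].
    by [].
  by rewrite !fE -{1}[x]scale1r lin mul1r.
have fr x y y' : f x (y + y') = f x y + f x y'.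
  have fE z : f x z = a [eta [eta v with i |-> x] with j |-> z].
    congr a; apply/funext => l /=; case: (eqVneq l j) => // ->.
    by rewrite ji.
  by rewrite !fE -{1}[y]scale1r lin mul1r.
have f0 x : f x x = 0.
  by apply: (alt0 _ i j) => //=; rewrite eqxx ji; case: eqP.
(* Polarization: expand the zero value with [u + w] in both slots. *)
have := f0 (u + w); rewrite fl !fr !f0 add0r addr0 => /eqP.
by rewrite addr_eq0 => /eqP.
Qed.

Lemma alternating_skewf k (a : kform R R n k) : alternating a -> skewf a.
Proof.
move=> alta.
have ij T (p q : seq T) x y : size (p ++ x :: y :: q) = k ->
    ((size p < k)%N * ((size p).+1 < k)%N)%type.
  by rewrite size_cat /= => <-; split; lia.
split=> [p x y q sz|p x q sz]; have [h1 h2] := ij _ _ _ _ _ sz.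
  have ne : Ordinal h1 != Ordinal h2 by rewrite -val_eqE /= ltn_eqF.
  have E u w : a (tv (p ++ u :: w :: q)) =
      a [eta tv (p ++ x :: y :: q) with Ordinal h1 |-> u, Ordinal h2 |-> w].
    congr a; apply/funext => i; rewrite /tv /= -!val_eqE /= !nth_cat.
    case: (eqVneq (i : nat) (size p)) => [->|ip]; first by rewrite ltnn subnn.
    case: (eqVneq (i : nat) (size p).+1) => [->|ip1].
      by rewrite ltnNge leqnSn /= subSnn.
    case: ltnP => // pi; case D: (i - size p)%N => [|[|d]] //; lia.
  by rewrite !E; exact: alternating_swap.
apply: (alta.2 _ (Ordinal h1) (Ordinal h2)).
  by rewrite -val_eqE /= ltn_eqF.
by rewrite /tv /= !nth_cat ltnn subnn ltnNge leqnSn /= subSnn.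
Qed.

Lemma sort_skewf (K : comPzRingType) k (a : kform R K n k) (vs : seq V) l :
  skewf a -> size l = k ->
  a (tv [seq vs`_i | i <- l]) =
    zr (nsort l).1 * a (tv [seq vs`_i | i <- (nsort l).2]).
Proof.
by move=> sa sz; exact: (skew_nsort (skew_map (nth 0 vs) sa) sz).
Qed.

Lemma wedge_list (K : fieldType) k l (a : kform R K n k) (b : kform R K n l) vs :
  wedge a b (tv vs) = (k`!%:R * l`!%:R)^-1 *
    \sum_(p <- permutations (iota 0 (k + l))) zr (nsort p).1 *
      (a (tv [seq vs`_i | i <- take k p]) * b (tv [seq vs`_i | i <- drop k p])).
Proof.
rewrite /wedge; congr (_ * _); rewrite -(big_permE
  (F := fun s => a (fun j => tv vs (s (lshift l j))) * b (fun j => tv vs (s (rshift k j))))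
  (H := fun p => a (tv [seq vs`_i | i <- take k p]) * b (tv [seq vs`_i | i <- drop k p])))//.
move=> s; congr (a _ * b _); apply: eq_tv => i; rewrite /tv.
  rewrite (nth_map 0%N) ?size_take ?size_ordlist ?nth_take//.
    by rewrite (nth_ordlist s 0%N (lshift l i)).
  by move: (ltn_ord i); case: (ltnP k (k + l)%N) => // kl ik; apply: (leq_trans ik); lia.
rewrite (nth_map 0%N) ?size_drop ?size_ordlist ?addKn// nth_drop.
by rewrite (nth_ordlist s 0%N (rshift k i)).
Qed.

Lemma wedge_sort (K : fieldType) k l (a : kform R K n k) (b : kform R K n l) vs :
  skewf a -> skewf b ->
  wedge a b (tv vs) = (k`!%:R * l`!%:R)^-1 *
    \sum_(p <- [seq let s := nsort (take k p) in let t := nsort (drop k p) in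
                  (Z.mul (nsort p).1 (Z.mul s.1 t.1), s.2, t.2)
               | p <- permutations (iota 0 (k + l))])
      zr p.1.1 * (a (tv [seq vs`_i | i <- p.1.2]) * b (tv [seq vs`_i | i <- p.2])).
Proof.
move=> sa sb; rewrite wedge_list; congr (_ * _); rewrite big_map.
apply: eq_big_seq => p; rewrite mem_permutations => /perm_size.
rewrite size_iota => szp.
have h1 : size (take k p) = k by rewrite size_takel// szp leq_addr.
have h2 : size (drop k p) = l by rewrite size_drop szp addKn.
rewrite [a _](sort_skewf vs sa h1) [b _](sort_skewf vs sb h2).
case: (nsort p) (nsort (take k p)) (nsort (drop k p)) => [x ?] [y ?] [z ?].
by rewrite /= !zrM -!mulrA; congr (_ * (_ * _)); rewrite mulrCA.
Qed.

Definition multilinear k (a : kform R R n k) : Prop :=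
  forall (v : 'I_k -> V) j (c : R) (u w : V),
     a [eta v with j |-> c *: u + w] =
     c * a [eta v with j |-> u] + a [eta v with j |-> w].

Lemma wedge_perm (K : fieldType) k l (a : kform R K n k) (b : kform R K n l)
    (v : 'I_(k + l) -> V) (t : 'S_(k + l)) :
  wedge a b (v \o t) = (-1) ^+ t * wedge a b v.
Proof.
rewrite /wedge mulrCA; congr (_ * _); rewrite big_distrr /=.
rewrite (reindex_inj (mulIg (t^-1)%g)) /=; apply: eq_bigr => s _.
rewrite odd_permM odd_permV signr_addb [RHS]mulrA [X in _ = X * _]mulrC.
congr (_ * _ * (a _ * b _)); apply/funext => j /=; by rewrite permM permKV.
Qed.

Lemma wedge_alternating k l (a : kform R R n k) (b : kform R R n l) :
  alternating a -> alternating b -> alternating (wedge a b).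
Proof.
move=> [la a0] [lb b0]; split=> [v j c u w|v i j ij vij]; last first.
  have := wedge_perm a b v (tperm i j); rewrite odd_tperm ij expr1.
  have -> : v \o tperm i j = v.
    by apply/funext => m /=; case: tpermP => [->|->|].
  by move=> h; apply/eqP; rewrite -[_ == _](mulrn_eq0 _ 2) mulr2n {1}h mulN1r addNr.
rewrite /wedge [X in _ = X + _]mulrCA -mulrDr; congr (_ * _).
rewrite big_distrr -big_split /=; apply: eq_bigr => s _.
rewrite [X in _ = X + _]mulrCA -mulrDr; congr (_ * _).
have sE (i i' : 'I_(k + l)) : (s i == s i') = (i == i') by rewrite (inj_eq perm_inj).
have lr i i' : (lshift l i == rshift k i') = false by rewrite eq_lrshift.
(* For each permutation [s] the slot [j] feeds exactly one of the two factors. *)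
have [[i ->]|[i ->]] : (exists i, j = s (lshift l i)) \/ (exists i, j = s (rshift k i)).
- have : j = s ((s^-1)%g j) by rewrite permKV.
  move: ((s^-1)%g j) => m ->; have := splitK m.
  by case: fintype.split => i /= <-; [left|right]; exists i.
- have A z : (fun j0 => [eta v with s (lshift l i) |-> z] (s (lshift l j0))) =
      [eta (fun j0 => v (s (lshift l j0))) with i |-> z].
    by apply/funext => j0; rewrite /= sE (inj_eq (@lshift_inj _ _)).
  have B z : (fun j0 => [eta v with s (lshift l i) |-> z] (s (rshift k j0))) =
      (fun j0 => v (s (rshift k j0))).
    by apply/funext => j0; rewrite /= sE eq_sym lr.
  by rewrite !A !B la mulrDl mulrA.
- have A z : (fun j0 => [eta v with s (rshift k i) |-> z] (s (rshift k j0))) =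
      [eta (fun j0 => v (s (rshift k j0))) with i |-> z].
    by apply/funext => j0; rewrite /= sE (inj_eq (@rshift_inj _ _)).
  have B z : (fun j0 => [eta v with s (rshift k i) |-> z] (s (lshift l j0))) =
      (fun j0 => v (s (lshift l j0))).
    by apply/funext => j0; rewrite /= sE lr.
  by rewrite !A !B lb mulrDr mulrCA.
Qed.

Lemma alternatingD k (a b : kform R R n k) : alternating a -> alternating b ->
  alternating (fun v => a v + b v).
Proof.
move=> [la a0] [lb b0]; split=> [v j c u w|v i j ij vij].
  by rewrite la lb mulrDr addrACA.
by rewrite (a0 _ i j)// (b0 _ i j)// addr0.
Qed.

Lemma alternatingZ k c (a : kform R R n k) : alternating a ->
  alternating (fun v => c * a v).
Proof.
move=> [la a0]; split=> [v j d u w|v i j ij vij].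
  by rewrite la mulrDr mulrCA.
by rewrite (a0 _ i j)// mulr0.
Qed.

Lemma alternating0 k : alternating (fun _ : 'I_k -> V => 0 : R).
Proof. by split=> [v j c u w|//]; rewrite mulr0 addr0. Qed.

Lemma alternating_contract k X (a : kform R R n k.+1) : alternating a ->
  alternating (contract X a).
Proof.
move=> [la a0]; split=> [v j c u w|v i j ij vij].
  have A z : vcons X [eta v with j |-> z] = [eta vcons X v with lift ord0 j |-> z].
    apply/funext => i; rewrite /vcons /=; case: (unliftP ord0 i) => [i' ->|->] /=.
      by rewrite (inj_eq (@lift_inj _ _)).
    by [].
  by rewrite /contract !A la.
apply: (a0 _ (lift ord0 i) (lift ord0 j)); first by rewrite (inj_eq (@lift_inj _ _)).
by rewrite /vcons !liftK.
Qed.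

End AltForms.

Lemma alternating_pull (R : realType) m n k (L : 'rV[R]_m -> 'rV[R]_n)
    (a : kform R R n k) :
  (forall c u v, L (c *: u + v) = c *: L u + L v) ->
  alternating a -> alternating (fun v => a (fun i => L (v i))).
Proof.
move=> LL [la a0]; split=> [v j c u w|v i j ij vij].
  have A z : (fun i => L ([eta v with j |-> z] i)) =
      [eta (fun i => L (v i)) with j |-> L z].
    by apply/funext => i /=; case: ifP.
  by rewrite !A LL la.
by apply: (a0 _ i j) => //; rewrite vij.
Qed.

(** * The Hodge star in an orthonormal frame *)

(** Each shuffle occurs [k! l!] times, once for every order of its two blocks; these repetitions
    cancel the normalization of [wedge]. *)
Definition shuffles k l : seq (Z * seq nat * seq nat) :=
  [seq let s := nsort (take k p) in let t := nsort (drop k p) in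
       (Z.mul (nsort p).1 (Z.mul s.1 t.1), s.2, t.2)
  | p <- permutations (iota 0 (k + l))].

Ltac vm_rewrite t :=
  let L := eval vm_compute in t in
  rewrite (_ : t = L); last (by vm_compute).

Lemma zrm1 (K : pzRingType) : zr (Zneg xH) = -1 :> K. Proof. by []. Qed.

Section Wedges.
Variables (R : realType) (n : nat).
Local Notation V := 'rV[R]_n.

Lemma wedge12 (a : kform R R n 1) (b : kform R R n 2) x y z :
  alternating a -> alternating b ->
  wedge a b (tv [:: x; y; z]) = a (tv [:: x]) * b (tv [:: y; z])
    - a (tv [:: y]) * b (tv [:: x; z]) + a (tv [:: z]) * b (tv [:: x; y]).
Proof.
move=> /alternating_skewf sa /alternating_skewf sb.
rewrite wedge_sort// -/(shuffles 1 2); vm_rewrite (shuffles 1 2).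
rewrite !big_cons big_nil /= !(zr1, zrm1, factS, fact0) ?muln1; by field.
Qed.

Lemma wedge13 (a : kform R R n 1) (b : kform R R n 3) x y z t :
  alternating a -> alternating b ->
  wedge a b (tv [:: x; y; z; t]) = a (tv [:: x]) * b (tv [:: y; z; t])
    - a (tv [:: y]) * b (tv [:: x; z; t]) + a (tv [:: z]) * b (tv [:: x; y; t])
    - a (tv [:: t]) * b (tv [:: x; y; z]).
Proof.
move=> /alternating_skewf sa /alternating_skewf sb.
rewrite wedge_sort// -/(shuffles 1 3); vm_rewrite (shuffles 1 3).
rewrite !big_cons big_nil /= !(zr1, zrm1, factS, fact0) ?muln1; by field.
Qed.

Lemma wedge22 (a b : kform R R n 2) x y z t :
  alternating a -> alternating b ->
  wedge a b (tv [:: x; y; z; t]) =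
    a (tv [:: x; y]) * b (tv [:: z; t]) - a (tv [:: x; z]) * b (tv [:: y; t])
    + a (tv [:: x; t]) * b (tv [:: y; z]) + a (tv [:: y; z]) * b (tv [:: x; t])
    - a (tv [:: y; t]) * b (tv [:: x; z]) + a (tv [:: z; t]) * b (tv [:: x; y]).
Proof.
move=> /alternating_skewf sa /alternating_skewf sb.
rewrite wedge_sort// -/(shuffles 2 2); vm_rewrite (shuffles 2 2).
rewrite !big_cons big_nil /= !(zr1, zrm1, factS, fact0) ?muln1; by field.
Qed.
End Wedges.

Section Words.
Variables (T : finType) (K : nmodType).

Definition fcons k (p : T * {ffun 'I_k -> T}) : {ffun 'I_k.+1 -> T} :=
  [ffun j => oapp p.2 p.1 (unlift ord0 j)].

Lemma big_ffunS k (F : {ffun 'I_k.+1 -> T} -> K) :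
  \sum_f F f = \sum_i \sum_f F (fcons (i, f)).
Proof.
rewrite pair_bigA /= (reindex (@fcons k)) /=; first by apply: eq_bigr => -[].
exists (fun h : {ffun 'I_k.+1 -> T} => (h ord0, [ffun j => h (lift ord0 j)])).
  move=> [i f] _; congr (_, _); first by rewrite ffunE unlift_none.
  by apply/ffunP => j; rewrite !ffunE liftK.
move=> h _; apply/ffunP => j; rewrite ffunE /=.
by case: (unliftP ord0 j) => [j' ->|->] //=; rewrite ffunE.
Qed.
End Words.

Fixpoint words k n : seq (seq nat) :=
  if k is k'.+1 then [seq i :: l | i <- iota 0 n, l <- words k' n]
  else [:: [::]].

Lemma big_words (K : nmodType) k n (H : seq nat -> K) :
  \sum_(f : {ffun 'I_k -> 'I_n}) H [seq val (f j) | j <- enum 'I_k] =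
  \sum_(l <- words k n) H l.
Proof.
elim: k H => [|k IH] H /=.
  rewrite big_seq1 (eq_bigr (fun=> H [::])) => [|f _]; last first.
    by rewrite (size0nil (size_enum_ord 0)).
  by rewrite big_const card_ffun !card_ord expn0 /= addr0.
rewrite big_ffunS big_allpairs_dep -[n in iota 0 n]subn0 -/(index_iota 0 n) big_mkord.
apply: eq_bigr => i _; rewrite -IH; apply: eq_bigr => f _; congr H.
rewrite enum_ordSl /= ffunE unlift_none /=; congr (_ :: _).
by rewrite -map_comp; apply: eq_map => j /=; rewrite ffunE liftK.
Qed.

Section Star.
Variables (R : realType) (n : nat).
Local Notation V := 'rV[R]_n.

Lemma multilinear_sum k (a : kform R R n k) v j (I : Type) (r : seq I)
    (c : I -> R) (w : I -> V) : multilinear a ->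
  a [eta v with j |-> \sum_(i <- r) c i *: w i] =
  \sum_(i <- r) c i * a [eta v with j |-> w i].
Proof.
move=> la; elim: r => [|i r IH]; last by rewrite !big_cons la IH.
rewrite !big_nil; have := la v j (-1) 0 0.
by rewrite scaler0 addr0 mulN1r addNr.
Qed.

Lemma multilinear_contract k X (a : kform R R n k.+1) : multilinear a ->
  multilinear (contract X a).
Proof.
move=> la v j c u w.
have A z : vcons X [eta v with j |-> z] = [eta vcons X v with lift ord0 j |-> z].
  apply/funext => i; rewrite /vcons /=; case: (unliftP ord0 i) => [i' ->|->] /=; last by [].
  by rewrite (inj_eq (@lift_inj _ _)).
by rewrite /contract !A la.
Qed.

Lemma multilinear_expand k (a : kform R R n k) (I : finType)
    (c : 'I_k -> I -> R) (e : I -> V) : multilinear a ->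
  a (fun j => \sum_i c j i *: e i) =
  \sum_(h : {ffun 'I_k -> I}) (\prod_j c j (h j)) * a (fun j => e (h j)).
Proof.
elim: k a c => [|k IH] a c la.
  rewrite (eq_bigr (fun=> a (fun=> 0))) => [|h _]; last first.
    by rewrite big_ord0 mul1r; congr a; apply/funext => -[].
  rewrite big_const card_ffun card_ord expn0 /= addr0.
  by congr a; apply/funext => -[].
have -> : (fun j => \sum_i c j i *: e i) =
    [eta (fun j => \sum_i c j i *: e i) with ord0 |-> \sum_i c ord0 i *: e i].
  by apply/funext => j /=; case: eqP => // ->.
rewrite multilinear_sum// big_ffunS; apply: eq_bigr => i _.
have -> : [eta (fun j => \sum_i c j i *: e i) with ord0 |-> e i] =
    vcons (e i) (fun j : 'I_k => \sum_i c (lift ord0 j) i *: e i) :> ('I_k.+1 -> V).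
  apply/funext => j /=; rewrite /vcons.
  by case: (unliftP ord0 j) => [j' ->|->].
have := IH (contract (e i) a) (fun j => c (lift ord0 j)) (multilinear_contract (e i) la).
rewrite {1}/contract => ->; rewrite big_distrr; apply: eq_bigr => f _ /=.
rewrite big_ord_recl ffunE unlift_none /= -mulrA; congr (_ * (_ * _)).
  by apply: eq_bigr => j _; rewrite ffunE liftK.
rewrite /contract; congr a; apply/funext => j; rewrite /vcons ffunE /=.
by case: (unlift ord0 j).
Qed.

Lemma rV_ebase (v : V) : v = \sum_i v 0 i *: ebase R i.
Proof. by rewrite {1}[v]row_sum_delta. Qed.

Section Frame.
Variables (g : V -> V -> R) (E : 'I_n -> V).
Hypothesis gip : inner_product g.
Hypothesis gE : forall i j, g (E i) (E j) = (i == j)%:R.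

Definition frame_mx : 'M[R]_n := \matrix_(i, j) E i 0 j.

Lemma gram_bilin u v : g u v = (u *m gram g *m v^T) 0 0.
Proof.
case: gip => gl gs _.
have g0 w : g 0 w = 0.
  by have := gl (-1) 0 0 w; rewrite scaler0 addr0 mulN1r addNr.
have gsum (c : 'I_n -> R) (e : 'I_n -> V) w :
    g (\sum_i c i *: e i) w = \sum_i c i * g (e i) w.
  by elim/big_rec2: _ => [|i x y _ <-]; rewrite ?g0// gl.
rewrite {1}[u]rV_ebase {1}[v]rV_ebase gsum mxE.
under eq_bigr do rewrite gs gsum.
under eq_bigr do rewrite mulr_sumr; rewrite exchange_big; apply: eq_bigr => j _ /=.
rewrite !mxE big_distrl; apply: eq_bigr => i _ /=.
by rewrite !mxE gs; ring.
Qed.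

Lemma frame_gram : frame_mx *m gram g *m frame_mx^T = 1%:M.
Proof.
apply/matrixP => i j; rewrite [RHS]mxE -gE gram_bilin [LHS]mxE [RHS]mxE; apply: eq_bigr => k _.
rewrite !mxE; congr (_ * _).
by apply: eq_bigr => l _; rewrite !mxE.
Qed.

(** The relation [P G P^T = 1] for the frame matrix [P] exhibits [P^T P] as an inverse of the Gram
    matrix [G]. *)
Lemma frame_invgram : invmx (gram g) = frame_mx^T *m frame_mx.
Proof.
have := frame_gram; rewrite -mulmxA => /mulmx1C h.
have uG : gram g \in unitmx.
  by apply: (mulmx1_unit (_ : gram g *m (frame_mx^T *m frame_mx) = 1%:M)).1; rewrite mulmxA.
by rewrite -[RHS]mul1mx -(mulVmx uG) -mulmxA (mulmxA (gram g)) h mulmx1.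
Qed.

(** The inverse Gram matrix is [P^T P], so the product of its entries splits into two multilinear
    expansions of frame vectors, one absorbed by [a] and one by [vol]. No metric coefficient is
    left. *)
Lemma star_frame k l (Ekl : (k + l)%N = n) vol (a : kform R R n k) w :
  alternating a -> alternating vol ->
  star Ekl g vol a w = (k`!%:R)^-1 * \sum_(f : {ffun 'I_k -> 'I_n})
    a (fun j => E (f j)) *
    vol (fun i => vcat (fun j => E (f j)) w (cast_ord (esym Ekl) i)).
Proof.
move=> [la _] [lvol _]; rewrite /star; congr (_ * _); apply: esym.
pose b : kform R R n k := fun v => vol (fun i => vcat v w (cast_ord (esym Ekl) i)).
have lb : multilinear b.
  move=> v j c x y; rewrite /b.
  have A z : (fun i => vcat [eta v with j |-> z] w (cast_ord (esym Ekl) i)) =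
      [eta (fun i => vcat v w (cast_ord (esym Ekl) i)) with
        cast_ord Ekl (lshift l j) |-> z].
    apply/funext => i /=; rewrite /vcat -(inj_eq (@cast_ord_inj _ _ (esym Ekl))) cast_ordK.
    case: (fintype.splitP (cast_ord (esym Ekl) i)) => m /= im.
      by rewrite -!val_eqE /= im.
    by rewrite -val_eqE /= im; case: eqP => // ?; have := ltn_ord j; lia.
  by rewrite !A lvol.
have Ee i : E i = \sum_m frame_mx i m *: ebase R m.
  by rewrite {1}[E i]rV_ebase; apply: eq_bigr => m _; rewrite mxE.
pose P := frame_mx.
transitivity (\sum_(f : {ffun 'I_k -> 'I_n})
   (\sum_(h : {ffun 'I_k -> 'I_n}) (\prod_j P (f j) (h j)) * a (fun j => ebase R (h j))) *
   (\sum_(h : {ffun 'I_k -> 'I_n}) (\prod_j P (f j) (h j)) * b (fun j => ebase R (h j)))).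
  apply: eq_bigr => f _; rewrite -!(multilinear_expand (fun j => P (f j)))//.
  by congr (a _ * b _); apply/funext => j; exact: Ee.
under eq_bigr do rewrite big_distrl /=.
rewrite exchange_big; apply: eq_bigr => x _ /=.
under eq_bigr do rewrite big_distrr /=.
rewrite exchange_big; apply: eq_bigr => y _ /=.
rewrite frame_invgram.
under [in RHS]eq_bigr do rewrite mxE.
rewrite bigA_distr_bigA /= -mulrA big_distrl /=; apply: eq_bigr => f _.
rewrite mulrACA -big_split /=; congr (_ * _).
by apply: eq_bigr => j _; rewrite [in RHS]mxE.
Qed.

End Frame.
End Star.

Definition zsum (T : Type) (r : seq T) (F : T -> Z) : Z :=
  foldr (fun x z => Z.add (F x) z) Z0 r.

(* A notation, because a function would evaluate [B] even when [A] is [0]. *)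
Notation lazy_mul A B := (if A is Z0 then Z0 else Z.mul A B).

Lemma lazy_mulE A B : lazy_mul A B = Z.mul A B.
Proof. by case: A. Qed.

Lemma zr_zsum (K : pzRingType) (T : Type) (r : seq T) (F : T -> Z) :
  zr (zsum r F) = \sum_(x <- r) zr (F x) :> K.
Proof. by elim: r => [|x r IH]; rewrite ?big_nil //= big_cons -IH -zrD. Qed.

Lemma wordsP k n l : reflect (size l = k /\ {in l, forall i, (i < n)%N}) (l \in words k n).
Proof.
elim: k l => [|k IH] l /=.
  rewrite inE; apply: (iffP eqP) => [->//|[]]; by case: l.
apply: (iffP allpairsP) => [[[i m]] /= [+ /IH[<- lt] ->]|].
  rewrite mem_iota /= => ln; split=> // j; rewrite inE => /orP[/eqP->|]//.
  exact: lt.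
case: l => [[]//|i m] [[sm] lt]; exists (i, m); split => //=.
  by rewrite mem_iota /=; apply: lt; rewrite mem_head.
by apply/IH; split=> // j jm; apply: lt; rewrite inE jm orbT.
Qed.

Arguments words : simpl never.

(** The Levi-Civita symbol. *)
Definition eps n (l : seq nat) : Z :=
  let: (s, m) := nsort l in if m == iota 0 n then s else Z0.

(** A sparse list of entries: most components of the forms below vanish, and the star sums run over
    the others only. *)
Definition nonzero_entries n k (A : seq nat -> Z) : seq (seq nat * Z) :=
  [seq q <- [seq (p, A p) | p <- words k n] | q.2 != Z0].

Section Tables.
Variables (R : realType) (n : nat).
Local Notation V := 'rV[R]_n.
Variables E : nat -> V.

Lemma alternating_not_uniq k (a : kform R R n k) l :
  alternating a -> size l = k -> ~~ uniq l -> a (tv (map E l)) = 0.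
Proof.
move=> [_ a0] sl /(uniqPn 0%N)[i [j [ij jl eij]]].
have il := ltn_trans ij jl; have [ik jk] : (i < k)%N * (j < k)%N by rewrite -sl.
apply: (a0 _ (Ordinal ik) (Ordinal jk)); first by rewrite -val_eqE /= ltn_eqF.
by rewrite /tv /= !(nth_map 0%N)// eij.
Qed.

Lemma alternating_top (vol : kform R R n n) l : alternating vol ->
  l \in words n n -> vol (tv (map E l)) = zr (eps n l) * vol (tv (map E (iota 0 n))).
Proof.
move=> avol /wordsP[szl ltl].
have := skew_nsort (skew_map E (alternating_skewf avol)) szl.
have := nsort_perm l; have := nsort_sorted l; rewrite /eps.
case: (nsort l) => s m /= sm pm ->; case: eqP => [->//|mN].
rewrite zr0 mul0r alternating_not_uniq ?mulr0 ?(perm_size pm)//.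
(* A sorted list of [n] distinct indices below [n] is [iota 0 n], so any other list has a
   repetition. *)
apply/negP => um; apply: mN; apply: (sorted_eq leq_trans anti_leq sm (iota_sorted _ _)).
have sub : {subset m <= iota 0 n}.
  by move=> i; rewrite (perm_mem pm) mem_iota => /ltl.
apply: uniq_perm => //; first exact: iota_uniq.
by apply: (uniq_min_size um sub _).2; rewrite size_iota (perm_size pm) szl.
Qed.

Lemma tv_map k (v : 'I_k -> V) (e : 'I_k -> nat) :
  (forall j, v j = E (e j)) -> v = tv (map E [seq e j | j <- enum 'I_k]).
Proof.
by move=> vE; rewrite [LHS]tv_codom -map_comp; congr tv; apply: eq_map => j; rewrite vE.
Qed.

Lemma words_map k (f : 'I_k -> 'I_n) : [seq val (f j) | j <- enum 'I_k] \in words k n.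
Proof.
apply/wordsP; split; first by rewrite size_map size_enum_ord.
by move=> i /mapP[j _ ->]; exact: ltn_ord.
Qed.

Lemma form_words_eq k (a b : kform R R n k) :
  multilinear a -> multilinear b ->
  (forall v : V, exists c : 'I_n -> R, v = \sum_i c i *: E i) ->
  {in words k n, forall l, a (tv (map E l)) = b (tv (map E l))} ->
  forall v, a v = b v.
Proof.
move=> la lb bas ab v.
have [c cE] := choice (fun j => bas (v j)).
have -> : v = fun j => \sum_i c j i *: E i by apply/funext => j; rewrite -cE.
rewrite (multilinear_expand c (fun i : 'I_n => E i) la).
rewrite (multilinear_expand c (fun i : 'I_n => E i) lb); apply: eq_bigr => h _.
have -> : (fun j => E (h j)) = tv (map E [seq val (h j) | j <- enum 'I_k]).
  exact: tv_map.
by rewrite ab//; exact: words_map.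
Qed.

Variables (g : V -> V -> R).
Hypothesis gip : inner_product g.
Hypothesis gE : forall i j : 'I_n, g (E i) (E j) = (i == j)%:R.

Lemma frame_basis (v : V) : exists c : 'I_n -> R, v = \sum_i c i *: E i.
Proof.
have h := frame_gram gip gE; have u := (mulmx1_unit h).2.
rewrite unitmx_tr in u.
pose c := v *m invmx (frame_mx (fun i : 'I_n => E i)).
exists (c 0); rewrite -[LHS](mulmxKV u) -/c; apply/rowP => j.
by rewrite mxE summxE; apply: eq_bigr => i _; rewrite !mxE.
Qed.

(** The factor [1/k!] of the star is left out to stay in the integers. *)
Definition star_tab k (A : seq nat -> Z) (w : seq nat) : Z :=
  zsum (nonzero_entries n k A) (fun q => Z.mul q.2 (eps n (q.1 ++ w))).

Lemma star_tabE k l (Ekl : (k + l)%N = n) vol (a : kform R R n k) A c w :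
  alternating a -> alternating vol -> vol (tv (map E (iota 0 n))) = 1 ->
  {in words k n, forall p, a (tv (map E p)) = c * zr (A p)} ->
  w \in words l n ->
  star Ekl g vol a (tv (map E w)) = (k`!%:R)^-1 * (c * zr (star_tab k A w)).
Proof.
move=> aa avol vol1 aA wl.
rewrite (star_frame gip gE)//; congr (_ * _).
have -> : zr (star_tab k A w) =
    \sum_(p <- words k n) zr (A p) * zr (eps n (p ++ w)) :> R.
  rewrite /star_tab zr_zsum /nonzero_entries big_filter big_map big_mkcond.
  by apply: eq_bigr => p _ /=; case: eqP => [->|_]; rewrite ?zr0 ?mul0r ?zrM.
rewrite mulr_sumr; under [RHS]eq_bigr do rewrite mulrA.
rewrite -(big_words k n (fun p => c * zr (A p) * zr (eps n (p ++ w)))).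
apply: eq_bigr => f _.
set p := [seq val (f j) | j <- enum 'I_k].
have pk : p \in words k n := words_map f.
have -> : (fun j => E (f j)) = tv (map E p) by apply: tv_map.
rewrite aA//; congr (_ * _); rewrite -[RHS]mulr1 -vol1 -alternating_top//; last first.
  move/wordsP: pk => [sp ltp]; move/wordsP: wl => [sw ltw]; apply/wordsP.
  rewrite size_cat sp sw; split => // i; rewrite mem_cat => /orP[/ltp|/ltw]//.
congr vol; apply: eq_tv => i; rewrite /vcat map_cat nth_cat size_map.
move/wordsP: pk => [-> _].
by case: fintype.splitP => j /= ->; rewrite ?ltn_ord// ltnNge leq_addr /= addKn.
Qed.

End Tables.

Lemma wedge_frame (R : realType) n (K : fieldType) k l (a : kform R K n k)
    (b : kform R K n l) (E : nat -> 'rV[R]_n) (s : seq nat) : size s = (k + l)%N ->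
  wedge a b (tv (map E s)) = (k`!%:R * l`!%:R)^-1 *
    \sum_(p <- permutations (iota 0 (k + l))) zr (nsort p).1 *
      (a (tv (map E [seq nth 0%N s i | i <- take k p])) *
       b (tv (map E [seq nth 0%N s i | i <- drop k p]))).
Proof.
move=> szs; rewrite wedge_list; congr (_ * _); apply: eq_big_seq => p.
rewrite mem_permutations => pi.
have A (q : seq nat) : {subset q <= p} ->
    [seq (map E s)`_i | i <- q] = map E [seq nth 0%N s i | i <- q].
  move=> qp; rewrite -map_comp; apply/eq_in_map => i /qp.
  by rewrite (perm_mem pi) mem_iota => /= ilt; rewrite (nth_map 0%N) ?szs.
by rewrite !A// => i; [exact: mem_drop|exact: mem_take].
Qed.

Fixpoint assoc (T : seq (seq nat * Z)) (l : seq nat) : Z :=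
  if T is (m, z) :: T' then if m == l then z else assoc T' l else Z0.

Definition tab (T : seq (seq nat * Z)) (l : seq nat) : Z :=
  let: (s, m) := nsort l in Z.mul s (assoc T m).

(** * Integer tables of the flat model *)

(* The standard [SU(3)]-structure on [R^6 = C^3], with complex coordinates
   [x0 + i x1], [x2 + i x3], [x4 + i x5]. *)
Definition omega_table : seq (seq nat * Z) :=
  [:: ([:: 0; 1], Zpos xH); ([:: 2; 3], Zpos xH); ([:: 4; 5], Zpos xH)]%N.
Definition re_table : seq (seq nat * Z) := [:: ([:: 0; 2; 4], Zpos xH); ([:: 0; 3; 5], Zneg xH);
  ([:: 1; 2; 5], Zneg xH); ([:: 1; 3; 4], Zneg xH)]%N.
Definition im_table : seq (seq nat * Z) := [:: ([:: 0; 2; 5], Zpos xH); ([:: 0; 3; 4], Zpos xH);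
  ([:: 1; 2; 4], Zpos xH); ([:: 1; 3; 5], Zneg xH)]%N.
Definition omega0 := tab omega_table.
Definition re0 := tab re_table.
Definition im0 := tab im_table.

Definition ind0 (i j : nat) : Z := if i == j then Zpos xH else Z0.

Local Notation "a +z b" := (Z.add a b) (at level 50, left associativity).
Local Notation "a -z b" := (Z.sub a b) (at level 50, left associativity).
Local Notation "a *z b" := (Z.mul a b) (at level 40, left associativity).

(* [phi], [psi], [d phi / lam] and [*d phi / lam] in a frame where [e_0] is
   [grad f / lam] and [e_6] is [d_r / nu]. *)
Definition phi0 (l : seq nat) : Z := if l is [:: i; j; k] then
  re0 l +z (ind0 6 i *z omega0 [:: j; k] -z ind0 6 j *z omega0 [:: i; k]
            +z ind0 6 k *z omega0 [:: i; j]) else Z0.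

Definition psi0 (l : seq nat) : Z := if l is [:: i; j; k; m] then
  omega0 [:: i; j] *z omega0 [:: k; m] -z omega0 [:: i; k] *z omega0 [:: j; m]
  +z omega0 [:: i; m] *z omega0 [:: j; k]
  -z (ind0 6 i *z im0 [:: j; k; m] -z ind0 6 j *z im0 [:: i; k; m]
      +z ind0 6 k *z im0 [:: i; j; m] -z ind0 6 m *z im0 [:: i; j; k]) else Z0.

Definition dphi0 (l : seq nat) : Z := if l is [:: i; j; k; m] then
  let u i j k := re0 [:: i; j; k] in
  let o i j k := ind0 6 i *z omega0 [:: j; k] -z ind0 6 j *z omega0 [:: i; k]
            +z ind0 6 k *z omega0 [:: i; j] in
  let f i j k := o i j k -z u i j k in
  ind0 0 i *z f j k m -z ind0 0 j *z f i k m
  +z ind0 0 k *z f i j m -z ind0 0 m *z f i j k else Z0.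

Definition chi0 (l : seq nat) : Z := if l is [:: i; j; k] then
  let t i := omega0 [:: 0%N; i] in
  let u i j := im0 [:: 0%N; i; j] in
  ind0 6 i *z u j k -z ind0 6 j *z u i k +z ind0 6 k *z u i j
  -z (t i *z omega0 [:: j; k] -z t j *z omega0 [:: i; k] +z t k *z omega0 [:: i; j])
  else Z0.

(** The factor [k!] on the right makes up for the normalization of [star]; the local [T] lets the
    nonzero entries be computed once for all [w]. *)
Definition star_check k l (A B : seq nat -> Z) : bool :=
  let T := nonzero_entries 7 k A in
  let c := Z.of_nat k`! in
  all (fun w => Z.eqb (zsum T (fun q => Z.mul q.2 (eps 7 (q.1 ++ w)))) (Z.mul c (B w)))
    (words l 7).

Lemma star_phi0 : star_check 3 4 phi0 psi0. Proof. by vm_compute. Qed.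
Lemma star_psi0 : star_check 4 3 psi0 phi0. Proof. by vm_compute. Qed.
Lemma star_dphi0 : star_check 4 3 dphi0 chi0. Proof. by vm_compute. Qed.

Definition nthl (l : seq nat) (q : seq nat) : seq nat := [seq nth 0%N l i | i <- q].

(* [2! 3! ((E_j _| phi) /\ phi)] on the basis vectors with indices in [l]. *)
Definition inner_entry (j : nat) (l : seq nat) : Z :=
  zsum (permutations (iota 0 5)) (fun q =>
    lazy_mul (phi0 (j :: nthl l (take 2 q)))
      (Z.mul (nsort q).1 (phi0 (nthl l (drop 2 q))))).

Definition inner0 (j : nat) : seq (seq nat * Z) :=
  [seq (l, inner_entry j l) | l <- words 5 7 & sorted ltn l].

(* [2880 = 12 * 2! * 5!] clears the denominators of the two wedge products. *)
Definition metric_check : bool :=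
  all (fun j => let T := inner0 j in all (fun i =>
    Z.eqb (zsum (permutations (iota 0 7)) (fun p =>
        lazy_mul (phi0 (i :: take 2 p)) (Z.mul (nsort p).1 (tab T (drop 2 p)))))
      (Z.mul (Z.of_nat 2880) (Z.mul (Z.of_nat 6) (ind0 i j)))) (iota 0 7)) (iota 0 7).

Definition omega_sq0 (l : seq nat) : Z := if l is [:: i; j; k; m] then
  let s := omega0 [:: i; j] *z omega0 [:: k; m] -z omega0 [:: i; k] *z omega0 [:: j; m]
    +z omega0 [:: i; m] *z omega0 [:: j; k] in s +z s else Z0.

Definition wedge_tab n k (A B : seq nat -> Z) : Z :=
  zsum (permutations (iota 0 n)) (fun p =>
    lazy_mul (A (take k p)) (Z.mul (nsort p).1 (B (drop k p)))).

Lemma metric_phi0 : metric_check. Proof. by vm_compute. Qed.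
Lemma wedge_phi0_dphi0 : wedge_tab 7 3 phi0 dphi0 = Z0. Proof. by vm_compute. Qed.
(** [wedge_tab] carries no factorials. Here [288 = 2! 4! * 6], as the cube of the Kähler form is 6
    times the volume, and below [144 = 3! 3! * 4], as [Re U /\ Im U] is 4 times the volume for the
    standard [U]. *)
Lemma omega0_cube : wedge_tab 6 2 omega0 omega_sq0 = Z.of_nat 288. Proof. by vm_compute. Qed.
Lemma re0_im0 : wedge_tab 6 3 re0 im0 = Z.of_nat 144. Proof. by vm_compute. Qed.
Lemma im0_re0 : wedge_tab 6 3 im0 re0 = Z.opp (Z.of_nat 144). Proof. by vm_compute. Qed.

(** * Forms on the product with a circle *)

Section Pull.
Variable R : realType.
Local Notation V := 'rV[R]_6.
Local Notation W := 'rV[R]_(6 + 1).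

Definition pull6 k (a : kform R R 6 k) : kform R R (6 + 1) k :=
  fun v => a (fun j => lsubmx (v j)).
Definition dr7 : kform R R (6 + 1) 1 := fun v => rsubmx (v 0) 0 0.
Definition oneform n (f : 'rV[R]_n -> R) : kform R R n 1 := fun v => f (v 0).

Lemma pull6_tv k (a : kform R R 6 k) l : pull6 a (tv l) = a (tv (map lsubmx l)).
Proof.
rewrite /pull6; congr a; apply/funext => i; rewrite /tv.
have [il|il] := ltnP i (size l); first by rewrite (nth_map 0).
by rewrite !nth_default ?size_map// raddf0.
Qed.

Lemma pull6_alternating k (a : kform R R 6 k) : alternating a -> alternating (pull6 a).
Proof.
move=> aa; have lL c (u v : W) : lsubmx (c *: u + v) = c *: lsubmx u + lsubmx v.
  exact: linearP.
exact: alternating_pull lL aa.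
Qed.

Lemma oneform_alternating n (f : 'rV[R]_n -> R) :
  (forall c u v, f (c *: u + v) = c * f u + f v) -> alternating (oneform f).
Proof.
move=> fl; split=> [v j c u w|v i j]; last by rewrite !ord1.
by rewrite /oneform /= !ord1 /= fl.
Qed.

Lemma dr7_alternating : alternating dr7.
Proof.
apply: (@oneform_alternating _ (fun v : W => rsubmx v 0 0)) => c u v.
by rewrite linearP !mxE.
Qed.

Variables (w : kform R R 6 2) (Ur Ui : kform R R 6 3) (nu : R) (df : V -> R) (X : V).

Definition phi7 : kform R R (6 + 1) 3 := fun v =>
  nu^-1 * pull6 Ur v + nu * wedge dr7 (pull6 w) v.
Definition psi7 : kform R R (6 + 1) 4 := fun v =>
  2^-1 * wedge (pull6 w) (pull6 w) v + (-1) * wedge dr7 (pull6 Ui) v.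
(** The form that [d phi7] becomes when [Ur] and [w] are closed and [d nu = nu df]: the opposite
    signs are those of [d (nu^-1)] and [d nu]. *)
Definition dphi7 : kform R R (6 + 1) 4 := fun v =>
  - nu^-1 * wedge (pull6 (oneform df)) (pull6 Ur) v +
  nu * wedge (pull6 (oneform df)) (wedge dr7 (pull6 w)) v.
(** The candidate for the Hodge star of [dphi7] when [X] is dual to [df]; [stars] confirms it. *)
Definition chi7 : kform R R (6 + 1) 3 := fun v =>
  (-1) * wedge (pull6 (contract X w)) (pull6 w) v +
  wedge dr7 (pull6 (contract X Ui)) v.

Hypotheses (aw : alternating w) (aUr : alternating Ur) (aUi : alternating Ui).
Hypothesis ldf : forall c u v, df (c *: u + v) = c * df u + df v.

Let adr := dr7_alternating.
Let aw7 := pull6_alternating aw.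
Let aUr7 := pull6_alternating aUr.
Let aUi7 := pull6_alternating aUi.
Let adf7 := pull6_alternating (oneform_alternating ldf).
Let aXw7 := pull6_alternating (alternating_contract X aw).
Let aXU7 := pull6_alternating (alternating_contract X aUi).

Let adw : @alternating R (6 + 1) 3 (wedge dr7 (pull6 w)) := wedge_alternating adr aw7.

Lemma phi7_alternating : alternating phi7.
Proof. exact: alternatingD (alternatingZ _ aUr7) (alternatingZ _ adw). Qed.

Lemma psi7_alternating : alternating psi7.
Proof.
exact: alternatingD (alternatingZ _ (wedge_alternating aw7 aw7))
  (alternatingZ _ (wedge_alternating adr aUi7)).
Qed.

Lemma dphi7_alternating : alternating dphi7.
Proof.
exact: alternatingD (alternatingZ _ (wedge_alternating adf7 aUr7))
  (alternatingZ _ (wedge_alternating adf7 adw)).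
Qed.

Lemma chi7_alternating : alternating chi7.
Proof.
exact: alternatingD (alternatingZ _ (wedge_alternating aXw7 aw7))
  (wedge_alternating adr aXU7).
Qed.

Local Notation L := lsubmx.
Local Notation r x := (rsubmx x 0 0).

Lemma contract_tv n k (a : kform R R n k.+1) Y l :
  contract Y a (tv l) = a (tv (Y :: l)).
Proof.
rewrite /contract; congr a; apply/funext => i; rewrite /vcons /tv.
by case: (unliftP ord0 i) => [j ->|->].
Qed.

Lemma dr7_tv x l : dr7 (tv (x :: l)) = r x. Proof. by []. Qed.

Lemma oneform_tv n (f : 'rV[R]_n -> R) x l : oneform f (tv (x :: l)) = f x.
Proof. by []. Qed.

Lemma phi7E (x y z : W) : phi7 (tv [:: x; y; z]) =
  nu^-1 * Ur (tv [:: L x; L y; L z]) +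
  nu * (r x * w (tv [:: L y; L z]) - r y * w (tv [:: L x; L z]) + r z * w (tv [:: L x; L y])).
Proof. by rewrite /phi7 wedge12// !pull6_tv. Qed.

Lemma psi7E (x y z t : W) : psi7 (tv [:: x; y; z; t]) =
  w (tv [:: L x; L y]) * w (tv [:: L z; L t]) -
  w (tv [:: L x; L z]) * w (tv [:: L y; L t]) +
  w (tv [:: L x; L t]) * w (tv [:: L y; L z]) -
  (r x * Ui (tv [:: L y; L z; L t]) - r y * Ui (tv [:: L x; L z; L t]) +
   r z * Ui (tv [:: L x; L y; L t]) - r t * Ui (tv [:: L x; L y; L z])).
Proof. by rewrite /psi7 wedge13// wedge22// !pull6_tv !dr7_tv /=; field. Qed.

Lemma dphi7E (x y z t : W) : dphi7 (tv [:: x; y; z; t]) =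
  let f a b c := nu * (r a * w (tv [:: L b; L c]) - r b * w (tv [:: L a; L c]) +
                 r c * w (tv [:: L a; L b])) - nu^-1 * Ur (tv [:: L a; L b; L c]) in
  df (L x) * f y z t - df (L y) * f x z t + df (L z) * f x y t - df (L t) * f x y z.
Proof.
rewrite /dphi7 !wedge13//.
by rewrite !wedge12// !pull6_tv !dr7_tv /= !oneform_tv; ring.
Qed.

Lemma chi7E (x y z : W) : chi7 (tv [:: x; y; z]) =
  r x * Ui (tv [:: X; L y; L z]) - r y * Ui (tv [:: X; L x; L z]) +
  r z * Ui (tv [:: X; L x; L y]) -
  (w (tv [:: X; L x]) * w (tv [:: L y; L z]) - w (tv [:: X; L y]) * w (tv [:: L x; L z]) +
   w (tv [:: X; L z]) * w (tv [:: L x; L y])).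
Proof. by rewrite /chi7 !wedge12// !pull6_tv !dr7_tv !contract_tv /=; ring. Qed.

Section AdaptedFrame.
Variables (e : nat -> V) (lam : R).
Hypotheses (nu_gt0 : 0 < nu) (e6 : e 6 = 0) (Xe : X = lam *: e 0%N).
Hypothesis we : {in words 2 7, forall l, w (tv (map e l)) = zr (omega0 l)}.
Hypothesis Ure : {in words 3 7, forall l, Ur (tv (map e l)) = nu * zr (re0 l)}.
Hypothesis Uie : {in words 3 7, forall l, Ui (tv (map e l)) = nu * zr (im0 l)}.
Hypothesis dfe : forall i, (i < 7)%N -> df (e i) = lam * zr (ind0 0 i).

(* With [e 6 = 0], so that [E7 6 = d_r / nu]. *)
Definition E7 (i : nat) : W := row_mx (e i) (nu^-1 * zr (ind0 6 i))%:M.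

Let LE i : L (E7 i) = e i. Proof. exact: row_mxKl. Qed.
Let rE i : r (E7 i) = nu^-1 * zr (ind0 6 i).
Proof. by rewrite row_mxKr mxE eqxx mulr1n. Qed.
Let nu0 : nu != 0. Proof. by rewrite gt_eqF. Qed.

Let ok (l : seq nat) : all (gtn 7) l -> l \in words (size l) 7.
Proof. by move=> /allP h; apply/wordsP. Qed.

Let wE i j : (i < 7)%N -> (j < 7)%N -> w (tv [:: e i; e j]) = zr (omega0 [:: i; j]).
Proof. by move=> i7 j7; apply: (we (x := [:: i; j])); apply: ok; rewrite /= i7 j7. Qed.
Let UrE i j k : (i < 7)%N -> (j < 7)%N -> (k < 7)%N ->
  Ur (tv [:: e i; e j; e k]) = nu * zr (re0 [:: i; j; k]).
Proof. by move=> i7 j7 k7; apply: (Ure (x := [:: i; j; k])); apply: ok; rewrite /= i7 j7 k7. Qed.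
Let UiE i j k : (i < 7)%N -> (j < 7)%N -> (k < 7)%N ->
  Ui (tv [:: e i; e j; e k]) = nu * zr (im0 [:: i; j; k]).
Proof. by move=> i7 j7 k7; apply: (Uie (x := [:: i; j; k])); apply: ok; rewrite /= i7 j7 k7. Qed.

Let XE k (a : kform R R 6 k.+1) l : alternating a ->
  a (tv (X :: l)) = lam * a (tv (e 0%N :: l)).
Proof.
move=> [la _]; have A Y : tv (Y :: l) = [eta tv (0 :: l) with ord0 |-> Y] :> ('I_k.+1 -> V).
  by apply/funext => i; rewrite /tv /=; case: (unliftP ord0 i) => [j ->|->].
have := la (tv (0 :: l)) ord0 lam (e 0%N) 0.
rewrite addr0 -Xe -!A => ->; have := la (tv (0 :: l)) ord0 (-1) 0 0.
by rewrite scaler0 addr0 mulN1r addNr -A => ->; rewrite addr0.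
Qed.

Lemma phi7_frame : {in words 3 7, forall l, phi7 (tv (map E7 l)) = zr (phi0 l)}.
Proof.
move=> l /wordsP[]; case: l => [|i [|j [|k []]]]//= _ h.
have [i7 j7 k7] : [/\ i < 7, j < 7 & k < 7]%N.
  by split; apply: h; rewrite !inE eqxx ?orbT.
rewrite phi7E !LE !rE !UrE// !wE// !(zrD, zrN, zrM).
by field.
Qed.

Lemma psi7_frame : {in words 4 7, forall l, psi7 (tv (map E7 l)) = zr (psi0 l)}.
Proof.
move=> l /wordsP[]; case: l => [|i [|j [|k [|m []]]]]//= _ h.
have [i7 j7 k7 m7] : [/\ i < 7, j < 7, k < 7 & m < 7]%N.
  by split; apply: h; rewrite !inE eqxx ?orbT.
rewrite psi7E !LE !rE !UiE// !wE// !(zrD, zrN, zrM).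
by field.
Qed.

Lemma dphi7_frame : {in words 4 7, forall l, dphi7 (tv (map E7 l)) = lam * zr (dphi0 l)}.
Proof.
move=> l /wordsP[]; case: l => [|i [|j [|k [|m []]]]]//= _ h.
have [i7 j7 k7 m7] : [/\ i < 7, j < 7, k < 7 & m < 7]%N.
  by split; apply: h; rewrite !inE eqxx ?orbT.
rewrite dphi7E /= !LE !rE !UrE// !wE// !dfe// !(zrD, zrN, zrM).
by field.
Qed.

Lemma chi7_frame : {in words 3 7, forall l, chi7 (tv (map E7 l)) = lam * zr (chi0 l)}.
Proof.
move=> l /wordsP[]; case: l => [|i [|j [|k []]]]//= _ h.
have [i7 j7 k7] : [/\ i < 7, j < 7 & k < 7]%N.
  by split; apply: h; rewrite !inE eqxx ?orbT.
rewrite chi7E !XE// !LE !rE !UiE// !wE// !(zrD, zrN, zrM).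
by field.
Qed.

End AdaptedFrame.
End Pull.

(** * The metric of a G2-structure *)

Section Volume.
Variables (R : realType) (n : nat).
Local Notation V := 'rV[R]_n.

Lemma det_alternating : alternating (fun v : 'I_n -> V => \det (\matrix_(i < n) v i)).
Proof.
split=> [v j c u w|v i j ij vij]; last first.
  by apply: (determinant_alternate ij) => m; rewrite !mxE vij.
rewrite -[\det (\matrix_(i < n) [eta v with j |-> w] i)]mul1r; apply: (@determinant_multilinear _ _ _ _ _ j).
- by apply/rowP => m; rewrite !mxE /= eqxx !mxE mul1r.
- by apply/matrixP => a b; rewrite !mxE /= [lift j a == j]eq_sym (negPf (neq_lift _ _)).
- by apply/matrixP => a b; rewrite !mxE /= [lift j a == j]eq_sym (negPf (neq_lift _ _)).
Qed.

Lemma volume_det (vol : kform R R n n) (v : 'I_n -> V) : alternating vol ->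
  vol v = \det (\matrix_(i < n) v i) * vol (@ebase R n).
Proof.
move=> avol.
have aD : alternating (fun v : 'I_n -> V => vol (@ebase R n) * \det (\matrix_(i < n) v i)).
  exact: (alternatingZ _ det_alternating).
pose e (i : nat) : V := if insub i is Some j then ebase R j else 0.
have eE (i : 'I_n) : e i = ebase R i by rewrite /e valK.
have ee : tv (map e (iota 0 n)) = @ebase R n.
  apply/esym/eq_tv => i; rewrite (nth_map 0%N) ?size_iota// nth_iota// add0n.
  by rewrite -eE.
rewrite mulrC; apply: (@form_words_eq _ _ e _ vol _ avol.1 aD.1).
  by move=> u; exists (u 0); rewrite {1}[u]rV_ebase; apply: eq_bigr => i _; rewrite eE.
move=> l lw; rewrite (alternating_top _ avol lw) (alternating_top _ aD lw) ee.
rewrite (_ : \matrix_(i < n) ebase R i = 1%:M) ?det1 ?mulr1//.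
by apply/matrixP => i j; rewrite !mxE eqxx eq_sym.
Qed.
End Volume.

Lemma assoc_map (f : seq nat -> Z) (r : seq (seq nat)) m :
  assoc [seq (l, f l) | l <- r] m = if m \in r then f m else Z0.
Proof.
elim: r => //= l r IH; rewrite inE eq_sym.
by case: eqP => [->|_] //=.
Qed.

Section Identify.
Variable R : realType.
Local Notation W := 'rV[R]_(6 + 1).
Variables (phi : kform R R (6 + 1) 3) (E : nat -> W).
Hypothesis aphi : alternating phi.
Hypothesis phiE : {in words 3 7, forall l, phi (tv (map E l)) = zr (phi0 l)}.

Let contractE k (a : kform R R (6 + 1) k.+1) i l :
  contract (E i) a (tv (map E l)) = a (tv (map E (i :: l))).
Proof. exact: contract_tv. Qed.

Let inner j : kform R R (6 + 1) 5 := @wedge R (6 + 1) R 2 3 (contract (E j) phi) phi.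

Let ainner j : alternating (inner j) :=
  wedge_alternating (alternating_contract _ aphi) aphi.

Let innerE j l : (j < 7)%N -> l \in words 5 7 ->
  inner j (tv (map E l)) = 12^-1 * zr (tab (inner0 j) l).
Proof.
move=> j7 /[dup] lw /wordsP[szl ltl].
rewrite (skew_nsort (skew_map E (alternating_skewf (ainner j))) szl) /tab.
have := nsort_perm l; have := nsort_sorted l.
case: (nsort l) => s m; rewrite -[(s, m).1]/s -[(s, m).2]/m => sm pm.
rewrite zrM [in RHS]mulrCA; apply: (congr1 (fun z => zr s * z)).
have szm : size m = 5%N by rewrite (perm_size pm).
have mw : m \in words 5 7.
  by apply/wordsP; split=> // i; rewrite (perm_mem pm) => /ltl.
rewrite /inner0 assoc_map mem_filter mw andbT ltn_sorted_uniq_leq sm andbT.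
case: ifPn => um; last first.
  by rewrite (alternating_not_uniq E (ainner j) szm um) zr0 mulr0.
rewrite /inner /inner_entry (@wedge_frame _ _ _ 2 3 _ _ _ _ szm) zr_zsum !factS fact0; congr (_ * _).
  by congr (_^-1); rewrite -natrM.
apply: eq_big_seq => p; rewrite mem_permutations => pi.
have szp : size p = 5%N by rewrite (perm_size pi) size_iota.
have pm5 q : {subset q <= p} -> {in nthl m q, forall i, (i < 7)%N}.
  move=> qp i /mapP[x /qp]; rewrite (perm_mem pi) mem_iota => /= x5 ->.
  by case/wordsP: mw => _; apply; rewrite mem_nth// szm.
rewrite lazy_mulE !zrM contractE -/(nthl m _) -/(nthl m _).
rewrite !phiE; first by rewrite mulrCA.
  by apply/wordsP; rewrite size_map size_drop szp; split=> //; apply: pm5 => i /mem_drop.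
apply/wordsP; split; first by rewrite /= size_map size_take szp.
by move=> i; rewrite inE => /orP[/eqP->//|]; apply: pm5 => x /mem_take.
Qed.

(** The defining identity of a G2-structure controls only the product of metric and volume;
    [frame_volume] separates the two. *)
Lemma metric_frameE (g : W -> W -> R) (vol : kform R R (6 + 1) 7) i j :
  (forall (X Y : W) (v : 'I_7 -> W),
     wedge (contract X phi) (wedge (contract Y phi) phi) v = 6 * g X Y * vol v) ->
  (i < 7)%N -> (j < 7)%N ->
  g (E i) (E j) * vol (tv (map E (iota 0 7))) = zr (ind0 i j).
Proof.
move=> gvol i7 j7; have := gvol (E i) (E j) (tv (map E (iota 0 7))).
have := metric_phi0 => /allP/(_ j); rewrite mem_iota => /(_ j7)/allP/(_ i).
rewrite mem_iota => /(_ i7)/Z.eqb_eq Bij.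
suff -> : wedge (contract (E i) phi) (wedge (contract (E j) phi) phi) (tv (map E (iota 0 7))) =
    6 * zr (ind0 i j).
  by move=> h; apply: (@mulfI _ (6 : R)); rewrite ?pnatr_eq0// mulrA -h.
rewrite -/(inner j).
rewrite (@wedge_frame _ _ _ 2 5)// -[LHS]/(_ * \sum_(p <- _) _).
(* [240 = 2! 5!] and [12 = 2! 3!] are the normalizations of the outer and the inner wedge
   product. *)
have -> : 6 * zr (ind0 i j) = (240^-1 * 12^-1) * zr (Z.mul (Z.of_nat 2880) (Z.mul (Z.of_nat 6) (ind0 i j))) :> R.
  rewrite !zrM (_ : zr (Z.of_nat 2880) = 2880)// (_ : zr (Z.of_nat 6) = 6)//.
  by field.
rewrite -Bij zr_zsum -mulrA !factS fact0; congr (_ * _).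
  by congr (_^-1); rewrite -natrM.
rewrite mulr_sumr; apply: eq_big_seq => p; rewrite mem_permutations => pi.
have szp : size p = 7%N by rewrite (perm_size pi) size_iota.
have p7 x : x \in p -> (x < 7)%N by rewrite (perm_mem pi) mem_iota.
have nthE q : {subset q <= p} -> [seq nth 0%N (iota 0 7) x | x <- q] = q.
  by move=> qp; apply: map_id_in => x /qp/p7 x7; rewrite nth_iota.
rewrite !nthE; last 2 first.
- by move=> x /mem_drop.
- by move=> x /mem_take.
rewrite contractE innerE//; last first.
  by apply/wordsP; rewrite size_drop szp; split=> // x /mem_drop/p7.
rewrite phiE; last first.
  apply/wordsP; split; first by rewrite /= size_take szp.
  by move=> x; rewrite inE => /orP[/eqP->//|/mem_take/p7].
by rewrite lazy_mulE !zrM; ring.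
Qed.

End Identify.

Lemma star_multilinear (R : realType) n k l (Ekl : (k + l)%N = n) g vol (a : kform R R n k) :
  alternating vol -> multilinear (star Ekl g vol a).
Proof.
move=> [lvol _] w j c x y; rewrite /star [X in _ = X + _]mulrCA -mulrDr.
congr (_ * _); rewrite mulr_sumr -big_split; apply: eq_bigr => f _ /=.
rewrite mulr_sumr -big_split; apply: eq_bigr => h _ /=.
rewrite [X in _ = X + _]mulrCA -mulrDr; congr (_ * _).
have A z : (fun i => vcat (fun j => ebase R (h j)) [eta w with j |-> z] (cast_ord (esym Ekl) i)) =
    [eta (fun i => vcat (fun j => ebase R (h j)) w (cast_ord (esym Ekl) i)) with
      cast_ord Ekl (rshift k j) |-> z].
  apply/funext => i /=; rewrite /vcat -(inj_eq (@cast_ord_inj _ _ (esym Ekl))) cast_ordK.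
  case: (fintype.splitP (cast_ord (esym Ekl) i)) => m /= im.
    by rewrite -val_eqE /= im; case: eqP => // ?; have := ltn_ord m; lia.
  by rewrite -!val_eqE /= im eqn_add2l.
by rewrite !A lvol.
Qed.

Section Metric.
Variable R : realType.
Local Notation W := 'rV[R]_(6 + 1).
Variables (phi : kform R R (6 + 1) 3) (E : nat -> W).
Variables (g : W -> W -> R) (vol : kform R R (6 + 1) (6 + 1)).
Hypothesis aphi : alternating phi.
Hypothesis phiE : {in words 3 7, forall l, phi (tv (map E l)) = zr (phi0 l)}.
Hypothesis gip : inner_product g.
Hypothesis gvol : volume_form g vol.
Hypothesis gphi : forall (X Y : W) (v : 'I_7 -> W),
  wedge (contract X phi) (wedge (contract Y phi) phi) v = 6 * g X Y * vol v.

Let avol : alternating vol. Proof. by case: gvol. Qed.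

(* In the frame the metric is [u^-1] times the identity, where [u] is the volume
   of the frame, and so [u ^+ 2 = u ^- 7]. *)
Lemma frame_volume : vol (tv (map E (iota 0 7))) = 1.
Proof.
set u := vol _.
have gE i j : (i < 7)%N -> (j < 7)%N -> g (E i) (E j) * u = zr (ind0 i j).
  exact: (metric_frameE aphi phiE gphi).
have g00 : g (E 0%N) (E 0%N) * u = 1 by rewrite gE.
have u0 : u != 0.
  by apply/eqP => u0; move/eqP: g00; rewrite u0 mulr0 eq_sym oner_eq0.
have E0 : E 0%N != 0.
  apply/eqP => E0; move/eqP: g00; rewrite E0; case: gip => gl _ _.
  by have := gl (-1) 0 0 0; rewrite scaler0 addr0 mulN1r addNr => ->; rewrite mul0r eq_sym oner_eq0.
(* Positivity of the metric fixes the sign of the volume, hence the orientation of the frame. *)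
have u_gt0 : 0 < u.
  have gpos : 0 < g (E 0%N) (E 0%N) by case: gip => _ _; apply.
  by rewrite -(pmulr_rgt0 _ gpos) g00.
pose P : 'M[R]_(6 + 1) := frame_mx (fun i : 'I_(6 + 1) => E i).
have PGP : P *m gram g *m P^T = (u^-1)%:M.
  apply/matrixP => i j; transitivity (g (E i) (E j)).
    rewrite (gram_bilin gip) mxE [RHS]mxE; apply: eq_bigr => k _.
    by rewrite !mxE; congr (_ * _); apply: eq_bigr => m _; rewrite !mxE.
  apply: (mulIf u0); rewrite gE// mxE /ind0 val_eqE.
  by case: (i == j); rewrite ?mulr1n ?mulr0n ?mul0r ?mulVf.
have uP : u = \det P * vol (@ebase R (6 + 1)).
  rewrite /u (volume_det _ avol); congr (\det _ * _); apply/matrixP => i j.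
  by rewrite !mxE /tv (nth_map 0%N) ?size_iota// nth_iota.
have u9 : u ^+ 9 = 1.
  have := congr1 determinant PGP; rewrite !det_mulmx det_tr det_scalar => h.
  have u2 : u ^+ 2 = u^-1 ^+ 7.
    by rewrite -h -gvol.2 uP; ring.
  by rewrite (_ : 9 = 2 + 7)%N// exprD u2 -exprMn mulVf// expr1n.
by apply/eqP; rewrite -(@pexpr_eq1 _ u 9)// ?u9// ltW.
Qed.

Lemma frame_orthonormal (i j : 'I_(6 + 1)) : g (E i) (E j) = (i == j)%:R.
Proof.
have := metric_frameE aphi phiE gphi (ltn_ord i) (ltn_ord j).
by rewrite frame_volume mulr1 => ->; rewrite /ind0 val_eqE; case: (i == j).
Qed.

(** The real scalar [c] stays outside the integer tables: it is 1 for [phi] and [psi], and the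
    coefficient [lam] of the gradient for [d phi]. *)
Lemma star_tab_eq k l (Ekl : (k + l)%N = (6 + 1)%N) A B c
    (a : kform R R (6 + 1) k) (b : kform R R (6 + 1) l) :
  star_check k l A B -> alternating a -> alternating b ->
  {in words k 7, forall p, a (tv (map E p)) = c * zr (A p)} ->
  {in words l 7, forall p, b (tv (map E p)) = c * zr (B p)} ->
  forall v, star Ekl g vol a v = b v.
Proof.
move=> chk aa ab aA bB; apply: (@form_words_eq _ _ E).
- exact: star_multilinear.
- by case: ab.
- exact: frame_basis gip frame_orthonormal.
move=> w ww; rewrite (star_tabE gip frame_orthonormal Ekl aa avol frame_volume aA ww).
rewrite bB//; move: chk => /allP/(_ w ww)/Z.eqb_eq.
rewrite -/(star_tab _ _ _ _) => ->.
have -> : zr (Z.mul (Z.of_nat k`!) (B w)) = k`!%:R * zr (B w) :> R.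
  by rewrite zrM; congr (_ * _); rewrite /zr (_ : int_of_Z _ = k`!)// -[X in int_of_Z X]/(Z_of_int k`!) Z_of_intK.
by rewrite mulrCA mulKf// pnatr_eq0 -lt0n fact_gt0.
Qed.

(** Serves for [phi /\ d phi = 0], that is [tau0 = 0]: a form of top degree vanishes as soon as it
    does on the frame. *)
Lemma wedge_tab_eq0 (a : kform R R (6 + 1) 3) (b : kform R R (6 + 1) 4) A B c :
  wedge_tab 7 3 A B = Z0 -> alternating a -> alternating b ->
  {in words 3 7, forall p, a (tv (map E p)) = zr (A p)} ->
  {in words 4 7, forall p, b (tv (map E p)) = c * zr (B p)} ->
  forall v, wedge a b v = 0.
Proof.
move=> chk aa ab aA bB.
have aw : @alternating R (6 + 1) (6 + 1) (@wedge R (6 + 1) R 3 4 a b) := wedge_alternating aa ab.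
have w0 : @wedge R (6 + 1) R 3 4 a b (tv (map E (iota 0 7))) = 0.
  rewrite (@wedge_frame _ _ _ 3 4)//.
  transitivity ((3`!%:R * 4`!%:R)^-1 * (c * zr (wedge_tab 7 3 A B)) : R); last first.
    by rewrite chk zr0 !mulr0.
  congr (_ * _); rewrite /wedge_tab zr_zsum mulr_sumr; apply: eq_big_seq => p.
  rewrite mem_permutations => pi.
  have szp : size p = 7%N by rewrite (perm_size pi) size_iota.
  have p7 x : x \in p -> (x < 7)%N by rewrite (perm_mem pi) mem_iota.
  have nthE q : {subset q <= p} -> [seq nth 0%N (iota 0 7) x | x <- q] = q.
    by move=> qp; apply: map_id_in => x /qp/p7 x7; rewrite nth_iota.
  rewrite !nthE; last 2 first.
  - by move=> x /mem_drop.
  - by move=> x /mem_take.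
  rewrite aA; last by apply/wordsP; rewrite size_take szp; split=> // x /mem_take/p7.
  rewrite bB; last by apply/wordsP; rewrite size_drop szp; split=> // x /mem_drop/p7.
  by rewrite lazy_mulE !zrM; ring.
have l0 := (@alternating0 R (6 + 1) (6 + 1)).1.
apply: (form_words_eq (E := E) aw.1 l0 (frame_basis gip frame_orthonormal)) => l lw.
by rewrite (alternating_top _ aw lw) w0 mulr0.
Qed.

End Metric.

(** * Smooth functions *)

Section ClassC.
Variables (R : realType) (V : normedModType R).
Implicit Types (W : set V) (f g : V -> R).

(** Restriction to a line makes the one-variable chain rule and mean value theorem available. *)
Lemma is_derive_line f x v (b : R) :
  is_derive x v f b <-> is_derive (0 : R) 1 (fun h : R => f (h *: v + x)) b.
Proof.
have E : 'D_v f x = 'D_1 (fun h : R => f (h *: v + x)) 0.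
  rewrite /derive; set g1 := fun h => h^-1 *: _; set g2 := fun h => h^-1 *: _.
  suff -> : g1 = g2 by [].
  by rewrite /g1 /g2; apply/funext => h /=; rewrite addr0 scale0r add0r [_%:A]mulr1.
split=> -[d e]; split.
- by apply/(derivable1P f x v).
- by rewrite -E.
- by apply/(derivable1P f x v).
- by rewrite E.
Qed.

Lemma is_derive_comp (F : R -> R) f x v (a b : R) :
  is_derive x v f b -> is_derive (f x) 1 F a -> is_derive x v (F \o f) (a * b).
Proof.
move=> /(is_derive_line f x v b).1 fl Fl; apply/(is_derive_line (F \o f) x v _).2.
apply: (@is_derive1_comp _ F (fun h : R => f (h *: v + x))).
by rewrite scale0r add0r.
Qed.

Lemma continuous_near (f g : V -> R) x :
  (\near x, f x = g x) -> {for x, continuous f} -> {for x, continuous g}.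
Proof.
move=> fg cf; rewrite /prop_for /continuous_at -(nbhs_singleton fg).
exact: cvg_trans (near_eq_cvg fg) cf.
Qed.

Lemma open_near W f g x : open W -> W x -> (forall y, W y -> f y = g y) ->
  \near x, f x = g x.
Proof.
by move=> oW Wx fg; near=> y; apply: fg; near: y; apply: open_nbhs_nbhs; split.
Unshelve. all: by end_near. Qed.

Lemma classC_ext k W f g : open W -> (forall x, W x -> f x = g x) ->
  classC k W f -> classC k W g.
Proof.
move=> oW; elim: k f g => [|k IH] f g fg /= [cf df].
  by split=> // x Wx; apply: continuous_near (cf x Wx); exact: open_near fg.
split=> [x Wx|v]; first by apply: continuous_near (cf x Wx); exact: open_near fg.
have [dfv cfv] := df v; split=> [x Wx|].
  by apply: near_eq_derivable (dfv x Wx); exact: open_near fg.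
by apply: IH cfv => x Wx; apply: near_eq_derive; exact: open_near fg.
Qed.

Lemma classC_sub k W W' f : W' `<=` W -> classC k W f -> classC k W' f.
Proof.
move=> sub; elim: k f => [|k IH] f /= [cf df]; first by split=> // x /sub/cf.
split=> [x /sub/cf//|v]; have [dfv cfv] := df v.
by split=> [x /sub/dfv//|]; exact: IH.
Qed.

Lemma classC_pred k W f : classC k.+1 W f -> classC k W f.
Proof.
elim: k f => [|k IH] f; first by case.
by case=> cf df; split=> // v; have [dfv /IH cfv] := df v; split.
Qed.

Lemma classC_cst k W (c : R) : classC k W (fun=> c).
Proof.
elim: k c => [|k IH] c /=; first by split=> // x _; exact: cst_continuous.
split=> [x _|v]; first exact: cst_continuous.
split=> [x _|]; first exact: derivable_cst.
have -> : (fun x : V => 'D_v (fun=> c) x) = (fun=> 0 : R) by apply/funext => x; exact: derive_cst.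
exact: IH.
Qed.

Lemma classCD k W f g : open W -> classC k W f -> classC k W g ->
  classC k W (fun x => f x + g x).
Proof.
move=> oW; elim: k f g => [|k IH] f g /= [cf df] [cg dg].
  by split=> // x Wx; apply: continuousD; [exact: cf|exact: cg].
split=> [x Wx|v]; first by apply: continuousD; [exact: cf|exact: cg].
have [[dfv cfv] [dgv cgv]] := (df v, dg v); split=> [x Wx|].
  by apply: derivableD; [exact: dfv|exact: dgv].
apply: classC_ext (IH _ _ cfv cgv) => // x Wx.
by rewrite -(deriveD (dfv x Wx) (dgv x Wx)).
Qed.

Lemma classCM k W f g : open W -> classC k W f -> classC k W g ->
  classC k W (fun x => f x * g x).
Proof.
move=> oW; elim: k f g => [|k IH] f g Cf Cg.
  case: Cf Cg => cf _ [cg _].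
  by split=> // x Wx; apply: continuousM; [exact: cf|exact: cg].
have [Cf' Cg'] := (classC_pred Cf, classC_pred Cg).
case: Cf Cg => cf df [cg dg].
split=> [x Wx|v]; first by apply: continuousM; [exact: cf|exact: cg].
have [[dfv cfv] [dgv cgv]] := (df v, dg v); split=> [x Wx|].
  by apply: derivableM; [exact: dfv|exact: dgv].
apply: classC_ext (classCD oW (IH _ _ Cf' cgv) (IH _ _ Cg' cfv)) => // x Wx.
by have := deriveM (dfv x Wx) (dgv x Wx).
Qed.

Lemma classCV k W f : open W -> (forall x, W x -> f x != 0) -> classC k W f ->
  classC k W (fun x => (f x)^-1).
Proof.
move=> oW f0; elim: k => [|k IH] Cf.
  by case: Cf => cf _; split=> // x Wx; apply: cvgV; [exact: f0|exact: cf].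
have Cf' := classC_pred Cf; case: Cf => cf df.
split=> [x Wx|v]; first by apply: cvgV; [exact: f0|exact: cf].
have [dfv cfv] := df v; split=> [x Wx|].
  by apply: derivableV; [exact: f0|exact: dfv].
apply: classC_ext (classCM oW (classCM oW (classC_cst _ _ (-1))
  (classCM oW (IH Cf') (IH Cf'))) cfv) => // x Wx.
rewrite (deriveV (f0 x Wx) (dfv x Wx)) -[in RHS]/(_ * _).
by rewrite mulN1r expr2 invfM.
Qed.

Lemma classC_ln k W f : open W -> (forall x, W x -> 0 < f x) -> classC k W f ->
  classC k W (fun x => ln (f x)).
Proof.
move=> oW f0; have c_ln : (forall x, W x -> {for x, continuous f}) ->
    forall x, W x -> {for x, continuous (fun x => ln (f x))}.
  move=> cf x Wx; exact: (continuous_comp (cf x Wx) (continuous_ln (f0 x Wx))).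
case: k => [|k] Cf; first by case: Cf => cf _; split=> // x Wx; exact: c_ln.
have Cf' := classC_pred Cf; case: Cf => cf df; split; first exact: c_ln.
move=> v; have [dfv cfv] := df v.
have D x : W x -> is_derive x v (fun x => ln (f x)) ((f x)^-1 * 'D_v f x).
  move=> Wx; apply: (@is_derive_comp (@ln R) f); last exact: is_derive1_ln (f0 x Wx).
  exact/derivableP/dfv.
split=> [x /D[]//|]; apply: classC_ext (classCM oW (classCV oW _ Cf') cfv) => //.
  by move=> x /D[].
by move=> x /f0; rewrite lt0r => /andP[].
Qed.

(** Smoothness of a germ: it carries no extension, unlike [smooth_on], and is insensitive to changes
    away from [x]. *)
Definition smooth_at (x : V) f : Prop :=
  exists2 W : set V, open W /\ W x & forall k, classC k W f.

Lemma smooth_on_at W f x : open W -> smooth_on W f -> W x -> smooth_at x f.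
Proof.
move=> oW [W' [oW' sub [h Ch hf]]] Wx; exists W => // k.
by apply: classC_ext hf _ => //; exact: classC_sub (Ch k).
Qed.

Lemma smooth_at_near f x : smooth_at x f -> \forall y \near x, smooth_at y f.
Proof.
by move=> [W [oW Wx] C]; near=> y; exists W => //; split=> //; near: y;
  exact: open_nbhs_nbhs.
Unshelve. all: by end_near. Qed.

Lemma smooth_at_ext f g x : (\near x, f x = g x) -> smooth_at x f -> smooth_at x g.
Proof.
rewrite /prop_near1 nbhsE => -[U [oU Ux] fg] [W [oW Wx] C]; exists (W `&` U).
  by split; [exact: openI|split].
have o : open (W `&` U) by exact: openI.
move=> k; apply: (@classC_ext _ _ f) => //; first by move=> y [_ /fg].
by apply: classC_sub (C k) => y [].
Qed.

Lemma smooth_at_cst (c : R) x : smooth_at x (fun=> c).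
Proof. by exists setT; [split=> //; exact: openT|move=> k; exact: classC_cst]. Qed.

Lemma smooth_atD f g x : smooth_at x f -> smooth_at x g ->
  smooth_at x (fun y => f y + g y).
Proof.
move=> [W [oW Wx] C] [W' [oW' W'x] C']; exists (W `&` W').
  by split; [exact: openI|split].
by move=> k; apply: classCD;
  [exact: openI|apply: classC_sub (C k) => y []|apply: classC_sub (C' k) => y []].
Qed.

Lemma smooth_atM f g x : smooth_at x f -> smooth_at x g ->
  smooth_at x (fun y => f y * g y).
Proof.
move=> [W [oW Wx] C] [W' [oW' W'x] C']; exists (W `&` W').
  by split; [exact: openI|split].
by move=> k; apply: classCM;
  [exact: openI|apply: classC_sub (C k) => y []|apply: classC_sub (C' k) => y []].
Qed.

Lemma smooth_atZ (c : R) f x : smooth_at x f -> smooth_at x (fun y => c * f y).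
Proof. by apply: smooth_atM; exact: smooth_at_cst. Qed.

Lemma smooth_atN f x : smooth_at x f -> smooth_at x (fun y => - f y).
Proof.
by move=> /(smooth_atZ (-1)); apply: smooth_at_ext; near=> y; rewrite mulN1r.
Unshelve. all: by end_near. Qed.

Lemma smooth_at_sum (I : Type) (r : seq I) (P : pred I) (F : I -> V -> R) x :
  (forall i, smooth_at x (F i)) -> smooth_at x (fun y => \sum_(i <- r | P i) F i y).
Proof.
move=> sF; elim: r => [|i r IH].
  by apply: smooth_at_ext (smooth_at_cst 0 x); near=> y; rewrite big_nil.
apply: (smooth_at_ext (f := fun y => (if P i then F i y else 0) + \sum_(j <- r | P j) F j y)).
  by near=> y; rewrite big_cons; case: (P i); rewrite ?add0r.
by apply: smooth_atD => //; case: (P i) => //; exact: smooth_at_cst.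
Unshelve. all: by end_near. Qed.

Lemma smooth_at_prod (I : Type) (r : seq I) (P : pred I) (F : I -> V -> R) x :
  (forall i, smooth_at x (F i)) -> smooth_at x (fun y => \prod_(i <- r | P i) F i y).
Proof.
move=> sF; elim: r => [|i r IH].
  by apply: smooth_at_ext (smooth_at_cst 1 x); near=> y; rewrite big_nil.
apply: (smooth_at_ext (f := fun y => (if P i then F i y else 1) * \prod_(j <- r | P j) F j y)).
  by near=> y; rewrite big_cons; case: (P i); rewrite ?mul1r.
by apply: smooth_atM => //; case: (P i) => //; exact: smooth_at_cst.
Unshelve. all: by end_near. Qed.

Lemma smooth_at_continuous f x : smooth_at x f -> {for x, continuous f}.
Proof. by move=> [W [oW Wx] /(_ 0%N)[cf _]]; exact: cf. Qed.

Lemma smooth_at_derivable f x v : smooth_at x f -> derivable f x v.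
Proof. by move=> [W [oW Wx] /(_ 1%N)[_ /(_ v)[df _]]]; exact: df. Qed.

Lemma smooth_at_derive f x v : smooth_at x f -> smooth_at x (fun y => 'D_v f y).
Proof. by move=> [W Wx C]; exists W => // k; have [_ /(_ v)[]] := C k.+1. Qed.

Lemma smooth_atV f x : f x != 0 -> smooth_at x f -> smooth_at x (fun y => (f y)^-1).
Proof.
move=> fx0 sf; have cf := smooth_at_continuous sf.
have : \forall y \near x, f y != 0 by exact: cvgr_neq0 cf fx0.
rewrite /prop_near1 nbhsE => -[U [oU Ux] f0]; case: sf => W [oW Wx] C; exists (W `&` U).
  by split; [exact: openI|split].
move=> k; apply: classCV; [exact: openI|by move=> y [_ /f0]|].
by apply: classC_sub (C k) => y [].
Qed.

Lemma smooth_at_ln f x : 0 < f x -> smooth_at x f -> smooth_at x (fun y => ln (f y)).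
Proof.
move=> fx0 sf; have cf := smooth_at_continuous sf.
have : \forall y \near x, 0 < f y by exact: cvgr_gt cf _ fx0.
rewrite /prop_near1 nbhsE => -[U [oU Ux] f0]; case: sf => W [oW Wx] C; exists (W `&` U).
  by split; [exact: openI|split].
move=> k; apply: classC_ln; [exact: openI|by move=> y [_ /f0]|].
by apply: classC_sub (C k) => y [].
Qed.

Lemma is_derive_dirZ f x v (c : R) : derivable f x v ->
  is_derive x (c *: v) f (c * 'D_v f x).
Proof.
move=> /derivableP/(is_derive_line f x v _).1 dl.
have id : is_derive (0 : R) 1 (fun h : R => c * h) c.
  have := is_deriveZ c (is_derive_id (0 : R) (1 : R)).
  by rewrite -[c *: (1 : R)]/(c * 1) mulr1.
rewrite mulrC; apply/(is_derive_line f x (c *: v) _).2.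
have -> : (fun h : R => f (h *: (c *: v) + x)) =
      (fun h : R => f (h *: v + x)) \o (fun h : R => c * h).
  by apply/funext => h /=; rewrite scalerA mulrC.
by apply: is_derive1_comp => //; rewrite mulr0.
Qed.

Lemma derive_dirZ f x v (c : R) : derivable f x v -> 'D_(c *: v) f x = c * 'D_v f x.
Proof. by move=> /(is_derive_dirZ c)[]. Qed.

Lemma is_derive_affine f w z (s : R) : derivable f (s *: w + z) w ->
  is_derive s 1 (fun t : R => f (t *: w + z)) ('D_w f (s *: w + z)).
Proof.
move=> /derivableP/(is_derive_line _ _ _ _).1 dl.
have -> : (fun t : R => f (t *: w + z)) =
    (fun k : R => f (k *: w + (s *: w + z))) \o (fun t : R => t - s).
  by apply/funext => t /=; rewrite addrA -scalerDl subrK.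
rewrite -['D_w f _]mulr1; apply: is_derive1_comp.
  by rewrite subrr.
exact: is_derive_shift.
Qed.

(** [classC] speaks of directional derivatives only, and their additivity in the direction can fail
    without continuity. On the path [x], [x + h u], [x + h u + h v] the mean value theorem is
    applied to the second leg, and continuity of ['D_v f] at [x] concludes. *)
Lemma derive_dirD f x u v : smooth_at x f ->
  'D_(u + v) f x = 'D_u f x + 'D_v f x.
Proof.
move=> sf; apply: cvg_lim => //.
have cDv : {for x, continuous (fun y => 'D_v f y)}.
  exact/smooth_at_continuous/smooth_at_derive.
have -> : (fun h : R => h^-1 *: ((f \o shift x) (h *: (u + v)) - f x)) =
    (fun h : R => h^-1 *: ((f \o shift x) (h *: u) - f x) +
      h^-1 *: (f (h *: v + (h *: u + x)) - f (h *: u + x))).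
  apply/funext => h /=; rewrite -scalerDr; congr (_ *: _).
  by rewrite [RHS]addrC subrKA scalerDr addrCA addrA.
apply: cvgD; first exact: smooth_at_derivable sf.
apply/cvgrPdist_le => /= e e0.
have /nbhs_ballP[d /= d0 dP] : \forall y \near x, derivable f y v /\
    `|'D_v f x - 'D_v f y| <= e.
  near=> y; split; last by near: y; move/cvgrPdist_le : cDv; apply.
  apply: smooth_at_derivable; near: y; exact: smooth_at_near.
(* The second leg stays in the ball of radius [d] once [|h| * M < d]; the summand 1 keeps [M]
   positive. *)
pose M := `|u| + `|v| + 1.
have M0 : 0 < M by rewrite ltr_pwDr// addr_ge0.
near=> h.
have h0 : h != 0 by near: h; exact: nbhs_dnbhs_neq.
have hM : `|h| * M < d.
  rewrite -ltr_pdivlMr//; near: h.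
  by apply: dnbhs0_lt; rewrite divr_gt0.
have yP s : 0 <= s <= 1 -> ball x d (s *: (h *: v) + (h *: u + x)).
  move=> /andP[s0 s1]; rewrite -ball_normE /=.
  rewrite addrA opprD addrCA subrr addr0 normrN (le_lt_trans _ hM)//.
  apply: (le_trans (ler_normD _ _)); rewrite !normrZ (ger0_norm s0).
  rewrite /M !mulrDr mulr1 [_ + `|h| * `|v|]addrC -addrA lerD//.
    by rewrite ler_piMl// mulr_ge0.
  by rewrite lerDl.
have D (s : R) : 0 <= s <= 1 ->
    is_derive s (1 : R) (fun t : R => f (t *: (h *: v) + (h *: u + x)))
      (h * 'D_v f (s *: (h *: v) + (h *: u + x))).
  move=> /yP/dP[dv _].
  by rewrite -(derive_dirZ _ dv); apply: is_derive_affine; have [] := is_derive_dirZ h dv.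
have itvW (s : R) : s \in `]0, 1[%R -> 0 <= s <= 1.
  by rewrite in_itv /= => /andP[/ltW -> /ltW ->].
have c01 : {within `[0, 1], continuous (fun t : R => f (t *: (h *: v) + (h *: u + x)))}.
  apply: derivable_within_continuous => s; rewrite in_itv /= => /D[].
  by [].
have D' (s : R) : s \in `]0, 1[%R -> is_derive s (1 : R) _ _ := fun s01 => D s (itvW s s01).
have [s s01] := MVT ltr01 D' c01.
rewrite scale1r scale0r add0r subr0 mulr1 => ->.
rewrite -[_ *: _]/(_ * _) mulKf//.
by have /yP/dP[_] := itvW _ s01.
Unshelve. all: by end_near. Qed.

End ClassC.

(** * Exterior and Lie derivatives *)

Section Slots.
Variables (R : realType) (n : nat).
Local Notation V := 'rV[R]_n.

Lemma multilinear_slot k (a : kform R R n k) l1 l2 c u w :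
  multilinear a -> (size l1 < k)%N ->
  a (tv (l1 ++ (c *: u + w) :: l2)) =
  c * a (tv (l1 ++ u :: l2)) + a (tv (l1 ++ w :: l2)).
Proof.
move=> la l1k; have A z : tv (l1 ++ z :: l2) =
    [eta tv (l1 ++ 0 :: l2) with Ordinal l1k |-> z] :> ('I_k -> V).
  apply/funext => i; rewrite /tv /= -val_eqE /= !nth_cat.
  case: (ltngtP i (size l1)) => [//|il|->]; last by rewrite subnn.
  by case E: (i - size l1)%N => [|m] //; lia.
by rewrite (A (c *: u + w)) (A u) (A w) la.
Qed.

Lemma multilinear_head k (a : kform R R n k.+1) l c u w : multilinear a ->
  a (tv (c *: u + w :: l)) = c * a (tv (u :: l)) + a (tv (w :: l)).
Proof. by move=> la; exact: (@multilinear_slot k.+1 a [::] l c u w la isT). Qed.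

Lemma multilinear_head0 k (a : kform R R n k.+1) l : multilinear a ->
  a (tv (0 :: l)) = 0.
Proof.
move=> la; have := multilinear_head l (-1) 0 0 la.
by rewrite scaler0 addr0 mulN1r addNr.
Qed.

Lemma multilinear_headZ k (a : kform R R n k.+1) l c u : multilinear a ->
  a (tv (c *: u :: l)) = c * a (tv (u :: l)).
Proof.
move=> la; have := multilinear_head l c u 0 la.
by rewrite addr0 multilinear_head0// addr0.
Qed.

Lemma multilinear_head_sum k (a : kform R R n k.+1) l u : multilinear a ->
  a (tv (u :: l)) = \sum_i u 0 i * a (tv (ebase R i :: l)).
Proof.
move=> la; rewrite {1}[u]rV_ebase; elim: (index_enum _) => [|i r IH].
  by rewrite !big_nil multilinear_head0.
by rewrite !big_cons multilinear_head// IH.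
Qed.

Lemma alternating_swap01 k (a : kform R R n k.+2) u v l : alternating a ->
  size l = k -> a (tv (u :: v :: l)) = - a (tv (v :: u :: l)).
Proof. by move=> /alternating_skewf[h _] sl; apply: (h [::]); rewrite /= sl. Qed.

Lemma alternating_swap12 k (a : kform R R n k.+3) t u v l : alternating a ->
  size l = k -> a (tv (t :: u :: v :: l)) = - a (tv (t :: v :: u :: l)).
Proof. by move=> /alternating_skewf[h _] sl; apply: (h [:: t]); rewrite /= sl. Qed.

Lemma tv_cons_vcons k (u : V) l : tv (u :: l) = vcons u (tv l) :> ('I_k.+1 -> V).
Proof.
by apply/funext => i; rewrite /vcons /tv; case: (unliftP ord0 i) => [j ->|->].
Qed.

Variables (D : set V) (oD : open D).

Definition sform k (a : V -> kform R R n k) : Prop :=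
  forall x, D x -> alternating (a x) /\ forall v, smooth_at x (fun y => a y v).

Definition svec (X : V -> V) : Prop :=
  forall x, D x -> forall j, smooth_at x (fun y => X y 0 j).

Lemma near_D x : D x -> \forall y \near x, D y.
Proof. by move=> Dx; exact: open_nbhs_nbhs. Qed.

Lemma svec_derivable X x v : svec X -> D x -> derivable X x v.
Proof.
move=> sX Dx; apply/derivable_mxP => i j; rewrite ord1.
exact: smooth_at_derivable (sX x Dx j).
Qed.

Lemma svec_derive X x v j : svec X -> D x ->
  ('D_v X x) 0 j = 'D_v (fun y => X y 0 j) x.
Proof. by move=> sX Dx; rewrite (derive_mx (@svec_derivable X x v sX Dx)) mxE. Qed.

Lemma smooth_head k (a : V -> kform R R n k.+1) X l x : sform a -> svec X -> D x ->
  smooth_at x (fun y => a y (tv (X y :: l))).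
Proof.
move=> sa sX Dx.
apply: (@smooth_at_ext _ _ (fun y => \sum_i X y 0 i * a y (tv (ebase R i :: l)))).
  by apply: filterS (near_D Dx) => y Dy; rewrite -multilinear_head_sum//; case: (sa y Dy) => -[].
apply: smooth_at_sum => i; apply: smooth_atM; first exact: sX.
exact: (sa x Dx).2.
Qed.

Lemma derive_sum_seq (I : Type) (r : seq I) (F : I -> V -> R) x v :
  (forall i, derivable (F i) x v) ->
  'D_v (fun y => \sum_(i <- r) F i y) x = \sum_(i <- r) 'D_v (F i) x.
Proof.
move=> dF; suff : is_derive x v (fun y => \sum_(i <- r) F i y) (\sum_(i <- r) 'D_v (F i) x).
  by case.
elim: r => [|i r IH].
  rewrite big_nil (_ : (fun y => _) = cst 0); first exact: is_derive_cst.
  by apply/funext => y; rewrite big_nil.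
rewrite big_cons (_ : (fun y => _) = (F i + (fun y => \sum_(j <- r) F j y))).
  by apply: is_deriveD => //; exact/derivableP.
by apply/funext => y; rewrite big_cons.
Qed.

(** Leibniz rule for a moving first argument: in the constant basis [a(X, ...)] is a sum of products
    of functions. *)
Lemma derive_head k (a : V -> kform R R n k.+1) X l x v : sform a -> svec X -> D x ->
  'D_v (fun y => a y (tv (X y :: l))) x =
  'D_v (fun y => a y (tv (X x :: l))) x + a x (tv ('D_v X x :: l)).
Proof.
move=> sa sX Dx.
have da i : smooth_at x (fun y => a y (tv (ebase R i :: l))) by exact: (sa x Dx).2.
have E (Y : V -> V) : \near x, a x (tv (Y x :: l)) = \sum_i Y x 0 i * a x (tv (ebase R i :: l)).
  by apply: filterS (near_D Dx) => y Dy; rewrite -multilinear_head_sum//; case: (sa y Dy) => -[].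
rewrite (near_eq_derive _ (E X)) (near_eq_derive _ (E (fun=> X x))).
rewrite derive_sum_seq; last first.
  by move=> i; apply: smooth_at_derivable; apply: smooth_atM => //; exact: sX.
rewrite derive_sum_seq; last first.
  by move=> i; apply: smooth_at_derivable; exact: smooth_atZ.
rewrite [X in _ = _ + X]multilinear_head_sum; last by case: (sa x Dx) => -[].
rewrite -big_split; apply: eq_bigr => i _ /=.
have := deriveM (smooth_at_derivable (v := v) (sX x Dx i)) (smooth_at_derivable (v := v) (da i)).
move=> ->; have -> := deriveZ (X x 0 i) (smooth_at_derivable (v := v) (da i)).
by rewrite (@svec_derive X x v _ sX Dx) -[_ *: 'D_v (fun y => X y 0 i) x]/(_ * _) [X in _ + X]mulrC.
Qed.

Lemma derive_alternating k (a : V -> kform R R n k) x v : sform a -> D x ->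
  alternating (fun u => 'D_v (fun y => a y u) x).
Proof.
move=> sa Dx; have da u := smooth_at_derivable (v := v) ((sa x Dx).2 u).
split=> [u j c p q|u i j ij uij].
  have := deriveD (derivableZ (k := c) (da [eta u with j |-> p])) (da [eta u with j |-> q]).
  rewrite (deriveZ c (da [eta u with j |-> p])) => <-; apply: near_eq_derive.
  by apply: filterS (near_D Dx) => y Dy; case: (sa y Dy) => -[-> _] _.
rewrite -[RHS](derive_cst (0 : R) x v); apply: near_eq_derive.
by apply: filterS (near_D Dx) => y Dy; case: (sa y Dy) => -[_ /(_ _ _ _ ij uij)].
Qed.

Lemma derive_linear (f : V -> R) x c u v : smooth_at x f ->
  'D_(c *: u + v) f x = c * 'D_u f x + 'D_v f x.
Proof.
move=> sf; rewrite derive_dirD// derive_dirZ//; exact: smooth_at_derivable.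
Qed.

Lemma extd_tv k (a : V -> kform R R n k) x l : size l = k.+1 ->
  extd a x (tv l) = \sum_(i < k.+1) (-1) ^+ i *
    'D_(l`_i) (fun y => a y (tv (take i l ++ drop i.+1 l))) x.
Proof.
move=> sl; apply: eq_bigr => i _.
apply: (congr1 (fun f : V -> R => (-1) ^+ i * 'D_(l`_i) f x)).
apply/funext => y; congr (a y _); apply/funext => j; rewrite /tv /= nth_cat.
rewrite size_take sl ltn_ord /bump; case: leqP => ij.
  by rewrite nth_drop add1n; congr (l`_ _); lia.
by rewrite add0n nth_take.
Qed.

Lemma eq_extd k (a b : V -> kform R R n k) x v : D x ->
  (forall y, D y -> a y = b y) -> extd a x v = extd b x v.
Proof.
move=> Dx ab; apply: eq_bigr => i _; congr (_ * _); apply: near_eq_derive.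
by apply: filterS (near_D Dx) => y Dy; rewrite ab.
Qed.

End Slots.

Section PointwiseDerive.
Variables (R : realType) (V : normedModType R) (x v : V).
Implicit Types f g : V -> R.

Lemma derive_ptD f g : smooth_at x f -> smooth_at x g ->
  'D_v (fun y => f y + g y) x = 'D_v f x + 'D_v g x.
Proof.
move=> sf sg.
exact: (deriveD (smooth_at_derivable (v := v) sf) (smooth_at_derivable (v := v) sg)).
Qed.

Lemma derive_ptM f g : smooth_at x f -> smooth_at x g ->
  'D_v (fun y => f y * g y) x = f x * 'D_v g x + g x * 'D_v f x.
Proof.
move=> sf sg.
exact: (deriveM (smooth_at_derivable (v := v) sf) (smooth_at_derivable (v := v) sg)).
Qed.

Lemma derive_ptN f : smooth_at x f -> 'D_v (fun y => - f y) x = - 'D_v f x.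
Proof. by move=> sf; have := deriveN (smooth_at_derivable (v := v) sf). Qed.

Lemma derive_ptZ c f : smooth_at x f -> 'D_v (fun y => c * f y) x = c * 'D_v f x.
Proof. by move=> sf; have := deriveZ c (smooth_at_derivable (v := v) sf). Qed.

Lemma derive_ptV f : f x != 0 -> smooth_at x f ->
  'D_v (fun y => (f y)^-1) x = - (f x)^-2 * 'D_v f x.
Proof. by move=> f0 sf; have := deriveV f0 (smooth_at_derivable (v := v) sf). Qed.

End PointwiseDerive.

Ltac smooth := by do ![done | apply: smooth_atD | apply: smooth_atM | apply: smooth_atN | apply: smooth_at_cst].

Section Extd.
Variables (R : realType) (n : nat).
Local Notation V := 'rV[R]_n.

Lemma extd2E (a : V -> kform R R n 2) x p q s : extd a x (tv [:: p; q; s]) =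
  'D_p (fun y => a y (tv [:: q; s])) x - 'D_q (fun y => a y (tv [:: p; s])) x
  + 'D_s (fun y => a y (tv [:: p; q])) x.
Proof.
rewrite extd_tv// !big_ord_recl big_ord0 /= /bump /=; ring.
Qed.

Lemma extd3E (a : V -> kform R R n 3) x p q s t : extd a x (tv [:: p; q; s; t]) =
  'D_p (fun y => a y (tv [:: q; s; t])) x - 'D_q (fun y => a y (tv [:: p; s; t])) x
  + 'D_s (fun y => a y (tv [:: p; q; t])) x - 'D_t (fun y => a y (tv [:: p; q; s])) x.
Proof.
rewrite extd_tv// !big_ord_recl big_ord0 /= /bump /=; ring.
Qed.

Lemma extd4E (a : V -> kform R R n 4) x p q s t u : extd a x (tv [:: p; q; s; t; u]) =
  'D_p (fun y => a y (tv [:: q; s; t; u])) x - 'D_q (fun y => a y (tv [:: p; s; t; u])) x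
  + 'D_s (fun y => a y (tv [:: p; q; t; u])) x - 'D_t (fun y => a y (tv [:: p; q; s; u])) x
  + 'D_u (fun y => a y (tv [:: p; q; s; t])) x.
Proof.
rewrite extd_tv// !big_ord_recl big_ord0 /= /bump /=; ring.
Qed.

Variables (D : set V) (oD : open D).

Lemma bracket_cst (X : V -> V) (u x : V) : bracket X (fun=> u) x = - 'D_u X x.
Proof. by rewrite /bracket derive_cst sub0r. Qed.

Lemma lie_tv k (a : V -> kform R R n k) X x l : multilinear (a x) -> size l = k ->
  lie X a x (tv l) = 'D_(X x) (fun y => a y (tv l)) x +
    \sum_(j < k) a x (tv (set_nth 0 l j ('D_(l`_j) X x))).
Proof.
move=> la sl; rewrite /lie -sumrN; congr (_ + _); apply: eq_bigr => j _.
have A z : [eta tv l with j |-> z] = tv (set_nth 0 l j z) :> ('I_k -> V).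
  by apply/funext => i; rewrite /tv nth_set_nth /= val_eqE.
have l0 := la (tv l) j (-1) 0 0; rewrite scaler0 addr0 mulN1r addNr in l0.
(* The bracket with a constant field is minus a derivative of [X], which cancels the minus sign in
   [lie]. *)
have lN u := la (tv l) j (-1) u 0.
by have := lN ('D_(l`_j) X x); rewrite scaleN1r addr0 l0 addr0 mulN1r bracket_cst => ->; rewrite opprK A.
Qed.

(* Cartan's formula for closed forms. *)
Lemma lie2_closed (a : V -> kform R R n 2) X x p q :
  sform D a -> svec D X -> D x -> (forall v, extd a x v = 0) ->
  lie X a x (tv [:: p; q]) =
  'D_p (fun y => a y (tv [:: X y; q])) x - 'D_q (fun y => a y (tv [:: X y; p])) x.
Proof.
move=> sa sX Dx da0; have aa := (sa x Dx).1.
have := da0 (tv [:: X x; p; q]); rewrite extd2E => dX.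
have dX2 := fun l v => @derive_head R n D oD 1 a X l x v sa sX Dx.
rewrite (dX2 [:: q] p) (dX2 [:: p] q) lie_tv; [|by case: aa|by []].
rewrite !big_ord_recl big_ord0 -[set_nth _ _ _ _]/[:: 'D_p X x; q].
rewrite -[set_nth _ _ _ _]/[:: p; 'D_q X x].
rewrite (alternating_swap01 p _ aa)//.
move: dX; set d1 := 'D_(X x) _ _; set d2 := 'D_p _ _; set d3 := 'D_q _ _.
set e1 := a x _; set e2 := a x _ => dX.
have -> : d1 = d2 - d3 by apply/eqP; rewrite -subr_eq0 -[eqbRHS]dX; apply/eqP; ring.
ring.
Qed.

Lemma lie3_closed (a : V -> kform R R n 3) X x p q s :
  sform D a -> svec D X -> D x -> (forall v, extd a x v = 0) ->
  lie X a x (tv [:: p; q; s]) =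
  'D_p (fun y => a y (tv [:: X y; q; s])) x - 'D_q (fun y => a y (tv [:: X y; p; s])) x
  + 'D_s (fun y => a y (tv [:: X y; p; q])) x.
Proof.
move=> sa sX Dx da0; have aa := (sa x Dx).1.
have := da0 (tv [:: X x; p; q; s]); rewrite extd3E => dX.
have dX3 := fun l v => @derive_head R n D oD 2 a X l x v sa sX Dx.
rewrite (dX3 [:: q; s] p) (dX3 [:: p; s] q) (dX3 [:: p; q] s) lie_tv; [|by case: aa|by []].
rewrite !big_ord_recl big_ord0 -[set_nth _ _ _ _]/[:: 'D_p X x; q; s].
rewrite -[set_nth _ _ _ _]/[:: p; 'D_q X x; s] -[set_nth _ _ _ _]/[:: p; q; 'D_s X x].
rewrite (alternating_swap01 p ('D_q X x) aa)// (alternating_swap12 p q ('D_s X x) aa)//.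
rewrite (alternating_swap01 p ('D_s X x) aa)//.
move: dX; set d1 := 'D_(X x) _ _; set d2 := 'D_p _ _; set d3 := 'D_q _ _; set d4 := 'D_s _ _.
set e1 := a x _; set e2 := a x _; set e3 := a x _ => dX.
have -> : d1 = d2 - d3 + d4 by apply/eqP; rewrite -subr_eq0 -[eqbRHS]dX; apply/eqP; ring.
ring.
Qed.

End Extd.

(** These tactics turn derivatives, values of a form and circle coordinates into variables, so that
    [ring] sees a polynomial identity. *)
Ltac gen_derive := repeat match goal with
  |- context [@derive ?R ?V ?W ?v ?f ?x] => generalize (@derive R V W v f x); intro end.
Ltac gen_form a := repeat match goal with
  |- context [a (tv ?l)] => generalize (a (tv l)); intro end.
Ltac gen_entry := repeat match goal with
  |- context [@fun_of_matrix ?R ?m ?n (rsubmx ?v) ?i ?j] =>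
    generalize (@fun_of_matrix R m n (rsubmx v) i j); intro end.

Lemma derive_comp_lsubmx (R : realType) m n (F : 'rV[R]_m -> R) (y v : 'rV[R]_(m + n)) :
  'D_v (fun p => F (lsubmx p)) y = 'D_(lsubmx v) F (lsubmx y).
Proof.
rewrite /derive; set g1 := fun h => h^-1 *: _; set g2 := fun h => h^-1 *: _.
suff -> : g1 = g2 by [].
by rewrite /g1 /g2; apply/funext => h /=; rewrite linearP.
Qed.

(** * Exterior derivatives on the product with the circle *)

Section Seven.
Variable R : realType.
Local Notation V := 'rV[R]_6.
Local Notation W := 'rV[R]_(6 + 1).
Local Notation L := lsubmx.
Local Notation r x := (rsubmx x 0 0).

Variables (D : set V) (oD : open D).
Variables (w : V -> kform R R 6 2) (Ur Ui : V -> kform R R 6 3) (nu f : V -> R).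
Variable X : V -> V.
Hypotheses (sw : sform D w) (sUr : sform D Ur) (sUi : sform D Ui) (sX : svec D X).
Hypothesis snu : forall x, D x -> smooth_at x nu.
Hypothesis nu_gt0 : forall x, D x -> 0 < nu x.
Hypothesis Dnu : forall x v, D x -> 'D_v nu x = nu x * 'D_v f x.
Hypothesis sf : forall x, D x -> smooth_at x f.
Hypothesis dw0 : forall x v, D x -> extd w x v = 0.
Hypothesis dUr0 : forall x v, D x -> extd Ur x v = 0.
Hypothesis dUi0 : forall x v, D x -> extd Ui x v = 0.

Lemma open_lsubmx : open [set y : W | D (L y)].
Proof.
have c : continuous (@lsubmx R 1 6 1 : W -> V).
  by move=> y; apply: differentiable_continuous; exact: differentiable_lsubmx.
exact: (continuousP _).1 c _ oD.
Qed.

(** The forms in play are invariant along the circle, so every derivative on the product descends to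
    the base. *)
Lemma derive7 (F : W -> R) (G : V -> R) (y v : W) : D (L y) ->
  (forall p : W, D (L p) -> F p = G (L p)) -> 'D_v F y = 'D_(L v) G (L y).
Proof.
move=> Dy FG; rewrite -derive_comp_lsubmx; apply: near_eq_derive.
have : nbhs y [set p : W | D (L p)] by apply: open_nbhs_nbhs; split=> //; exact: open_lsubmx.
by apply: filterS => p; exact: FG.
Qed.

Lemma extd_phi7 (y : W) v : D (L y) ->
  extd (fun p => phi7 (w (L p)) (Ur (L p)) (nu (L p))) y v =
  dphi7 (w (L y)) (Ur (L y)) (nu (L y)) (fun u => 'D_u f (L y)) v.
Proof.
move=> Dy; rewrite [v]tv_codom enum_ordSl enum_ordSl enum_ordSl enum_ordSl.
rewrite (size0nil (size_enum_ord 0)) /=.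
set v0 := v _; set v1 := v _; set v2 := v _; set v3 := v _.
have aw p (Dp : D p) := (sw Dp).1; have aUr p (Dp : D p) := (sUr Dp).1.
have df : forall c u v, 'D_(c *: u + v) f (L y) = c * 'D_u f (L y) + 'D_v f (L y).
  by move=> c u1 u2; exact: derive_linear (sf Dy).
have sw' u : smooth_at (L y) (fun q => w q u) := (sw Dy).2 u.
have sUr' u : smooth_at (L y) (fun q => Ur q u) := (sUr Dy).2 u.
have snu' := snu Dy.
have n0 : nu (L y) != 0 by rewrite gt_eqF// nu_gt0.
have snuV := smooth_atV n0 snu'.
have E x a b c : 'D_x (fun p => phi7 (w (L p)) (Ur (L p)) (nu (L p)) (tv [:: a; b; c])) y =
    (nu (L y))^-1 * ('D_(L x) (fun q => Ur q (tv [:: L a; L b; L c])) (L y) -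
      'D_(L x) f (L y) * Ur (L y) (tv [:: L a; L b; L c])) +
    nu (L y) * (r a * 'D_(L x) (fun q => w q (tv [:: L b; L c])) (L y) -
      r b * 'D_(L x) (fun q => w q (tv [:: L a; L c])) (L y) +
      r c * 'D_(L x) (fun q => w q (tv [:: L a; L b])) (L y) +
      'D_(L x) f (L y) * (r a * w (L y) (tv [:: L b; L c]) - r b * w (L y) (tv [:: L a; L c]) +
         r c * w (L y) (tv [:: L a; L b]))).
  rewrite (@derive7 _ (fun q => (nu q)^-1 * Ur q (tv [:: L a; L b; L c]) +
    nu q * (r a * w q (tv [:: L b; L c]) - r b * w q (tv [:: L a; L c]) +
            r c * w q (tv [:: L a; L b]))) y x)//; last first.
    by move=> p Dp; rewrite phi7E//; auto.
  rewrite derive_ptD; [|smooth|smooth]; congr (_ + _).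
    rewrite derive_ptM; [|smooth|smooth].
    by rewrite derive_ptV// Dnu//; field.
  rewrite derive_ptM; [|smooth|smooth].
  rewrite derive_ptD; [|smooth|smooth].
  rewrite derive_ptD; [|smooth|smooth].
  rewrite derive_ptN; [|smooth].
  rewrite !derive_ptZ; try by smooth.
  by rewrite Dnu//; ring.
rewrite extd3E !E dphi7E; [|by auto|by auto|by []].
have := dUr0 (tv [:: L v0; L v1; L v2; L v3]) Dy.
rewrite extd3E => /eqP; rewrite subr_eq add0r => /eqP dUE.
have dwE a b c := dw0 (tv [:: a; b; c]) Dy.
(* Closedness is solved for the derivative along the last argument; with these derivatives
   eliminated, the claim is a polynomial identity. *)
have dwE' a b c : 'D_c (fun q => w q (tv [:: a; b])) (L y) =
    'D_b (fun q => w q (tv [:: a; c])) (L y) - 'D_a (fun q => w q (tv [:: b; c])) (L y).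
  by have := dwE a b c; rewrite extd2E => /eqP; rewrite addr_eq0 => /eqP h; rewrite -[LHS]opprK -h opprB.
rewrite -dUE (dwE' (L v0) (L v1) (L v2)) (dwE' (L v0) (L v1) (L v3)).
rewrite (dwE' (L v0) (L v2) (L v3)) (dwE' (L v1) (L v2) (L v3)) /=.
gen_derive; gen_form (w (L y)); gen_form (Ur (L y)); gen_entry; ring.
Qed.

Let closed2 x a b c : D x -> 'D_c (fun q => w q (tv [:: a; b])) x =
  'D_b (fun q => w q (tv [:: a; c])) x - 'D_a (fun q => w q (tv [:: b; c])) x.
Proof.
move=> Dx; have /eqP := dw0 (tv [:: a; b; c]) Dx.
by rewrite extd2E addr_eq0 => /eqP h; rewrite -[LHS]opprK -h opprB.
Qed.

Let closed3 x a b c d : D x -> 'D_d (fun q => Ui q (tv [:: a; b; c])) x =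
  'D_a (fun q => Ui q (tv [:: b; c; d])) x - 'D_b (fun q => Ui q (tv [:: a; c; d])) x +
  'D_c (fun q => Ui q (tv [:: a; b; d])) x.
Proof.
move=> Dx; have /eqP := dUi0 (tv [:: a; b; c; d]) Dx.
by rewrite extd3E subr_eq add0r => /eqP ->.
Qed.

Lemma extd_psi7 (y : W) v : D (L y) ->
  extd (fun p => psi7 (w (L p)) (Ui (L p))) y v = 0.
Proof.
move=> Dy; rewrite [v]tv_codom 5!enum_ordSl (size0nil (size_enum_ord 0)) /=.
set v0 := v _; set v1 := v _; set v2 := v _; set v3 := v _; set v4 := v _.
have aw p (Dp : D p) := (sw Dp).1; have aUi p (Dp : D p) := (sUi Dp).1.
have sw' u : smooth_at (L y) (fun q => w q u) := (sw Dy).2 u.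
have sUi' u : smooth_at (L y) (fun q => Ui q u) := (sUi Dy).2 u.
pose W2 (p q : W) : R := w (L y) (tv [:: L p; L q]).
pose DW (u p q : W) : R := 'D_(L u) (fun z => w z (tv [:: L p; L q])) (L y).
pose DU (u p q s : W) : R := 'D_(L u) (fun z => Ui z (tv [:: L p; L q; L s])) (L y).
pose ry (u : W) : R := r u.
have E x a b c d : 'D_x (fun p => psi7 (w (L p)) (Ui (L p)) (tv [:: a; b; c; d])) y =
    (W2 a b * DW x c d + W2 c d * DW x a b) - (W2 a c * DW x b d + W2 b d * DW x a c) +
    (W2 a d * DW x b c + W2 b c * DW x a d) -
    (ry a * DU x b c d - ry b * DU x a c d + ry c * DU x a b d - ry d * DU x a b c).
  rewrite (@derive7 _ (fun q =>
    w q (tv [:: L a; L b]) * w q (tv [:: L c; L d]) -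
    w q (tv [:: L a; L c]) * w q (tv [:: L b; L d]) +
    w q (tv [:: L a; L d]) * w q (tv [:: L b; L c]) -
    (r a * Ui q (tv [:: L b; L c; L d]) - r b * Ui q (tv [:: L a; L c; L d]) +
     r c * Ui q (tv [:: L a; L b; L d]) - r d * Ui q (tv [:: L a; L b; L c]))) y x)//; last first.
    by move=> p Dp; rewrite psi7E//; auto.
  rewrite derive_ptD; [|smooth|smooth]; congr (_ + _).
    rewrite derive_ptD; [|smooth|smooth]; congr (_ + _); last by rewrite derive_ptM; smooth.
    rewrite derive_ptD; [|smooth|smooth]; congr (_ + _); first by rewrite derive_ptM; smooth.
    rewrite derive_ptN; [|smooth]; congr (- _).
    by rewrite derive_ptM; smooth.
  rewrite derive_ptN; [|smooth]; congr (- _).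
  rewrite derive_ptD; [|smooth|smooth]; congr (_ + _).
    rewrite derive_ptD; [|smooth|smooth]; congr (_ + _); last by rewrite derive_ptZ; smooth.
    rewrite derive_ptD; [|smooth|smooth]; congr (_ + _); first by rewrite derive_ptZ; smooth.
    rewrite derive_ptN; [|smooth]; congr (- _).
    by rewrite derive_ptZ; smooth.
  rewrite derive_ptN; [|smooth]; congr (- _).
  by rewrite derive_ptZ; smooth.
have W3 a b c : DW c a b = DW b a c - DW a b c := closed2 (L a) (L b) (L c) Dy.
have U4 a b c d : DU d a b c = DU a b c d - DU b a c d + DU c a b d :=
  closed3 (L a) (L b) (L c) (L d) Dy.
rewrite extd4E !E; clear E; move: W3 U4; clearbody W2 DW DU ry => W3 U4.
(* Closedness for all ten increasing triples and, further on, all five increasing quadruples of the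
   arguments. *)
rewrite (W3 v0 v1 v2) (W3 v0 v1 v3) (W3 v0 v1 v4) (W3 v0 v2 v3) (W3 v0 v2 v4).
rewrite (W3 v0 v3 v4) (W3 v1 v2 v3) (W3 v1 v2 v4) (W3 v1 v3 v4) (W3 v2 v3 v4).
rewrite (U4 v0 v1 v2 v3) (U4 v0 v1 v2 v4) (U4 v0 v1 v3 v4) (U4 v0 v2 v3 v4) (U4 v1 v2 v3 v4).
clear -v0; ring.
Qed.

(** Horizontal lifts and, with [ver], the field [d_r]: the components of a 4-form on [hor]s alone
    and on [ver] with three [hor]s are the two equations to be compared. *)
Definition hor (u : V) : W := row_mx u 0.
Definition ver : W := row_mx 0 1%:M.

Let Lhor u : L (hor u) = u. Proof. exact: row_mxKl. Qed.
Let rhor u : r (hor u) = 0. Proof. by rewrite row_mxKr mxE. Qed.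
Let Lver : L ver = 0. Proof. exact: row_mxKl. Qed.
Let rver : r ver = 1. Proof. by rewrite row_mxKr mxE. Qed.

Let aw p (Dp : D p) := (sw Dp).1.
Let aUi p (Dp : D p) := (sUi Dp).1.
Let saw p l (Dp : D p) : smooth_at p (fun q => w q (tv (X q :: l))) := smooth_head oD l sw sX Dp.

(** Since [w] is closed, [d ((X _| w) /\ w) = (L_X w) /\ w] by Cartan's formula; the [dr] term of
    [chi7] does not see horizontal vectors. *)
Lemma extd_chi7_hor (y : W) a b c d : D (L y) ->
  extd (fun p => chi7 (w (L p)) (Ui (L p)) (X (L p))) y (tv (map hor [:: a; b; c; d])) =
  let x := L y in let Lw p q := lie X w x (tv [:: p; q]) in
  let W2 p q := w x (tv [:: p; q]) in
  - (Lw a b * W2 c d - Lw a c * W2 b d + Lw a d * W2 b c +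
     W2 a b * Lw c d - W2 a c * Lw b d + W2 a d * Lw b c).
Proof.
move=> Dy; have sw' u : smooth_at (L y) (fun q => w q u) := (sw Dy).2 u.
have saw' l := @saw _ l Dy.
pose T (p : V) : R := w (L y) (tv [:: X (L y); p]).
pose W2 (p q : V) : R := w (L y) (tv [:: p; q]).
pose DT (u p : V) : R := 'D_u (fun z => w z (tv [:: X z; p])) (L y).
pose DW (u p q : V) : R := 'D_u (fun z => w z (tv [:: p; q])) (L y).
have E x p q s : 'D_x (fun p0 => chi7 (w (L p0)) (Ui (L p0)) (X (L p0))
      (tv [:: hor p; hor q; hor s])) y =
    - ((T p * DW (L x) q s + W2 q s * DT (L x) p) -
       (T q * DW (L x) p s + W2 p s * DT (L x) q) +
       (T s * DW (L x) p q + W2 p q * DT (L x) s)).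
  rewrite (@derive7 _ (fun z => - (w z (tv [:: X z; p]) * w z (tv [:: q; s]) -
      w z (tv [:: X z; q]) * w z (tv [:: p; s]) +
      w z (tv [:: X z; s]) * w z (tv [:: p; q]))) y x)//; last first.
    move=> z Dz; rewrite chi7E; [|by auto|by auto].
    by rewrite !Lhor !rhor; ring.
  rewrite derive_ptN; [|smooth]; congr (- _).
  rewrite derive_ptD; [|smooth|smooth]; congr (_ + _); last by rewrite derive_ptM; smooth.
  rewrite derive_ptD; [|smooth|smooth]; congr (_ + _); first by rewrite derive_ptM; smooth.
  rewrite derive_ptN; [|smooth]; congr (- _).
  by rewrite derive_ptM; smooth.
have W3 p q s : DW s p q = DW q p s - DW p q s := closed2 p q s Dy.
pose Lw (p q : V) : R := lie X w (L y) (tv [:: p; q]).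
have LE p q : Lw p q = DT p q - DT q p :=
  @lie2_closed _ _ D oD w X (L y) p q sw sX Dy (fun v => dw0 v Dy).
rewrite extd3E !E !Lhor [LHS]/= -[RHS]/(- (Lw a b * W2 c d - Lw a c * W2 b d +
  Lw a d * W2 b c + W2 a b * Lw c d - W2 a c * Lw b d + W2 a d * Lw b c)).
clear E; move: W3 LE; clearbody T W2 DT DW Lw => W3 LE.
rewrite !LE (W3 a b c) (W3 a b d) (W3 a c d) (W3 b c d); clear -a; ring.
Qed.

(** [d (dr /\ (X _| Ui)) = - dr /\ d (X _| Ui)], and the last factor is [L_X Ui] by Cartan's
    formula. The other term of [chi7] is pulled back from the base, hence invisible to [ver]. *)
Lemma extd_chi7_ver (y : W) a b c : D (L y) ->
  extd (fun p => chi7 (w (L p)) (Ui (L p)) (X (L p))) y (tv (ver :: map hor [:: a; b; c])) =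
  - lie X Ui (L y) (tv [:: a; b; c]).
Proof.
move=> Dy; rewrite (@lie3_closed _ _ D oD Ui X (L y) a b c sUi sX Dy (fun v => dUi0 v Dy)) extd3E /=.
have w0 z u : D z -> w z (tv [:: u; 0]) = 0.
  by move=> Dz; rewrite (alternating_swap01 _ _ (aw Dz))// multilinear_head0 ?oppr0//; case: (aw Dz).
have E x p q : 'D_x (fun p0 => chi7 (w (L p0)) (Ui (L p0)) (X (L p0))
      (tv [:: ver; hor p; hor q])) y = 'D_(L x) (fun z => Ui z (tv [:: X z; p; q])) (L y).
  apply: derive7 => // z Dz; rewrite chi7E; [|by auto|by auto].
  rewrite !Lhor !rhor Lver rver !(w0 _ _ Dz).
  have w0' u : w (L z) (tv [:: 0; u]) = 0 by rewrite multilinear_head0//; case: (aw Dz).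
  by rewrite !w0'; ring.
rewrite (E (hor a) b c) (E (hor b) a c) (E (hor c) a b) !Lhor.
rewrite (@derive7 _ (fun z => - (w z (tv [:: X z; a]) * w z (tv [:: b; c]) -
      w z (tv [:: X z; b]) * w z (tv [:: a; c]) +
      w z (tv [:: X z; c]) * w z (tv [:: a; b]))) y ver)//; last first.
  move=> z Dz; rewrite chi7E; [|by auto|by auto].
  by rewrite !Lhor !rhor; ring.
by rewrite Lver derive0; ring.
Qed.

End Seven.

(** * Types of complex forms *)

(** Subsets of ['I_k] as an explicit list of words, so that sums over types unfold by
    computation. *)
Fixpoint bwords k : seq (seq bool) :=
  if k is k'.+1 then [seq true :: l | l <- bwords k'] ++ [seq false :: l | l <- bwords k']
  else [:: [::]].

Lemma size_bwords k l : l \in bwords k -> size l = k.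
Proof.
elim: k l => [|k IH] l /=; first by rewrite inE => /eqP ->.
by rewrite mem_cat => /orP[] /mapP[m /IH <- ->].
Qed.

Lemma big_bffun (K : nmodType) k (H : seq bool -> K) :
  \sum_(f : {ffun 'I_k -> bool}) H [seq f j | j <- enum 'I_k] = \sum_(l <- bwords k) H l.
Proof.
elim: k H => [|k IH] H /=.
  rewrite big_seq1 (eq_bigr (fun=> H [::])) => [|f _]; last first.
    by rewrite (size0nil (size_enum_ord 0)).
  by rewrite big_const card_ffun !card_ord expn0 /= addr0.
rewrite big_ffunS big_bool big_cat !big_map /= -!IH; congr (_ + _);
  apply: eq_bigr => f _; congr H; rewrite enum_ordSl /= ffunE unlift_none /=;
  by congr (_ :: _); rewrite -map_comp; apply: eq_map => j /=; rewrite ffunE liftK.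
Qed.

Definition bset k (l : seq bool) : {set 'I_k} := finset (fun i : 'I_k => nth false l i).

Lemma big_setE (K : nmodType) k (F : {set 'I_k} -> K) :
  \sum_(S : {set 'I_k}) F S = \sum_(l <- bwords k) F (bset k l).
Proof.
rewrite -(big_bffun k (fun l => F (bset k l))).
rewrite (reindex (fun f : {ffun 'I_k -> bool} => finset (fun i : 'I_k => f i))) /=.
  apply: eq_bigr => f _; congr F; apply/setP => i; rewrite !inE.
  by rewrite (nth_map i) ?size_enum_ord// nth_ord_enum.
exists (fun S : {set 'I_k} => [ffun i => i \in S]) => [f _|S _].
  by apply/ffunP => i; rewrite ffunE inE.
by apply/setP => i; rewrite inE ffunE.
Qed.

Lemma card_bset k l : size l = k -> #|bset k l| = count id l.
Proof.
move=> sl; rewrite -sum1_card -sum1_count (big_nth false) sl big_mkord.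
by apply: eq_bigl => i; rewrite inE.
Qed.

Lemma card_bsetC k l : size l = k -> #|~: bset k l| = count negb l.
Proof.
move=> sl; have := cardsC (bset k l); rewrite card_ord card_bset// -[in RHS]sl.
by rewrite -(count_predC id l) => /addnI ->; apply: eq_count.
Qed.

Section Components.
Variables (R : realType) (n : nat).
Local Notation V := 'rV[R]_n.

Definition mlC k (a : kform R R[i] n k) : Prop :=
  multilinear (re a) /\ multilinear (im a).

Lemma multilinear_scale k (a : kform R R n k) (c : 'I_k -> R) v : multilinear a ->
  a (fun j => c j *: v j) = (\prod_j c j) * a v.
Proof.
elim: k a c v => [|k IH] a c v la.
  by rewrite big_ord0 mul1r; congr a; apply/funext => -[].
have -> : (fun j => c j *: v j) =
    vcons (c ord0 *: v ord0) (fun j => c (lift ord0 j) *: v (lift ord0 j)) :> ('I_k.+1 -> V).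
  by apply/funext => j; rewrite /vcons; case: (unliftP ord0 j) => [i ->|->].
have -> : vcons (c ord0 *: v ord0) (fun j : 'I_k => c (lift ord0 j) *: v (lift ord0 j)) =
    tv (c ord0 *: v ord0 :: [seq c (lift ord0 j) *: v (lift ord0 j) | j <- enum 'I_k]).
  by rewrite tv_cons_vcons -tv_codom.
rewrite multilinear_headZ// tv_cons_vcons -tv_codom big_ord_recl -mulrA; congr (_ * _).
have := IH (contract (v ord0) a) (fun j => c (lift ord0 j)) (fun j => v (lift ord0 j)).
rewrite /contract => ->; last exact: multilinear_contract.
congr (_ * a _); apply/funext => j.
by rewrite /vcons; case: (unliftP ord0 j) => [i ->|->].
Qed.

Lemma mlC_scale k (a : kform R R[i] n k) (c : 'I_k -> R) v : mlC a ->
  a (fun j => c j *: v j) = (\prod_j c j)%:C * a v.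
Proof.
move=> [lr li]; apply/eqP; rewrite eq_complex; apply/andP; split; apply/eqP.
  by rewrite -[LHS]/(re a _) (multilinear_scale _ _ lr) /re; case: (a v) => x y /=; ring.
by rewrite -[LHS]/(im a _) (multilinear_scale _ _ li) /im; case: (a v) => x y /=; ring.
Qed.

Fixpoint Jw (J : 'M[R]_n) (m : seq bool) (s : seq V) : seq V :=
  if s is x :: s' then (if head false m then x *m J else x) :: Jw J (behead m) s' else [::].

Lemma Jw_nth J m s i : (Jw J m s)`_i = if nth false m i then s`_i *m J else s`_i.
Proof.
elim: s m i => [|x s IH] m i /=; first by rewrite !nth_nil mul0mx; case: ifP.
by case: i => [|i] /=; [rewrite nth0|rewrite IH nth_behead].
Qed.

Fixpoint ipow (k : nat) : R[i] :=
  match k with O => 1 | S O => 'i%C | S (S k') => - ipow k' end.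

Lemma ipowE k : ipow k = 'i%C ^+ k.
Proof.
suff : ipow k = 'i%C ^+ k /\ ipow k.+1 = 'i%C ^+ k.+1 by case.
elim: k => [|k [IH1 IH2]]; first by rewrite expr0 expr1.
by split=> //=; rewrite IH1 -[k.+2]add2n exprD sqr_i mulN1r.
Qed.

Fixpoint ntrue (m : seq bool) : nat :=
  if m is b :: m' then if b then (ntrue m').+1 else ntrue m' else 0%N.

Lemma ntrueE m : ntrue m = count id m.
Proof. by elim: m => //= -[] m ->. Qed.

(** One sign for each slot that is of type (1,0), marked in [l], and carries a [J], marked in [m]:
    it is the minus sign of [proj10]. Like [ipow], it is recursive so that [/=] evaluates it on
    explicit words. *)
Fixpoint sgnw2 (l m : seq bool) (z : R[i]) : R[i] :=
  match l, m with
  | b :: l', c :: m' => if b && c then - sgnw2 l' m' z else sgnw2 l' m' z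
  | _, _ => z end.

Definition sgnw (l m : seq bool) : nat := count id [seq p.1 && p.2 | p <- zip l m].

(** Every projector [(v -+ i J v) / 2] is expanded: [l] tells which slots are of type (1,0), and [m]
    which slots take the term with [J]. *)
Lemma component_tv (J : 'M[R]_n) p q k (a : kform R R[i] n k) s : mlC a ->
  component J p q a (tv s) = (2^-1 ^+ k) *
    \sum_(l <- [seq l <- bwords k | (count id l == p) && (count negb l == q)])
      \sum_(m <- bwords k) sgnw2 l m (ipow (ntrue m)) * a (tv (Jw J m s)).
Proof.
move=> la; rewrite /component big_mkcond /= big_setE big_filter [in RHS]big_mkcond.
rewrite mulr_sumr; apply: eq_big_seq => l /size_bwords sl.
rewrite card_bset// card_bsetC//; case: ifP => _; last by rewrite mulr0.
rewrite /cext big_setE mulr_sumr; apply: eq_big_seq => m /size_bwords sm.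
have -> : sgnw2 l m (ipow (ntrue m)) = 'i%C ^+ count id m * (-1) ^+ sgnw l m.
  rewrite ipowE ntrueE; move: ('i%C ^+ _) => z; elim: l m {sl sm} => [|b l IH] [|c m] /=.
  - by rewrite mulr1.
  - by rewrite mulr1.
  - by rewrite mulr1.
  - by rewrite IH; case: b; case: c => //=; rewrite /sgnw /= ?add0n ?add1n ?exprS ?mulrN1 ?mulN1r ?mulrN.
rewrite card_bset// -!mulrA mulrCA; congr (_ * _).
have -> : (fun j : 'I_k => if j \in bset k m
    then (if j \in bset k l then proj10 J (tv s j) else proj01 J (tv s j)).2
    else (if j \in bset k l then proj10 J (tv s j) else proj01 J (tv s j)).1) =
    (fun j => (2^-1 * (-1) ^+ (nth false l j && nth false m j)) *: tv (Jw J m s) j).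
  apply/funext => j; rewrite !inE /tv Jw_nth.
  case: (nth false m j); rewrite ?andbT ?andbF ?expr0 ?mulr1; case: (nth false l j) => //=.
    by rewrite expr1 mulrN1.
  by rewrite expr0 mulr1.
rewrite (mlC_scale _ _ la) mulrA; congr (_ * _).
rewrite big_split /= prodr_const card_ord -expr_sum rmorphM rmorphXn /=; congr (_ * _).
  by congr (_ ^+ _); rewrite fmorphV rmorph_nat.
rewrite rmorphXn rmorphN1; congr (_ ^+ _).
rewrite /sgnw count_map -sum1_count (big_nth (false, false)) size_zip sl sm minnn.
rewrite big_mkord [RHS]big_mkcond /=; apply: eq_bigr => i _.
by rewrite nth_zip ?sl ?sm//=; case: (_ && _).
Qed.

Lemma mlC_cx k (b : kform R R n k) : multilinear b -> mlC (cx b).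
Proof.
move=> lb; split; first by [].
by move=> v j c u w; rewrite /im /cx /= mulr0 addr0.
Qed.

Variable J : 'M[R]_n.

Lemma component11 (a : kform R R[i] n 2) p q : mlC a ->
  component J 1 1 a (tv [:: p; q]) =
  2^-1 * (a (tv [:: p; q]) + a (tv [:: p *m J; q *m J])).
Proof.
move=> la; rewrite component_tv//.
rewrite (_ : [seq _ <- _ | _] = [:: [:: true; false]; [:: false; true]])//.
rewrite !big_cons !big_nil /=; by field.
Qed.

Lemma component30 (a : kform R R[i] n 3) p q s : mlC a ->
  component J 3 0 a (tv [:: p; q; s]) = 8^-1 * (a (tv [:: p; q; s])
    - a (tv [:: p *m J; q *m J; s]) - a (tv [:: p *m J; q; s *m J])
    - a (tv [:: p; q *m J; s *m J])
    - 'i%C * (a (tv [:: p *m J; q; s]) + a (tv [:: p; q *m J; s])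
              + a (tv [:: p; q; s *m J]) - a (tv [:: p *m J; q *m J; s *m J]))).
Proof.
move=> la; rewrite component_tv//.
rewrite (_ : [seq _ <- _ | _] = [:: [:: true; true; true]])//.
rewrite !big_cons !big_nil /=; by field.
Qed.

Lemma component03 (a : kform R R[i] n 3) p q s : mlC a ->
  component J 0 3 a (tv [:: p; q; s]) = 8^-1 * (a (tv [:: p; q; s])
    - a (tv [:: p *m J; q *m J; s]) - a (tv [:: p *m J; q; s *m J])
    - a (tv [:: p; q *m J; s *m J])
    + 'i%C * (a (tv [:: p *m J; q; s]) + a (tv [:: p; q *m J; s])
              + a (tv [:: p; q; s *m J]) - a (tv [:: p *m J; q *m J; s *m J]))).
Proof.
move=> la; rewrite component_tv//.
rewrite (_ : [seq _ <- _ | _] = [:: [:: false; false; false]])//.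
rewrite !big_cons !big_nil /=; by field.
Qed.

Lemma component31 (a : kform R R[i] n 4) p q s t : mlC a ->
  component J 3 1 a (tv [:: p; q; s; t]) = 8^-1 * (2 * a (tv [:: p; q; s; t])
    - 2 * a (tv [:: p *m J; q *m J; s *m J; t *m J])
    - 'i%C * (a (tv [:: p *m J; q; s; t]) + a (tv [:: p; q *m J; s; t])
              + a (tv [:: p; q; s *m J; t]) + a (tv [:: p; q; s; t *m J])
              + a (tv [:: p; q *m J; s *m J; t *m J]) + a (tv [:: p *m J; q; s *m J; t *m J])
              + a (tv [:: p *m J; q *m J; s; t *m J]) + a (tv [:: p *m J; q *m J; s *m J; t]))).
Proof.
move=> la; rewrite component_tv//.
rewrite (_ : [seq _ <- _ | _] = [:: [:: true; true; true; false]; [:: true; true; false; true];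
  [:: true; false; true; true]; [:: false; true; true; true]])//.
rewrite !big_cons !big_nil /=; by field.
Qed.

End Components.

(** * Holomorphic volume forms are closed *)

Lemma extd_multilinear (R : realType) n k (D : set 'rV[R]_n) (oD : open D)
    (a : 'rV[R]_n -> kform R R n k) x : sform D a -> D x -> multilinear (extd a x).
Proof.
move=> sa Dx v j c u w; rewrite /extd mulr_sumr -big_split; apply: eq_bigr => i _ /=.
rewrite [X in _ = X + _]mulrCA -mulrDr; congr (_ * _).
(* In the summand [i = j] the slot is the direction of derivation, in the others an argument of the
   form. *)
have [->|ji] := eqVneq i j.
  have A z : (fun m => if lift j m == j then z else v (lift j m)) = (fun m : 'I_k => v (lift j m)).
    by apply/funext => m; rewrite eq_sym (negPf (neq_lift _ _)).
  rewrite /= ?eqxx !A; apply: derive_linear; exact: (sa x Dx).2.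
have [m jm] : exists m, j = lift i m by case: (unliftP i j) ji => [m ->|->]; [exists m|rewrite eqxx].
have A z : (fun l => if lift i l == j then z else v (lift i l)) =
    [eta (fun l => v (lift i l)) with m |-> z] :> ('I_k -> 'rV[R]_n).
  by apply/funext => l /=; rewrite jm (inj_eq lift_inj).
rewrite /= ?(negPf ji) !A; exact: (derive_alternating oD _ sa Dx).1.
Qed.

Section Closed.
Variable R : realType.
Local Notation V := 'rV[R]_6.
Local Notation i := ('i%C : R[i]).
Variables (D : set V) (oD : open D) (J : V -> 'M[R]_6) (U : V -> kform R R[i] 6 3).
Hypothesis J2 : forall x, D x -> J x *m J x = - 1%:M.
Hypothesis sJ : forall x a b, D x -> smooth_at x (fun y => J y a b).
Hypothesis nij : forall x a b, D x -> nijenhuis J (fun=> a) (fun=> b) x = 0.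
Hypothesis sUr : sform D (fun x => re (U x)).
Hypothesis sUi : sform D (fun x => im (U x)).
Hypothesis U30 : forall x, D x -> component (J x) 3 0 (U x) = U x.
Hypothesis dbarU : forall x v, D x -> dbar J 3 0 U x v = 0.

Let i2 : i * i = -1. Proof. by rewrite -expr2 sqr_i. Qed.

Lemma mulmx_JJ x (v : V) : D x -> v *m J x *m J x = - v.
Proof. by move=> Dx; rewrite -mulmxA J2// mulmxN mulmx1. Qed.

Let mlU x : D x -> mlC (U x).
Proof. by move=> Dx; split; [case: (sUr Dx) => -[]|case: (sUi Dx) => -[]]. Qed.

Lemma mlC_slot k (a : kform R R[i] 6 k) l1 l2 c u w : mlC a -> (size l1 < k)%N ->
  a (tv (l1 ++ (c *: u + w) :: l2)) =
  c%:C * a (tv (l1 ++ u :: l2)) + a (tv (l1 ++ w :: l2)).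
Proof.
move=> [lr li] sl; have hr := multilinear_slot l2 c u w lr sl.
have hi := multilinear_slot l2 c u w li sl; move: hr hi; rewrite /re /im.
case: (a (tv (l1 ++ (c *: u + w) :: l2))) => x1 y1.
case: (a (tv (l1 ++ u :: l2))) => x2 y2; case: (a (tv (l1 ++ w :: l2))) => x3 y3 /= -> ->.
by simpc.
Qed.

Lemma mlC_slotN k (a : kform R R[i] 6 k) l1 l2 u : mlC a -> (size l1 < k)%N ->
  a (tv (l1 ++ - u :: l2)) = - a (tv (l1 ++ u :: l2)).
Proof.
move=> la sl; have h0 := mlC_slot l2 (-1) 0 0 la sl.
have := mlC_slot l2 (-1) u 0 la sl; rewrite scaleN1r addr0 => ->.
move: h0; rewrite scaler0 addr0 rmorphN rmorph1 !mulN1r addNr => ->.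
by rewrite addr0.
Qed.

(** Substituting [p *m J x] for [p] permutes the eight terms of [component30] up to the factor
    [i]. *)
Lemma type30 x p q s : D x ->
  U x (tv [:: p *m J x; q; s]) = i * U x (tv [:: p; q; s]).
Proof.
move=> Dx; have la := mlU Dx.
have N b c : U x (tv [:: - p; b; c]) = - U x (tv [:: p; b; c]).
  exact: (mlC_slotN (l1 := [::])).
rewrite -(U30 Dx) !component30// mulmx_JJ// !N.
set A1 := U x (tv [:: p *m J x; q; s]); set A2 := U x (tv [:: p; q *m J x; s]).
set A3 := U x (tv [:: p; q; s *m J x]); set A4 := U x (tv [:: p; q; s]).
set A5 := U x (tv [:: p *m J x; q *m J x; s]); set A6 := U x (tv [:: p *m J x; q; s *m J x]).
set A7 := U x (tv [:: p; q *m J x; s *m J x]); set A8 := U x (tv [:: p *m J x; q *m J x; s *m J x]).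
rewrite mulrCA; congr (_ * _); rewrite [RHS]mulrBr [i * (i * _)]mulrA i2; ring.
Qed.

Definition dU x v l : R[i] :=
  'D_v (fun y => re (U y) (tv l)) x +i* 'D_v (fun y => im (U y) (tv l)) x.

(** [type30] differentiated in the base point; the extra term comes from the variation of [J]. *)
Lemma dU_J x v (b c d : V) : D x -> dU x v [:: b *m J x; c; d] =
  i * dU x v [:: b; c; d] - U x (tv [:: 'D_v (fun y => b *m J y) x; c; d]).
Proof.
move=> Dx; have sX : svec D (fun y => b *m J y).
  move=> y Dy j; apply: (@smooth_at_ext _ _ (fun y => \sum_k b 0 k * J y k j)).
    by near=> z; rewrite mxE.
  by apply: smooth_at_sum => k; apply: smooth_atZ; exact: sJ.
have hr := @derive_head _ _ D oD _ _ _ [:: c; d] x v sUr sX Dx.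
have hi := @derive_head _ _ D oD _ _ _ [:: c; d] x v sUi sX Dx.
have er : 'D_v (fun y => re (U y) (tv [:: b *m J y; c; d])) x =
    - 'D_v (fun y => im (U y) (tv [:: b; c; d])) x.
  rewrite -derive_ptN; last exact: (sUi Dx).2.
  apply: near_eq_derive; apply: filterS (near_D oD Dx) => y Dy.
  by rewrite /re /im type30//; case: (U y _) => p q /=; rewrite mul0r mul1r sub0r.
have ei : 'D_v (fun y => im (U y) (tv [:: b *m J y; c; d])) x =
    'D_v (fun y => re (U y) (tv [:: b; c; d])) x.
  apply: near_eq_derive; apply: filterS (near_D oD Dx) => y Dy.
  by rewrite /re /im type30//; case: (U y _) => p q /=; rewrite mul0r mul1r add0r.
rewrite er in hr; rewrite ei in hi; rewrite /dU.
have -> : 'D_v (fun y => re (U y) (tv [:: b *m J x; c; d])) x =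
    - 'D_v (fun y => im (U y) (tv [:: b; c; d])) x - re (U x) (tv [:: 'D_v (fun y => b *m J y) x; c; d]).
  by rewrite hr addrK.
have -> : 'D_v (fun y => im (U y) (tv [:: b *m J x; c; d])) x =
    'D_v (fun y => re (U y) (tv [:: b; c; d])) x - im (U x) (tv [:: 'D_v (fun y => b *m J y) x; c; d]).
  by rewrite hi addrK.
rewrite /re /im; case: (U x _) => p q; by simpc.
Unshelve. all: by end_near. Qed.

(** On constant fields the vanishing of the Nijenhuis tensor is an identity between first
    derivatives of [J]. *)
Lemma nijenhuis_cst x (a b : V) : D x ->
  'D_(a *m J x) (fun y => b *m J y) x - 'D_(b *m J x) (fun y => a *m J y) x =
  ('D_a (fun y => b *m J y) x - 'D_b (fun y => a *m J y) x) *m J x.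
Proof.
move=> Dx; have := nij a b Dx; rewrite /nijenhuis /bracket.
have D0 u v : 'D_u (fun=> v : V) x = 0 :> V by exact: derive_cst.
rewrite (D0 a b) (D0 b a) (D0 (a *m J x) b) (D0 (b *m J x) a) subr0 sub0r subr0.
rewrite add0r => /eqP; rewrite subr_eq0 => /eqP h.
by apply: (etrans (esym h)); rewrite -mulmxDl addrC.
Qed.

Definition extdU x a b c d : R[i] := extdC U x (tv [:: a; b; c; d]).

Lemma extdUE x a b c d : extdU x a b c d =
  dU x a [:: b; c; d] - dU x b [:: a; c; d] + dU x c [:: a; b; d] - dU x d [:: a; b; c].
Proof. by rewrite /extdU /extdC !extd3E /dU; simpc. Qed.

Lemma dU_swap01 x v a b c : D x -> dU x v [:: a; b; c] = - dU x v [:: b; a; c].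
Proof.
move=> Dx; have hr := alternating_swap01 a b (derive_alternating oD v sUr Dx) (erefl (size [:: c])).
have hi := alternating_swap01 a b (derive_alternating oD v sUi Dx) (erefl (size [:: c])).
by rewrite /dU hr hi; simpc.
Qed.

Lemma dU_swap12 x v a b c : D x -> dU x v [:: a; b; c] = - dU x v [:: a; c; b].
Proof.
move=> Dx; have hr := alternating_swap12 a b c (derive_alternating oD v sUr Dx) (erefl (size [::] : nat)).
have hi := alternating_swap12 a b c (derive_alternating oD v sUi Dx) (erefl (size [::] : nat)).
by rewrite /dU hr hi; simpc.
Qed.

Lemma extdU_swap01 x a b c d : D x -> extdU x a b c d = - extdU x b a c d.
Proof.
move=> Dx; rewrite !extdUE (dU_swap01 c a b d Dx) (dU_swap01 d a b c Dx).
by move: (dU _ _ _) (dU _ _ _) => z t; ring.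
Qed.

Lemma extdU_swap12 x a b c d : D x -> extdU x a b c d = - extdU x a c b d.
Proof.
move=> Dx; rewrite !extdUE (dU_swap12 d a b c Dx) (dU_swap01 a b c d Dx); ring.
Qed.

Lemma extdU_swap23 x a b c d : D x -> extdU x a b c d = - extdU x a b d c.
Proof.
move=> Dx; rewrite !extdUE (dU_swap12 a b c d Dx) (dU_swap12 b a c d Dx); ring.
Qed.

Let U_headD x u v c d : D x ->
  U x (tv [:: u + v; c; d]) = U x (tv [:: u; c; d]) + U x (tv [:: v; c; d]).
Proof.
move=> Dx; have := @mlC_slot _ _ [::] [:: c; d] 1 u v (mlU Dx) isT.
by rewrite scale1r rmorph1 mul1r.
Qed.

Let U_headN x u c d : D x -> U x (tv [:: - u; c; d]) = - U x (tv [:: u; c; d]).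
Proof. by move=> Dx; exact: (@mlC_slotN _ _ [::] _ _ (mlU Dx) isT). Qed.

(* [dU] has no component of type [(1, 3)] or [(2, 2)]. *)
Lemma extdU_01 x (a b c d : V) : D x -> extdU x a b c d + i * extdU x (a *m J x) b c d =
  extdU x (a *m J x) (b *m J x) c d - i * extdU x a (b *m J x) c d.
Proof.
move=> Dx; rewrite !extdUE.
pose A (v : V) : V := 'D_v (fun y => a *m J y) x.
pose B (v : V) : V := 'D_v (fun y => b *m J y) x.
have hb v : dU x v [:: b *m J x; c; d] = i * dU x v [:: b; c; d] - U x (tv [:: B v; c; d]).
  exact: dU_J.
have ha v e f : dU x v [:: a *m J x; e; f] = i * dU x v [:: a; e; f] - U x (tv [:: A v; e; f]).
  exact: dU_J.
have gb v e : dU x v [:: a; b *m J x; e] = i * dU x v [:: a; b; e] + U x (tv [:: B v; a; e]).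
  by rewrite dU_swap01// dU_J// (dU_swap01 v a b e Dx) mulrN opprB addrC.
have hs u e : U x (tv [:: u; b; e]) = - U x (tv [:: b; u; e]).
  have sr := alternating_swap01 u b (sUr Dx).1 (erefl (size [:: e])).
  have si := alternating_swap01 u b (sUi Dx).1 (erefl (size [:: e])).
  by move: sr si; rewrite /re /im; case: (U x _) => ? ?; case: (U x _) => ? ? /= -> ->; simpc.
have tb u e : U x (tv [:: u; b *m J x; e]) = - (i * U x (tv [:: b; u; e])).
  have sr := alternating_swap01 u (b *m J x) (sUr Dx).1 (erefl (size [:: e])).
  have si := alternating_swap01 u (b *m J x) (sUi Dx).1 (erefl (size [:: e])).
  by rewrite -type30//; move: sr si; rewrite /re /im; case: (U x _) => ? ?; case: (U x _) => ? ? /= -> ->; simpc.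
(* Integrability enters here: it matches the variation of [J] on [b] with that on [a], so that all
   these terms cancel below. *)
have hN : U x (tv [:: B (a *m J x); c; d]) =
    U x (tv [:: A (b *m J x); c; d]) +
    i * (U x (tv [:: B a; c; d]) - U x (tv [:: A b; c; d])).
  have -> : B (a *m J x) = A (b *m J x) + (B a - A b) *m J x.
    by rewrite -[RHS]addrC; apply/eqP; rewrite -subr_eq; apply/eqP; exact: nijenhuis_cst.
  by rewrite U_headD// type30// U_headD// U_headN.
clearbody A B.
rewrite (ha b c d) (ha c b d) (ha d b c) (hb (a *m J x)) (ha (b *m J x) c d).
rewrite (ha c (b *m J x) d) (ha d (b *m J x) c) (hb a) (gb c d) (gb d c).
rewrite (tb (A c) d) (tb (A d) c) (hs (A c) d) (hs (A d) c) hN.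
ring: i2.
Qed.

(** Twice [dU] with the first argument projected to [T^{0,1}]. The next lemmas show that the other
    three slots are then of type (1,0), so [Q] comes from the (3,1) part of [dU]. *)
Let Q x a b c d := extdU x a b c d + i * extdU x (a *m J x) b c d.

Let Q_J1 x a b c d : D x -> Q x a (b *m J x) c d = i * Q x a b c d.
Proof.
move=> Dx; rewrite [in RHS]/Q extdU_01// /Q.
move: (extdU _ _ _ _ _) (extdU _ _ _ _ _) => z t; ring: i2.
Qed.

Let Q_J2 x a b c d : D x -> Q x a b (c *m J x) d = i * Q x a b c d.
Proof.
have sw e f : D x -> Q x a e f d = - Q x a f e d.
  by move=> Dx; rewrite /Q !(extdU_swap12 _ e f)// mulrN opprD.
by move=> Dx; rewrite sw// Q_J1// (sw b c Dx) mulrN.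
Qed.

Let Q_J3 x a b c d : D x -> Q x a b c (d *m J x) = i * Q x a b c d.
Proof.
have sw e f : D x -> Q x a b e f = - Q x a b f e.
  by move=> Dx; rewrite /Q !(extdU_swap23 _ _ e f)// mulrN opprD.
by move=> Dx; rewrite sw// Q_J2// (sw c d Dx) mulrN.
Qed.

Let ml_extdU x : D x -> mlC (extdC U x).
Proof. by move=> Dx; split; exact: extd_multilinear Dx. Qed.

Let dbar0 x a b c d : D x -> 2 * extdU x a b c d
    - 2 * extdU x (a *m J x) (b *m J x) (c *m J x) (d *m J x)
    - i * (extdU x (a *m J x) b c d + extdU x a (b *m J x) c d
           + extdU x a b (c *m J x) d + extdU x a b c (d *m J x)
           + extdU x a (b *m J x) (c *m J x) (d *m J x)
           + extdU x (a *m J x) b (c *m J x) (d *m J x)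
           + extdU x (a *m J x) (b *m J x) c (d *m J x)
           + extdU x (a *m J x) (b *m J x) (c *m J x) d) = 0.
Proof.
move=> Dx; have := dbarU (tv [:: a; b; c; d]) Dx.
rewrite /dbar (component31 _ _ _ _ _ (ml_extdU Dx)) -/(extdU _ _ _ _ _).
by move/eqP; rewrite mulf_eq0 invr_eq0 pnatr_eq0 => /eqP.
Qed.

(** [Q] is extracted from the (3,1) part of [dU], which is [dbar U = 0]. Hence [dU] has no (0,1)
    part in its first slot. *)
Lemma extdU_J x a b c d : D x -> extdU x (a *m J x) b c d = i * extdU x a b c d.
Proof.
move=> Dx; have N e f g : extdU x (- a) e f g = - extdU x a e f g.
  exact: (@mlC_slotN _ _ [::] [:: e; f; g] a (ml_extdU Dx) isT).
suff Q0 : Q x a b c d = 0.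
  move/eqP: Q0; rewrite /Q addr_eq0 => /eqP ->.
  by move: (extdU _ _ _ _ _) => z; ring: i2.
have k1 b' c' d' : extdU x a b' c' d' = Q x a b' c' d' - i * extdU x (a *m J x) b' c' d'.
  by rewrite /Q addrK.
have G0 := dbar0 a b c d Dx; have := dbar0 (a *m J x) b c d Dx.
rewrite (mulmx_JJ _ Dx) !N !k1 ?Q_J1// ?Q_J2// ?Q_J3// => G1; move: G0.
rewrite !k1 ?Q_J1// ?Q_J2// ?Q_J3// => G0.
(* The equation at [a] plus [i] times the one at [a *m J x] has left side [8 Q]. *)
apply: (@mulfI _ 8); first by rewrite pnatr_eq0.
have E := congr2 (fun u v => u + i * v) G0 G1.
transitivity (0 + i * 0 : R[i]); last by rewrite !mulr0 addr0.
rewrite -E; move: (Q _ _ _ _ _) => q.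
do 7![move: (extdU _ _ _ _ _) => ?].
ring: i2.
Qed.

Variable x : V.
Hypothesis Dx : D x.
Variable e : nat -> V.
Hypothesis eJ : forall r, (r < 3)%N -> e r.*2.+1 = e r.*2 *m J x.
Hypothesis ebas : forall v : V, exists c : 'I_6 -> R, v = \sum_i c i *: e i.

(** [e 0], [e 2] and [e 4] span the tangent space over the complex numbers. *)
Lemma frame_Clinear_eq0 (f : V -> R[i]) :
  (forall c u v, f (c *: u + v) = c%:C * f u + f v) ->
  (forall v, f (v *m J x) = i * f v) ->
  (forall r, (r < 3)%N -> f (e r.*2) = 0) -> forall v, f v = 0.
Proof.
move=> fl fJ f0 v; have [c ->] := ebas v.
have fz : f 0 = 0.
  by have := fl (-1) 0 0; rewrite scaler0 addr0 rmorphN rmorph1 mulN1r addNr.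
elim/big_ind: _ => // [u w fu fw|[m m6] _].
  by have := fl 1 u w; rewrite scale1r fu fw mulr0 addr0.
have -> : f (c (Ordinal m6) *: e m) = (c (Ordinal m6))%:C * f (e m).
  by have := fl (c (Ordinal m6)) (e m) 0; rewrite addr0 fz addr0.
have h r : (r < 3)%N -> f (e r.*2) = 0 /\ f (e r.*2.+1) = 0.
  by move=> r3; rewrite eJ// fJ f0// mulr0.
have [h0 h1] := h 0%N isT; have [h2 h3] := h 1%N isT; have [h4 h5] := h 2%N isT.
by move: m6 => /=; case: m => [|[|[|[|[|[|]]]]]] m6 //; rewrite ?(h0, h1, h2, h3, h4, h5) mulr0.
Qed.

Let extdU_slot0 c u v p q s :
  extdU x (c *: u + v) p q s = c%:C * extdU x u p q s + extdU x v p q s.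
Proof. exact: (@mlC_slot _ _ [::] [:: p; q; s] c u v (ml_extdU Dx) isT). Qed.
Let extdU_slot1 c u v p q s :
  extdU x p (c *: u + v) q s = c%:C * extdU x p u q s + extdU x p v q s.
Proof. exact: (@mlC_slot _ _ [:: p] [:: q; s] c u v (ml_extdU Dx) isT). Qed.
Let extdU_slot2 c u v p q s :
  extdU x p q (c *: u + v) s = c%:C * extdU x p q u s + extdU x p q v s.
Proof. exact: (@mlC_slot _ _ [:: p; q] [:: s] c u v (ml_extdU Dx) isT). Qed.
Let extdU_slot3 c u v p q s :
  extdU x p q s (c *: u + v) = c%:C * extdU x p q s u + extdU x p q s v.
Proof. exact: (@mlC_slot _ _ [:: p; q; s] [::] c u v (ml_extdU Dx) isT). Qed.

Let extdU_J1 a b c d : extdU x a (b *m J x) c d = i * extdU x a b c d.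
Proof. by rewrite extdU_swap01// extdU_J// (extdU_swap01 b a)// mulrN opprK. Qed.
Let extdU_J2 a b c d : extdU x a b (c *m J x) d = i * extdU x a b c d.
Proof. by rewrite extdU_swap12// extdU_J1 (extdU_swap12 a c)// mulrN opprK. Qed.
Let extdU_J3 a b c d : extdU x a b c (d *m J x) = i * extdU x a b c d.
Proof. by rewrite extdU_swap23// extdU_J2 (extdU_swap23 a b d)// mulrN opprK. Qed.

Let extdU_eq01 a c d : extdU x a a c d = 0.
Proof.
have /eqP := extdU_swap01 a a c d Dx; rewrite -addr_eq0 -mulr2n -mulr_natl.
by rewrite mulf_eq0 pnatr_eq0 => /eqP.
Qed.
Let extdU_eq12 a b d : extdU x a b b d = 0.
Proof.
have /eqP := extdU_swap12 a b b d Dx; rewrite -addr_eq0 -mulr2n -mulr_natl.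
by rewrite mulf_eq0 pnatr_eq0 => /eqP.
Qed.
Let extdU_eq23 a b c : extdU x a b c c = 0.
Proof.
have /eqP := extdU_swap23 a b c c Dx; rewrite -addr_eq0 -mulr2n -mulr_natl.
by rewrite mulf_eq0 pnatr_eq0 => /eqP.
Qed.

(** Pigeonhole: of four indices below 3 two coincide. There is no (4,0)-form in complex dimension
    3. *)
Let extdU_frame : forall p q r s, (p < 3)%N -> (q < 3)%N -> (r < 3)%N -> (s < 3)%N ->
  extdU x (e p.*2) (e q.*2) (e r.*2) (e s.*2) = 0.
Proof.
have e02 a b d : extdU x a b a d = 0 by rewrite extdU_swap12// extdU_eq01 oppr0.
have e13 a b d : extdU x a b d b = 0 by rewrite extdU_swap23// extdU_eq12 oppr0.
have e03 a b d : extdU x a b d a = 0 by rewrite extdU_swap23// e02 oppr0.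
move=> p q r s.
by case: p => [|[|[|//]]]; case: q => [|[|[|//]]]; case: r => [|[|[|//]]]; case: s => [|[|[|//]]];
  rewrite ?(extdU_eq01, extdU_eq12, extdU_eq23, e02, e13, e03).
Qed.

(** [dU] is complex linear in each argument, so its vanishing spreads from the complex basis to all
    vectors one slot at a time. *)
Lemma extdU_eq0 v0 v1 v2 v3 : extdU x v0 v1 v2 v3 = 0.
Proof.
have H3 p q r u (p3 : (p < 3)%N) (q3 : (q < 3)%N) (r3 : (r < 3)%N) :
    extdU x (e p.*2) (e q.*2) (e r.*2) u = 0 :=
  @frame_Clinear_eq0 (fun u => extdU x (e p.*2) (e q.*2) (e r.*2) u)
  (fun c u w => extdU_slot3 c u w _ _ _) (fun u => extdU_J3 _ _ _ u)
  (fun s s3 => extdU_frame p3 q3 r3 s3) u.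
have H2 p q u (p3 : (p < 3)%N) (q3 : (q < 3)%N) : extdU x (e p.*2) (e q.*2) u v3 = 0 :=
  @frame_Clinear_eq0 (fun u => extdU x (e p.*2) (e q.*2) u v3)
  (fun c u w => extdU_slot2 c u w _ _ v3) (fun u => extdU_J2 _ _ u v3)
  (fun r r3 => H3 p q r v3 p3 q3 r3) u.
have H1 p u (p3 : (p < 3)%N) : extdU x (e p.*2) u v2 v3 = 0 :=
  @frame_Clinear_eq0 (fun u => extdU x (e p.*2) u v2 v3)
  (fun c u w => extdU_slot1 c u w _ v2 v3) (fun u => extdU_J1 _ u v2 v3)
  (fun q q3 => H2 p q v2 p3 q3) u.
exact: (@frame_Clinear_eq0 (fun u => extdU x u v1 v2 v3)
  (fun c u w => extdU_slot0 c u w v1 v2 v3) (fun u => extdU_J u v1 v2 v3 Dx)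
  (fun p p3 => H1 p v1 p3) v0).
Qed.

Lemma extdC_eq0 v : extdC U x v = 0.
Proof.
rewrite [v]tv_codom 4!enum_ordSl (size0nil (size_enum_ord 0)).
exact: extdU_eq0.
Qed.

Lemma extd_reU v : extd (fun y => re (U y)) x v = 0.
Proof. by have := extdC_eq0 v => -[]. Qed.

Lemma extd_imU v : extd (fun y => im (U y)) x v = 0.
Proof. by have := extdC_eq0 v => -[]. Qed.

End Closed.

(** * Adapted unitary frames *)

Lemma in_cons_all (T : eqType) (P : T -> Prop) (a : T) (s : seq T) :
  P a -> {in s, forall x, P x} -> {in a :: s, forall x, P x}.
Proof. by move=> Pa Ps x; rewrite inE => /orP[/eqP->//|/Ps]. Qed.

Section TabSkew.
Variables (K : comPzRingType) (k : nat) (A : seq nat -> K) (c : K).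
Variable T : seq (seq nat * Z).

Lemma assoc_not_uniq m : all (fun p => uniq p.1) T -> ~~ uniq m -> assoc T m = Z0.
Proof.
elim: T => //= -[l z] r IH /andP[ul /IH{}IH] um.
by case: eqP => [lm|_]; [rewrite -lm ul in um|exact: IH].
Qed.

Lemma skew_tab n : skewl k A ->
  (forall l, size l = k -> ~~ uniq l -> A l = 0) ->
  all (fun p => uniq p.1) T ->
  {in [seq l <- words k n | sorted ltn l], forall m, A m = c * zr (assoc T m)} ->
  {in words k n, forall l, A l = c * zr (tab T l)}.
Proof.
move=> sA A0 uT AT l /wordsP[szl ltl]; rewrite (skew_nsort sA szl) /tab.
have := nsort_perm l; have := nsort_sorted l.
case: (nsort l) => s m; rewrite -[(s, m).1]/s -[(s, m).2]/m => sm pm.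
rewrite zrM mulrCA; congr (_ * _); have szm : size m = k by rewrite (perm_size pm).
have [um|um] := boolP (uniq m); last by rewrite A0// assoc_not_uniq// mulr0.
apply: AT; rewrite mem_filter ltn_sorted_uniq_leq um sm; apply/wordsP.
by split=> // i; rewrite (perm_mem pm) => /ltl.
Qed.
End TabSkew.

Section UnitaryFrame.
Variable R : realType.
Local Notation V := 'rV[R]_6.
Variables (J : 'M[R]_6) (w : kform R R 6 2).
Hypothesis J2 : J *m J = - 1%:M.
Hypothesis aw : alternating w.
Hypothesis w11 : forall u v, w (tv [:: u *m J; v *m J]) = w (tv [:: u; v]).
Hypothesis wpos : forall u, u != 0 -> 0 < w (tv [:: u; u *m J]).

(** [kahler_metric] with its arguments as a list; see [kahler_metricE]. *)
Definition kmetric u v := w (tv [:: u; v *m J]).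

Let JJ u : (u *m J) *m J = - u :> V.
Proof. by rewrite -mulmxA J2 mulmxN mulmx1. Qed.

Let wN u v : w (tv [:: - u; v]) = - w (tv [:: u; v]).
Proof. by rewrite -scaleN1r multilinear_headZ ?mulN1r//; case: aw. Qed.

Lemma kmetric_sym u v : kmetric u v = kmetric v u.
Proof. by rewrite /kmetric -w11 JJ (alternating_swap01 _ _ aw)// wN opprK. Qed.

Lemma kmetric_J u v : kmetric (u *m J) (v *m J) = kmetric u v.
Proof. by rewrite /kmetric w11. Qed.

Lemma kmetric_ip : inner_product kmetric.
Proof.
split=> [c u v z|u v|u u0]; last exact: wpos.
  by rewrite /kmetric multilinear_head//; case: aw.
exact: kmetric_sym.
Qed.

Let wE' u v : w (tv [:: u; v]) = - kmetric u (v *m J).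
Proof.
rewrite /kmetric JJ (alternating_swap01 u (- v) aw)// wN opprK.
by rewrite -(alternating_swap01 u v aw).
Qed.

(** Fewer than six linear equations on [R^6] have a nonzero common solution, which positivity allows
    to normalize. *)
Lemma unit_orthogonal (s : seq V) : (size s < 6)%N ->
  exists2 u, kmetric u u = 1 & {in s, forall v, kmetric u v = 0}.
Proof.
move=> s6; have [gl gs gp] := kmetric_ip.
pose A : 'M[R]_(6, size s) := gram kmetric *m \matrix_(i, j) (s`_j) 0 i.
have kA : kermx A != 0.
  by rewrite -mxrank_eq0 mxrank_ker subn_eq0 -ltnNge (leq_ltn_trans (rank_leq_col A)).
have /rowV0Pn[v /sub_kermxP vA v0] := kA.
have gvv : 0 < kmetric v v by exact: gp.
have kZ c u z : kmetric (c *: u) z = c * kmetric u z.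
  by rewrite /kmetric multilinear_headZ//; case: aw.
pose c := (Num.sqrt (kmetric v v))^-1.
exists (c *: v).
  rewrite kZ kmetric_sym kZ mulrA -expr2 exprVn sqr_sqrtr ?ltW// mulVf// gt_eqF//.
move=> u us; rewrite kZ (gram_bilin kmetric_ip).
have := congr1 (fun M : 'rV_(size s) => M 0 (Ordinal (etrans (index_mem u s) us))) vA.
rewrite mulmxA !mxE => h; rewrite -[RHS](mulr0 c); congr (_ * _); rewrite -[RHS]h.
by apply: eq_bigr => i _; rewrite !mxE /= nth_index.
Qed.

Section Frame.
Variables (e0 e2 e4 : V).

(** Beyond index 5 the default value is 0, as [E7] requires of the base part of its last vector. *)
Definition uframe (i : nat) : V := [:: e0; e0 *m J; e2; e2 *m J; e4; e4 *m J]`_i.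

Hypothesis h00 : kmetric e0 e0 = 1.
Hypothesis h22 : kmetric e2 e2 = 1.
Hypothesis h44 : kmetric e4 e4 = 1.
Hypothesis h20 : kmetric e2 e0 = 0.
Hypothesis h21 : kmetric e2 (e0 *m J) = 0.
Hypothesis h40 : kmetric e4 e0 = 0.
Hypothesis h41 : kmetric e4 (e0 *m J) = 0.
Hypothesis h42 : kmetric e4 e2 = 0.
Hypothesis h43 : kmetric e4 (e2 *m J) = 0.

Lemma uframe_omega : {in words 2 7, forall l, w (tv (map uframe l)) = zr (omega0 l)}.
Proof.
move=> l lw; rewrite -[RHS]mul1r; move: l lw; apply: skew_tab.
- exact: skew_map (alternating_skewf aw).
- by move=> l; exact: alternating_not_uniq.
- by [].
vm_rewrite [seq l <- words 2 7 | sorted ltn l].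
have z u : w (tv [:: u; 0]) = 0.
  by rewrite (alternating_swap01 u 0 aw)// multilinear_head0 ?oppr0//; case: aw.
have JE u v : w (tv [:: u *m J; v]) = - kmetric u v.
  by rewrite (alternating_swap01 _ _ aw)// -/(kmetric v u) kmetric_sym.
have g := (h00, h22, h44, h20, h40, h42, etrans (kmetric_sym e0 e2) h20,
  etrans (kmetric_sym e0 e4) h40, etrans (kmetric_sym e2 e4) h42).
have wS u v : w (tv [:: u; v]) = kmetric v (u *m J).
  by rewrite (alternating_swap01 u v aw)// wE' opprK.
have w0 : (w (tv [:: e0; e2]) = 0) * (w (tv [:: e0; e4]) = 0) * (w (tv [:: e2; e4]) = 0).
  by rewrite !wS.
(* One case for each of the 21 increasing pairs of indices below 7; index 6 stands for the zero
   vector. *)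
by do 21!(apply: in_cons_all;
  first by rewrite mul1r /= ?(zr0, zr1) ?z ?w11 -?/(kmetric _ _) ?JE ?w0 ?g ?oppr0).
Qed.

End Frame.

Section Volume30.
Variable U : kform R R[i] 6 3.
Hypotheses (aUr : alternating (re U)) (aUi : alternating (im U)).
Hypothesis UJ : forall u v z, U (tv [:: u *m J; v; z]) = 'i%C * U (tv [:: u; v; z]).
Variables (e0 e2 e4 : V) (n : R).
Hypothesis Un : U (tv [:: e0; e2; e4]) = n%:C.

Let U01 u v z : U (tv [:: u; v; z]) = - U (tv [:: v; u; z]).
Proof.
have sr := alternating_swap01 u v aUr (erefl (size [:: z])).
have si := alternating_swap01 u v aUi (erefl (size [:: z])).
by move: sr si; rewrite /re /im; case: (U _) => ? ?; case: (U _) => ? ? /= -> ->; simpc.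
Qed.

Let U12 u v z : U (tv [:: u; v; z]) = - U (tv [:: u; z; v]).
Proof.
have sr := alternating_swap12 u v z aUr (erefl (size [::] : nat)).
have si := alternating_swap12 u v z aUi (erefl (size [::] : nat)).
by move: sr si; rewrite /re /im; case: (U _) => ? ?; case: (U _) => ? ? /= -> ->; simpc.
Qed.

Let UJ1 u v z : U (tv [:: u; v *m J; z]) = 'i%C * U (tv [:: u; v; z]).
Proof. by rewrite U01 UJ (U01 v u) mulrN opprK. Qed.

Let UJ2 u v z : U (tv [:: u; v; z *m J]) = 'i%C * U (tv [:: u; v; z]).
Proof. by rewrite U12 UJ1 (U12 u z) mulrN opprK. Qed.

Let U00 u z : U (tv [:: u; u; z]) = 0.
Proof.
have /eqP := U01 u u z; rewrite -addr_eq0 -mulr2n -mulr_natl.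
by rewrite mulf_eq0 pnatr_eq0 => /eqP.
Qed.

Let U11 u z : U (tv [:: u; z; z]) = 0.
Proof.
have /eqP := U12 u z z; rewrite -addr_eq0 -mulr2n -mulr_natl.
by rewrite mulf_eq0 pnatr_eq0 => /eqP.
Qed.

Let U0 u v : U (tv [:: u; v; 0]) = 0.
Proof.
rewrite U12 U01 opprK; apply/eqP; rewrite eq_complex; apply/andP; split; apply/eqP.
  by rewrite -[LHS]/(re U _) multilinear_head0//; case: aUr.
by rewrite -[LHS]/(im U _) multilinear_head0//; case: aUi.
Qed.

Let i2 (z : R[i]) : 'i%C * ('i%C * z) = - z.
Proof. by rewrite mulrA -expr2 sqr_i mulN1r. Qed.

(** A (3,0)-form is determined by its value on [e0], [e2], [e4]: every [J] in an argument comes out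
    as a factor [i]. *)
Let uframe_sorted : {in [seq l <- words 3 7 | sorted ltn l], forall m,
  U (tv (map (uframe e0 e2 e4) m)) = (n * zr (assoc re_table m)) +i* (n * zr (assoc im_table m))}.
Proof.
vm_rewrite [seq l <- words 3 7 | sorted ltn l].
(* The 35 increasing triples of indices below 7. *)
by do 35!(apply: in_cons_all; first by rewrite /= ?U0 ?UJ ?UJ1 ?UJ2 ?U00 ?U11 ?Un
  ?(zr0, zr1, zrm1) ?i2; simpc; rewrite ?(mulr1, mulr0, mulrN1, oppr0)).
Qed.

Lemma uframe_re : {in words 3 7, forall l, re U (tv (map (uframe e0 e2 e4) l)) = n * zr (re0 l)}.
Proof.
apply: skew_tab; [exact: skew_map (alternating_skewf aUr)| |by []|].
  by move=> l; exact: alternating_not_uniq.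
by move=> m /uframe_sorted; rewrite /re => ->.
Qed.

Lemma uframe_im : {in words 3 7, forall l, im U (tv (map (uframe e0 e2 e4) l)) = n * zr (im0 l)}.
Proof.
apply: skew_tab; [exact: skew_map (alternating_skewf aUi)| |by []|].
  by move=> l; exact: alternating_not_uniq.
by move=> m /uframe_sorted; rewrite /im => ->.
Qed.

End Volume30.
End UnitaryFrame.

Lemma re0_re0 : wedge_tab 6 3 re0 re0 = Z0. Proof. by vm_compute. Qed.
Lemma im0_im0 : wedge_tab 6 3 im0 im0 = Z0. Proof. by vm_compute. Qed.

Lemma zrC (R : realType) z : (zr z)%:C = zr z :> R[i].
Proof. by rewrite /zr rmorph_int. Qed.

Lemma wedge_cx (R : realType) n k l (a : kform R R n k) (b : kform R R n l) :
  wedge (cx a) (cx b) = cx (wedge a b).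
Proof.
apply/funext => v; rewrite /wedge /cx rmorphM fmorphV rmorphM !rmorph_nat rmorph_sum.
congr (_ * _); apply: eq_bigr => s _.
by rewrite !rmorphM rmorphXn rmorphN1.
Qed.

Lemma nthl_iota n p : perm_eq p (iota 0 n) -> forall q, {subset q <= p} ->
  [seq nth 0%N (iota 0 n) x | x <- q] = q.
Proof.
move=> pn q qp; apply: map_id_in => x /qp; rewrite (perm_mem pn) mem_iota => /= xn.
by rewrite nth_iota.
Qed.

(** * The length of the holomorphic volume form in a unitary frame *)

Section Normalization.
Variable R : realType.
Local Notation V := 'rV[R]_6.
Variables (w : kform R R 6 2) (U : kform R R[i] 6 3) (e : nat -> V) (n nu : R).
Hypothesis aw : alternating w.
Hypothesis we : {in words 2 7, forall l, w (tv (map e l)) = zr (omega0 l)}.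
Hypothesis Ure : {in words 3 7, forall l, re U (tv (map e l)) = n * zr (re0 l)}.
Hypothesis Uie : {in words 3 7, forall l, im U (tv (map e l)) = n * zr (im0 l)}.
Hypotheses (n0 : 0 <= n) (nu0 : 0 < nu).
Hypothesis normU : forall v : 'I_6 -> V, (3`!%:R)^-1 * wedge (cx w) (wedge (cx w) (cx w)) v =
  'i%C / 8 * ((nu ^+ 2)^-1)%:C * wedge U (conjf U) v.

Let words_sub l k p : perm_eq p (iota 0 6) -> {subset l <= p} -> size l = k -> l \in words k 7.
Proof.
move=> p6 lp sl; apply/wordsP; split=> // j /lp; rewrite (perm_mem p6) mem_iota.
by move=> /= j6; apply: ltn_trans j6 _.
Qed.

Let omega_sqE l : l \in words 4 7 -> wedge w w (tv (map e l)) = zr (omega_sq0 l).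
Proof.
move=> /wordsP[]; case: l => [|i [|j [|k [|m []]]]]//= _ h.
have [i7 j7 k7 m7] : [/\ i < 7, j < 7, k < 7 & m < 7]%N.
  by split; apply: h; rewrite !inE eqxx ?orbT.
have wE a b : (a < 7)%N -> (b < 7)%N -> w (tv [:: e a; e b]) = zr (omega0 [:: a; b]).
  move=> a7 b7; apply: (we (x := [:: a; b])); apply/wordsP; split=> // c.
  by rewrite !inE => /orP[]/eqP->.
rewrite wedge22// !wE// /omega_sq0 !(zrM, zrD, zrN); ring.
Qed.

Lemma omega_cubeE : wedge w (wedge w w) (tv (map e (iota 0 6))) = 6.
Proof.
rewrite (@wedge_frame _ _ _ 2 4)//.
transitivity (48^-1 * zr (wedge_tab 6 2 omega0 omega_sq0) : R); last first.
  by rewrite omega0_cube (_ : zr (Z.of_nat 288) = 288)//; field.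
congr (_ * _); first by rewrite !factS fact0 -natrM.
rewrite /wedge_tab zr_zsum; apply: eq_big_seq => p; rewrite mem_permutations => p6.
have szp : size p = 6%N by rewrite (perm_size p6).
have tp : {subset take 2 p <= p} by move=> x /mem_take.
have dp : {subset drop 2 p <= p} by move=> x /mem_drop.
rewrite !(nthl_iota p6)// we; last by apply: words_sub p6 tp _; rewrite size_take szp.
rewrite omega_sqE; last by apply: words_sub p6 dp _; rewrite size_drop szp.
by rewrite lazy_mulE !zrM mulrCA mulrA.
Qed.

Lemma volume30E : wedge U (conjf U) (tv (map e (iota 0 6))) = - 8 * 'i%C * (n ^+ 2)%:C.
Proof.
rewrite (@wedge_frame _ _ _ 3 3)//.
(* An opaque name for the table sum, so that no tactic unfolds its 720 permutations. *)
have [S SE] : exists S : (seq nat -> Z) -> (seq nat -> Z) -> R[i],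
    forall A B, S A B = zr (wedge_tab 6 3 A B) by exists (fun A B => zr (wedge_tab 6 3 A B)).
transitivity (36^-1 * ((n ^+ 2)%:C * (S re0 re0 + S im0 im0 + 'i%C * (S im0 re0 - S re0 im0)))).
  congr (_ * _); first by rewrite !factS fact0 -natrM.
  have SE' A B : S A B = \sum_(p <- permutations (iota 0 6))
      zr (A (take 3 p)) * (zr (nsort p).1 * zr (B (drop 3 p))).
    by rewrite SE /wedge_tab zr_zsum; apply: eq_bigr => p _; rewrite lazy_mulE !zrM.
  rewrite !SE' -sumrB mulr_sumr -!big_split mulr_sumr.
  apply: eq_big_seq => p; rewrite mem_permutations => p6.
  have szp : size p = 6%N by rewrite (perm_size p6).
  have tp : {subset take 3 p <= p} by move=> x /mem_take.
  have dp : {subset drop 3 p <= p} by move=> x /mem_drop.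
  rewrite !(nthl_iota p6)//.
  have tw : take 3 p \in words 3 7 by apply: words_sub p6 tp _; rewrite size_take szp.
  have dw : drop 3 p \in words 3 7 by apply: words_sub p6 dp _; rewrite size_drop szp.
  have UE l : l \in words 3 7 -> U (tv (map e l)) = (n * zr (re0 l)) +i* (n * zr (im0 l)).
    by move=> lw; rewrite -Ure// -Uie// /re /im; case: (U _).
  rewrite /conjf !UE// /= -!zrC.
  by apply/eqP; rewrite eq_complex /=; apply/andP; split; apply/eqP; ring.
rewrite !SE re0_re0 im0_im0 re0_im0 im0_re0 zr0 zrN (_ : zr (Z.of_nat 144) = 144)//.
by field.
Qed.

(** On the frame the normalization reads [1 = n^2 / nu^2], and neither number is negative. *)
Lemma norm_eq : n = nu.
Proof.
have := normU (tv (map e (iota 0 6))); rewrite wedge_cx wedge_cx volume30E /cx omega_cubeE.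
have i2 : 'i%C * 'i%C = -1 :> R[i] by rewrite -expr2 sqr_i.
have -> : 'i%C / 8 * ((nu ^+ 2)^-1)%:C * (- 8 * 'i%C * (n ^+ 2)%:C) =
    ((nu ^+ 2)^-1 * n ^+ 2)%:C.
  rewrite [RHS]rmorphM /=; move: ((nu ^+ 2)^-1)%:C (n ^+ 2)%:C => a b.
  have -> : 'i%C / 8 * a * (- 8 * 'i%C * b) = - ('i%C * 'i%C) * (a * b) :> R[i] by field.
  by rewrite i2 opprK mul1r.
have -> : (3`!%:R)^-1 * (6%:C) = 1 :> R[i].
  by rewrite rmorph_nat !factS fact0 mulVf// pnatr_eq0.
move=> /(congr1 (@complex.Re R)) /= h.
have : n ^+ 2 = nu ^+ 2.
  by apply: (@mulfI _ (nu ^+ 2)^-1); rewrite ?invr_eq0 ?expf_neq0 ?gt_eqF// -h mulVf// expf_neq0// gt_eqF.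
by move/eqP; rewrite eqrXn2// ?ltW// => /eqP.
Qed.

End Normalization.

Section AdaptedFrame.
Variable R : realType.
Local Notation V := 'rV[R]_6.
Variables (J : 'M[R]_6) (w : kform R R 6 2) (U : kform R R[i] 6 3) (nu : R).
Hypothesis J2 : J *m J = - 1%:M.
Hypothesis aw : alternating w.
Hypothesis w11 : forall u v, w (tv [:: u *m J; v *m J]) = w (tv [:: u; v]).
Hypothesis wpos : forall u, u != 0 -> 0 < w (tv [:: u; u *m J]).
Hypotheses (aUr : alternating (re U)) (aUi : alternating (im U)).
Hypothesis UJ : forall u v z, U (tv [:: u *m J; v; z]) = 'i%C * U (tv [:: u; v; z]).
Hypothesis nu0 : 0 < nu.
Hypothesis normU : forall v : 'I_6 -> V, (3`!%:R)^-1 * wedge (cx w) (wedge (cx w) (cx w)) v =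
  'i%C / 8 * ((nu ^+ 2)^-1)%:C * wedge U (conjf U) v.

Local Notation "<| u , v |>" := (kmetric J w u v).

Let gl c u v z : <| c *: u + v, z |> = c * <| u, z |> + <| v, z |>.
Proof. by have [/(_ c u v z)] := kmetric_ip J2 aw w11 wpos. Qed.
Let gZ c u z : <| c *: u, z |> = c * <| u, z |>.
Proof. by rewrite /kmetric multilinear_headZ//; case: aw. Qed.
Let gC u v : <| u, v |> = <| v, u |>.
Proof. exact: kmetric_sym. Qed.
Let gJ u v : <| u *m J, v *m J |> = <| u, v |>.
Proof. exact: kmetric_J. Qed.
Let JJ u : (u *m J) *m J = - u :> V.
Proof. by rewrite -mulmxA J2 mulmxN mulmx1. Qed.
Let gN u z : <| - u, z |> = - <| u, z |>.
Proof. by rewrite -scaleN1r gZ mulN1r. Qed.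
Let guJ u : <| u, u *m J |> = 0.
Proof.
have : <| u, u *m J |> = - <| u, u *m J |> by rewrite -[LHS]gJ JJ gC gN.
by move=> h; lra.
Qed.
Let gJl u v : <| u *m J, v |> = - <| u, v *m J |>.
Proof. by rewrite -gJ JJ gN. Qed.

(** The factor is the conjugate of [z] divided by [|z|]; at [z = 0] any unit will do. *)
Lemma phase (z : R[i]) : exists a b n : R, [/\ a ^+ 2 + b ^+ 2 = 1, 0 <= n & (a +i* b) * z = n%:C].
Proof.
have [z0|z0] := eqVneq z 0.
  by exists 1, 0, 0; rewrite z0 mulr0 lexx expr1n expr0n addr0.
case: z z0 => p q z0; pose n := Num.sqrt (p ^+ 2 + q ^+ 2).
have pq : 0 < p ^+ 2 + q ^+ 2.
  rewrite lt0r paddr_eq0 ?sqr_ge0// !sqrf_eq0 addr_ge0 ?sqr_ge0// andbT.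
  by apply: contraNN z0 => /andP[/eqP-> /eqP->].
have n0 : 0 < n by rewrite sqrtr_gt0.
have n2 : n ^+ 2 = p ^+ 2 + q ^+ 2 by rewrite sqr_sqrtr// ltW.
exists (p / n), (- q / n), n; split; rewrite ?ltW//.
  by rewrite !exprMn sqrrN -mulrDl -n2 exprVn mulfV// expf_neq0// gt_eqF.
apply/eqP; rewrite eq_complex /=; apply/andP; split; apply/eqP.
  by apply: (mulIf (lt0r_neq0 n0)); rewrite -[RHS]expr2 n2; field; rewrite gt_eqF.
by field; rewrite gt_eqF.
Qed.

Let U_slot2 c u v x y : U (tv [:: x; y; c *: u + v]) = c%:C * U (tv [:: x; y; u]) + U (tv [:: x; y; v]).
Proof.
have h (a : kform R R 6 3) (aa : alternating a) : a (tv [:: x; y; c *: u + v]) =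
    c * a (tv [:: x; y; u]) + a (tv [:: x; y; v]).
  have := multilinear_slot (l1 := [:: x; y]) [::] c u v aa.1; exact.
have := h _ aUr; have := h _ aUi; rewrite /re /im.
case: (U _) (U _) (U _) => [a b] [a' b'] [a'' b''] /= -> ->.
by apply/eqP; rewrite eq_complex /=; apply/andP; split; apply/eqP; ring.
Qed.

Let U_swap (x y z : V) : U (tv [:: x; y; z]) = U (tv [:: z; x; y]).
Proof.
have h (a : kform R R 6 3) (aa : alternating a) : a (tv [:: x; y; z]) = a (tv [:: z; x; y]).
  rewrite (alternating_swap12 x y z aa (erefl (size (Nil V)))).
  by rewrite (alternating_swap01 x z aa (erefl (size [:: y]))) opprK.
have := h _ aUr; have := h _ aUi; rewrite /re /im.
by case: (U _) (U _) => [a b] [a' b'] /= -> ->.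
Qed.

Lemma uframe_exists X : exists e0 e2 e4 lam n, [/\ X = lam *: e0, 0 <= n & U (tv [:: e0; e2; e4]) = n%:C] /\
  [/\ <| e0, e0 |> = 1, <| e2, e2 |> = 1 & <| e4, e4 |> = 1] /\
  <| e2, e0 |> = 0 /\ <| e2, e0 *m J |> = 0 /\
  [/\ <| e4, e0 |> = 0, <| e4, e0 *m J |> = 0, <| e4, e2 |> = 0 & <| e4, e2 *m J |> = 0].
Proof.
have [e0 [lam [Xe h0]]] : exists e0 lam, X = lam *: e0 /\ <| e0, e0 |> = 1.
  (* If [X] vanishes, any unit vector serves, with [lam = 0]. *)
  have [X0|X0] := eqVneq X 0.
    have [u u1 _] := @unit_orthogonal _ _ _ J2 aw w11 wpos [::] isT.
    by exists u, 0; rewrite scale0r.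
  have gp : 0 < <| X, X |> by exact: wpos.
  have s0 : Num.sqrt <| X, X |> != 0 by rewrite gt_eqF// sqrtr_gt0.
  exists ((Num.sqrt <| X, X |>)^-1 *: X), (Num.sqrt <| X, X |>).
  rewrite scalerA mulfV// scale1r gZ gC gZ mulrA -expr2 exprVn sqr_sqrtr ?ltW//.
  by rewrite mulVf// gt_eqF.
have [e2 h2 o2] := @unit_orthogonal _ _ _ J2 aw w11 wpos [:: e0; e0 *m J] isT.
have [e4 h4 o4] := @unit_orthogonal _ _ _ J2 aw w11 wpos [:: e0; e0 *m J; e2; e2 *m J] isT.
have {o2}[h20 h21] : <| e2, e0 |> = 0 /\ <| e2, e0 *m J |> = 0.
  by split; apply: o2; rewrite !inE eqxx ?orbT.
have {o4}[h40 h41 h42 h43] : [/\ <| e4, e0 |> = 0, <| e4, e0 *m J |> = 0,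
    <| e4, e2 |> = 0 & <| e4, e2 *m J |> = 0].
  by split; apply: o4; rewrite !inE eqxx ?orbT.
have [a [b [n [ab n0 abn]]]] := phase (U (tv [:: e0; e2; e4])).
(* Rotating [e4] in its complex line keeps the frame unitary and makes the value of [U] real and
   nonnegative. *)
exists e0, e2, (a *: e4 + b *: (e4 *m J)), lam, n; split.
  split=> //; rewrite U_slot2 -[b *: _]addr0 U_slot2 -abn.
  have -> : U (tv [:: e0; e2; 0]) = 0.
    by have := U_slot2 (-1) 0 0 e0 e2; rewrite scaler0 addr0 rmorphN1 mulN1r addNr.
  rewrite addr0 (U_swap e0 e2 (e4 *m J)) UJ -(U_swap e0 e2 e4); case: (U _) => p q.
  by apply/eqP; rewrite eq_complex /=; apply/andP; split; apply/eqP; ring.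
split; first split=> //.
  have f4 : <| e4 *m J, e4 |> = 0 by rewrite gC.
  have f44 : <| e4 *m J, e4 *m J |> = 1 by rewrite gJ.
  rewrite gl gZ (gC e4) (gC (e4 *m J)) !gl !gZ guJ h4 f4 f44 -[RHS]ab; ring.
by do 3?split=> //; rewrite gl gZ gJl ?JJ ?(gC e4 (- _)) ?gN ?(gC _ e4) ?h40 ?h41 ?h42 ?h43 ?oppr0 ?mulr0 ?addr0.
Qed.

Lemma adapted_frame X : exists (e : nat -> V) lam,
  [/\ e 6 = 0, X = lam *: e 0,
      {in words 2 7, forall l, w (tv (map e l)) = zr (omega0 l)},
      {in words 3 7, forall l, re U (tv (map e l)) = nu * zr (re0 l)}
    & {in words 3 7, forall l, im U (tv (map e l)) = nu * zr (im0 l)}] /\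
  [/\ forall r, (r < 3)%N -> e r.*2.+1 = e r.*2 *m J,
      forall v : V, exists c : 'I_6 -> R, v = \sum_i c i *: e i
    & forall i, (i < 7)%N -> <| X, e i |> = lam * zr (ind0 0 i)].
Proof.
have [e0 [e2 [e4 [lam [n [[Xe n0 Un] [[h0 h2 h4] [h20 [h21 [h40 h41 h42 h43]]]]]]]]]] := uframe_exists X.
have we := uframe_omega J2 aw w11 h0 h2 h4 h20 h21 h40 h41 h42 h43.
have Ure := uframe_re aUr aUi UJ Un; have Uie := uframe_im aUr aUi UJ Un.
have nnu := norm_eq aw we Ure Uie n0 nu0 normU; subst n.
pose e := uframe J e0 e2 e4.
have eJ r : (r < 3)%N -> e r.*2.+1 = e r.*2 *m J by do 3?[case: r => [|r]] => //.
have ge i j : (i < 7)%N -> (j < 6)%N -> <| e i, e j |> = zr (ind0 i j).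
  move=> i7 j6; have ww a b : (a < 7)%N -> (b < 7)%N -> w (tv [:: e a; e b]) = zr (omega0 [:: a; b]).
    move=> a7 b7; apply: (we [:: a; b]); apply/wordsP; split=> // c.
    by rewrite !inE => /orP[]/eqP->.
  have wN u v : w (tv [:: u; - v]) = - w (tv [:: u; v]).
    rewrite (alternating_swap01 u (- v) aw)// -(scaleN1r v) multilinear_headZ ?mulN1r; last by case: aw.
    by rewrite -(alternating_swap01 u v aw).
  have even r : (r < 3)%N -> <| e i, e r.*2 |> = zr (ind0 i r.*2).
    move=> r3; rewrite /kmetric -eJ// ww//; last by lia.
    move: i7 r3; do 7?[case: i => [|i]] => //; by do 3?[case: r => [|r]] => //.
  have odd r : (r < 3)%N -> <| e i, e r.*2.+1 |> = zr (ind0 i r.*2.+1).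
    move=> r3; rewrite /kmetric eJ// JJ wN ww//; last by lia.
    rewrite -zrN; congr zr.
    move: i7 r3; clear even; do 7?[case: i => [|i]] => //; by do 3?[case: r => [|r]] => //.
  have j2 : (j./2 < 3)%N by rewrite ltn_half_double.
  have jE := odd_double_half j; rewrite -jE; case: (ssrnat.odd j); [exact: odd|exact: even].
exists e, lam; split=> //; split=> //; last first.
  move=> i i7; rewrite Xe gZ -[e0]/(e 0%N) gC ge// /ind0 [in RHS]eq_sym.
  by case: eqP.
apply: (frame_basis (kmetric_ip J2 aw w11 wpos)) => i j; rewrite ge//.
  by rewrite /ind0 -val_eqE; case: eqP.
exact: ltn_trans (ltn_ord i) _.
Qed.
End AdaptedFrame.

(** * Calabi-Yau structures in a chart *)

Section SmoothMore.
Variables (R : realType) (V : normedModType R).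

Lemma classC_expR k (W : set V) (f : V -> R) : open W -> classC k W f ->
  classC k W (fun x => expR (f x)).
Proof.
move=> oW; have c_exp : (forall x, W x -> {for x, continuous f}) ->
    forall x, W x -> {for x, continuous (fun x => expR (f x))}.
  move=> cf x Wx; exact: (continuous_comp (cf x Wx) (@continuous_expR _ _)).
elim: k => [|k IH] Cf; first by case: Cf => cf _; split=> // x Wx; exact: c_exp.
have Cf' := classC_pred Cf; case: Cf => cf df; split; first exact: c_exp.
move=> v; have [dfv cfv] := df v.
have D x : W x -> is_derive x v (fun x => expR (f x)) (expR (f x) * 'D_v f x).
  by move=> Wx; apply: (@is_derive_comp _ _ (@expR R) f); exact/derivableP/dfv.
split=> [x /D[]//|]; apply: classC_ext (classCM oW (IH Cf') cfv) => //.
by move=> x /D[].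
Qed.

Lemma smooth_at_expR (f : V -> R) x : smooth_at x f -> smooth_at x (fun y => expR (f y)).
Proof.
move=> [W [oW Wx] C]; exists W => // k; exact: classC_expR.
Qed.
End SmoothMore.

Lemma gram_unit (R : realType) n (g : 'rV[R]_n -> 'rV[R]_n -> R) : inner_product g ->
  gram g \in unitmx.
Proof.
move=> gip; rewrite -row_free_unit -kermx_eq0; apply/eqP/eqP; apply/rowV0P => v /sub_kermxP vg.
have [_ _ gp] := gip; apply/eqP; apply: contraT => /gp.
by rewrite (gram_bilin gip) vg mul0mx mxE ltxx.
Qed.

Lemma smooth_wedge (R : realType) n k l (a : 'rV[R]_n -> kform R R n k)
    (b : 'rV[R]_n -> kform R R n l) x :
  (forall v, smooth_at x (fun y => a y v)) -> (forall v, smooth_at x (fun y => b y v)) ->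
  forall v, smooth_at x (fun y => wedge (a y) (b y) v).
Proof.
move=> sa sb v; apply: smooth_atZ; apply: smooth_at_sum => s; apply: smooth_atZ.
exact: smooth_atM.
Qed.

(** The factor [i] in the normalization turns this imaginary part into the real equation from which
    [nu] is recovered. *)
Lemma im_wedge_conj (R : realType) n k (U : kform R R[i] n k) v :
  complex.Im (wedge U (conjf U) v) = wedge (im U) (re U) v - wedge (re U) (im U) v.
Proof.
rewrite /wedge -natrM -(rmorph_nat (real_complex R)) -fmorphV /=.
have ImZ (c : R) z : complex.Im (c%:C * z) = c * complex.Im z.
  by case: z => p q /=; rewrite mul0r addr0.
have ImS (I : Type) (r : seq I) (F : I -> R[i]) :
    complex.Im (\sum_(i <- r) F i) = \sum_(i <- r) complex.Im (F i).
  by elim: r => [|i r IH]; rewrite ?big_nil// !big_cons -IH; case: (F i) (bigop _ _ _) => ?? [].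
rewrite ImZ ImS -mulrBr -sumrB; congr (_ * _); first by rewrite natrM.
apply: eq_bigr => s _.
rewrite -(rmorph_sign (real_complex R)) /= ImZ /conjf /re /im -mulrBr; congr (_ * _).
move: (U _) (U _) => -[p q] [p' q'] /=; ring.
Qed.

Section CalabiYauChart.
Variable R : realType.
Local Notation V := 'rV[R]_6.
Variables (D : set V) (oD : open D) (J : V -> 'M[R]_6).
Variables (w : V -> kform R R 6 2) (U : V -> kform R R[i] 6 3) (nu : V -> R).
Hypothesis J2 : forall x, D x -> J x *m J x = - 1%:M.
Hypothesis sJ : forall x a b, D x -> smooth_at x (fun y => J y a b).
Hypothesis nij : forall x a b, D x -> nijenhuis J (fun=> a) (fun=> b) x = 0.
Hypothesis sw : sform D w.
Hypothesis w11 : forall x u v, D x -> w x (tv [:: u *m J x; v *m J x]) = w x (tv [:: u; v]).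
Hypothesis wpos : forall x u, D x -> u != 0 -> 0 < w x (tv [:: u; u *m J x]).
Hypothesis dw0 : forall x v, D x -> extd w x v = 0.
Hypothesis sUr : sform D (fun x => re (U x)).
Hypothesis sUi : sform D (fun x => im (U x)).
Hypothesis U30 : forall x, D x -> component (J x) 3 0 (U x) = U x.
Hypothesis dbarU : forall x v, D x -> dbar J 3 0 U x v = 0.
Hypothesis nu0 : forall x, D x -> 0 < nu x.
Hypothesis normU : forall x (v : 'I_6 -> V), D x ->
  (3`!%:R)^-1 * wedge (cx (w x)) (wedge (cx (w x)) (cx (w x))) v =
  'i%C / 8 * ((nu x ^+ 2)^-1)%:C * wedge (U x) (conjf (U x)) v.

Definition metric x := kmetric (J x) (w x).
Definition lognorm x := ln (nu x).
Definition grad := gradient metric lognorm.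

Lemma metric_ip x : D x -> inner_product (metric x).
Proof.
move=> Dx; apply: kmetric_ip; [exact: J2|exact: (sw Dx).1|by move=> *; exact: w11|].
by move=> *; exact: wpos.
Qed.

Lemma frame_at x X : D x -> exists (e : nat -> V) lam,
  [/\ e 6 = 0, X = lam *: e 0,
      {in words 2 7, forall l, w x (tv (map e l)) = zr (omega0 l)},
      {in words 3 7, forall l, re (U x) (tv (map e l)) = nu x * zr (re0 l)}
    & {in words 3 7, forall l, im (U x) (tv (map e l)) = nu x * zr (im0 l)}] /\
  [/\ forall r, (r < 3)%N -> e r.*2.+1 = e r.*2 *m J x,
      forall v : V, exists c : 'I_6 -> R, v = \sum_i c i *: e i
    & forall i, (i < 7)%N -> metric x X (e i) = lam * zr (ind0 0 i)].
Proof.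
move=> Dx; apply: adapted_frame.
- exact: J2.
- exact: (sw Dx).1.
- by move=> *; exact: w11.
- by move=> *; exact: wpos.
- exact: (sUr Dx).1.
- exact: (sUi Dx).1.
- by move=> *; apply: (type30 J2 sUr sUi U30).
- exact: nu0.
- by move=> v; exact: normU.
Qed.

(** [is_norm] determines [nu] point by point. Evaluated on the frame of [x], kept constant near [x],
    it reads [nu^2 q = p] with [p] and [q] smooth and [q x = 1]; hence [ln nu] is half of
    [ln (p / q)] near [x]. *)
Lemma lognorm_smooth x : D x -> smooth_at x lognorm.
Proof.
move=> Dx; have [e [_ [[_ _ we _ _] _]]] := frame_at 0 Dx.
pose v := tv (map e (iota 0 6)) : 'I_6 -> V.
pose v6 : 'I_(2 + (2 + 2)) -> V := v.
pose v3 : 'I_(3 + 3) -> V := v.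
pose q y := (3`!%:R)^-1 * wedge (w y) (wedge (w y) (w y)) v6.
pose p y := 8^-1 * (wedge (re (U y)) (im (U y)) v3 - wedge (im (U y)) (re (U y)) v3).
have qp y : D y -> nu y ^+ 2 * q y = p y.
  move=> Dy; have := normU v Dy; rewrite !wedge_cx /cx => /(congr1 (@complex.Re R)).
  rewrite -(rmorph_nat (real_complex R)) -fmorphV /= mul0r subr0 -/(q y) => ->.
  rewrite (_ : complex.Re _ = (nu y ^+ 2)^-1 * (8^-1 * - complex.Im (wedge (U y) (conjf (U y)) v3))).
    by rewrite mulrA mulfV ?mul1r ?im_wedge_conj ?opprB// expf_neq0// gt_eqF// nu0.
  have -> : 8^-1 = (8^-1)%:C :> R[i] by rewrite fmorphV rmorph_nat.
  by case: (wedge _ _ _) => a b /=; ring.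
have q1 : q x = 1.
  by rewrite /q (omega_cubeE (sw Dx).1 we) !factS fact0 mulVf// pnatr_eq0.
have swv u := (sw Dx).2 u.
have sq : smooth_at x q by apply: smooth_atZ; do 2!apply: smooth_wedge => //.
have sp : smooth_at x p.
  apply: smooth_atZ; apply: smooth_atD; last apply: smooth_atN;
    by apply: smooth_wedge => u; (exact: (sUr Dx).2 || exact: (sUi Dx).2).
have px : 0 < p x / q x by rewrite -qp// q1 mulr1 divr1 exprn_gt0// nu0.
apply: (@smooth_at_ext _ _ (fun y => 2^-1 * ln (p y / q y))); last first.
  by apply: smooth_atZ; apply: smooth_at_ln => //;
    apply: smooth_atM => //; apply: smooth_atV; rewrite ?q1 ?oner_neq0.
have qn0 : \forall y \near x, q y != 0.
  by apply: cvgr_neq0 (smooth_at_continuous sq) _; rewrite q1 oner_neq0.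
near=> y; have Dy : D y by near: y; exact: near_D.
have qy : q y != 0 by near: y.
rewrite -qp// mulfK// lnXn ?nu0// -[ln _ *+ 2]mulr_natl mulrA mulVf ?mul1r//.
Unshelve. all: by end_near.
Qed.

Lemma nu_expR x : D x -> nu x = expR (lognorm x).
Proof. by move=> Dx; rewrite lnK// posrE nu0. Qed.

Lemma nu_near x : D x -> \near x, expR (lognorm x) = nu x.
Proof. by move=> Dx; apply: filterS (near_D oD Dx) => y Dy; rewrite -nu_expR. Qed.

Lemma norm_smooth x : D x -> smooth_at x nu.
Proof.
move=> Dx; apply: smooth_at_ext (nu_near Dx) _; apply: smooth_at_expR.
exact: lognorm_smooth.
Qed.

Lemma norm_derive x v : D x -> 'D_v nu x = nu x * 'D_v lognorm x.
Proof.
move=> Dx; rewrite -(near_eq_derive _ (nu_near Dx)) (nu_expR Dx).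
have /derivableP h := smooth_at_derivable (v := v) (lognorm_smooth Dx).
by have [] := is_derive_comp h (is_derive_expR _).
Qed.

Lemma metric_smooth x u v : D x -> smooth_at x (fun y => metric y u v).
Proof.
move=> Dx; have sv : svec D (fun y => v *m J y).
  move=> y Dy j; apply: (@smooth_at_ext _ _ (fun y => \sum_i v 0 i * J y i j)).
    by apply: filterE => z; rewrite mxE.
  by apply: smooth_at_sum => i; apply: smooth_atZ; exact: sJ.
apply: smooth_at_ext (smooth_atN (smooth_head oD [:: u] sw sv Dx)).
apply: filterS (near_D oD Dx) => y Dy.
by rewrite /metric /kmetric (alternating_swap01 u _ (sw Dy).1)// opprK.
Qed.

Lemma smooth_det n (A : V -> 'M[R]_n) x : (forall i j, smooth_at x (fun y => A y i j)) ->
  smooth_at x (fun y => \det (A y)).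
Proof.
move=> sA; apply: smooth_at_sum => s; apply: smooth_atZ; exact: smooth_at_prod.
Qed.

Lemma grad_smooth : svec D grad.
Proof.
move=> x Dx j; pose G y := gram (metric y).
have sG i k : smooth_at x (fun y => G y i k).
  apply: smooth_at_ext (metric_smooth (ebase R i) (ebase R k) Dx).
  by apply: filterE => y; rewrite mxE.
have sd : smooth_at x (fun y => \det (G y)) by exact: smooth_det.
(* Cramer's rule: the inverse Gram matrix is rational in the entries of the metric. *)
apply: (@smooth_at_ext _ _ (fun y => \sum_i 'D_(ebase R i) lognorm y *
    ((\det (G y))^-1 * ((-1) ^+ (j + i) * \det (row' j (col' i (G y))))))).
  apply: filterS (near_D oD Dx) => y Dy; rewrite /grad /gradient [RHS]mxE; apply: eq_bigr => i _.
  by rewrite mxE -/(G y) /invmx (gram_unit (metric_ip Dy)) !mxE.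
apply: smooth_at_sum => i; apply: smooth_atM.
  exact: smooth_at_derive (lognorm_smooth Dx).
apply: smooth_atM.
  apply: smooth_atV => //; have := gram_unit (metric_ip Dx); by rewrite unitmxE unitfE.
apply: smooth_atZ; apply: smooth_det => a b; apply: smooth_at_ext (sG (lift j a) (lift i b)).
by apply: filterE => y; rewrite [RHS]mxE [RHS]mxE.
Qed.

Lemma metric_grad x v : D x -> metric x (grad x) v = 'D_v lognorm x.
Proof.
move=> Dx; rewrite (gram_bilin (metric_ip Dx)) mulmxKV; last exact: gram_unit (metric_ip Dx).
have al : multilinear (oneform (fun v : V => 'D_v lognorm x)).
  by case: (@oneform_alternating _ _ (fun v : V => 'D_v lognorm x)) => // *;
    exact: derive_linear (lognorm_smooth Dx).
have := multilinear_head_sum [::] v al; rewrite !oneform_tv => ->.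
by rewrite mxE; apply: eq_bigr => i _; rewrite !mxE oneform_tv mulrC.
Qed.

Lemma holomorphic_closed x v : D x ->
  extd (fun y => re (U y)) x v = 0 /\ extd (fun y => im (U y)) x v = 0.
Proof.
move=> Dx; have [e [_ [_ [eJ ebas _]]]] := frame_at 0 Dx.
split; first exact: (extd_reU oD J2 sJ nij sUr sUi U30 dbarU Dx eJ ebas).
exact: (extd_imU oD J2 sJ nij sUr sUi U30 dbarU Dx eJ ebas).
Qed.

Lemma dUr0 x v : D x -> extd (fun y => re (U y)) x v = 0.
Proof. by case/(holomorphic_closed v). Qed.
Lemma dUi0 x v : D x -> extd (fun y => im (U y)) x v = 0.
Proof. by case/(holomorphic_closed v). Qed.

(** * The right-hand side of the flow over a chart *)

Section Circle.
Local Notation W := 'rV[R]_(6 + 1).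
Local Notation L := lsubmx.
Variables (O : set W) (oO : open O).
Hypothesis OD : forall y, O y -> D (L y).
Variables (phi : W -> kform R R (6 + 1) 3) (g : W -> W -> W -> R).
Variable vol : W -> kform R R (6 + 1) (6 + 1).
Hypothesis phiE : forall y, O y -> phi y = phi7 (w (L y)) (re (U (L y))) (nu (L y)).
Hypothesis sphi : forall y v, O y -> smooth_at y (fun p => phi p v).
Hypothesis gip : forall y, O y -> inner_product (g y).
Hypothesis gvol : forall y, O y -> volume_form (g y) (vol y).
Hypothesis gphi : forall y, O y -> forall (X Y : W) (v : 'I_7 -> W),
  wedge (contract X (phi y)) (wedge (contract Y (phi y)) (phi y)) v = 6 * g y X Y * vol y v.

Definition psiO (y : W) := psi7 (w (L y)) (im (U (L y))).
Definition dphiO (y : W) := dphi7 (w (L y)) (re (U (L y))) (nu (L y)) (fun u => 'D_u lognorm (L y)).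
Definition chiO (y : W) := chi7 (w (L y)) (im (U (L y))) (grad (L y)).

(** The frame belongs to the single point [y], but the resulting formulas no longer mention it, so
    they can be differentiated over [O]. *)
Lemma stars y : O y ->
  [/\ @star R 7 3 4 erefl (g y) (vol y) (phi y) = psiO y,
      @star R 7 4 3 erefl (g y) (vol y) (psiO y) = phi y,
      @star R 7 4 3 erefl (g y) (vol y) (dphiO y) = chiO y
    & forall v, wedge (phi y) (dphiO y) v = 0].
Proof.
move=> Oy; have Dy := OD Oy; have [e [lam [[e6 Xe we Ure Uie] [_ _ me]]]] := frame_at (grad (L y)) Dy.
have dfe i : (i < 7)%N -> 'D_(e i) lognorm (L y) = lam * zr (ind0 0 i).
  by move=> i7; rewrite -metric_grad// me.
have aw := (sw Dy).1; have aUr := (sUr Dy).1; have aUi := (sUi Dy).1; have n0 := nu0 Dy.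
have ldf c u v : 'D_(c *: u + v) lognorm (L y) = c * 'D_u lognorm (L y) + 'D_v lognorm (L y).
  exact: derive_linear (lognorm_smooth Dy).
have aphi : alternating (phi y) by rewrite (phiE Oy); exact: phi7_alternating.
have apsi : alternating (psiO y) by exact: psi7_alternating.
have adphi : alternating (dphiO y) by exact: dphi7_alternating.
have achi : alternating (chiO y) by exact: chi7_alternating.
pose E := E7 (nu (L y)) e.
have phiT : {in words 3 7, forall l, phi y (tv (map E l)) = zr (phi0 l)}.
  by rewrite (phiE Oy); exact: phi7_frame.
have psiT : {in words 4 7, forall l, psiO y (tv (map E l)) = 1 * zr (psi0 l)}.
  by move=> l lw; rewrite mul1r; move: l lw; exact: psi7_frame.
have phiT1 : {in words 3 7, forall l, phi y (tv (map E l)) = 1 * zr (phi0 l)}.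
  by move=> l lw; rewrite mul1r phiT.
have dphiT : {in words 4 7, forall l, dphiO y (tv (map E l)) = lam * zr (dphi0 l)}.
  exact: dphi7_frame.
have chiT : {in words 3 7, forall l, chiO y (tv (map E l)) = lam * zr (chi0 l)}.
  exact: chi7_frame.
have ip := gip Oy; have vf := gvol Oy; have gp := gphi Oy.
split.
- apply/funext; exact: (@star_tab_eq R (phi y) E (g y) (vol y) aphi phiT ip vf gp 3 4 erefl
    phi0 psi0 1 (phi y) (psiO y) star_phi0 aphi apsi phiT1 psiT).
- apply/funext; exact: (@star_tab_eq R (phi y) E (g y) (vol y) aphi phiT ip vf gp 4 3 erefl
    psi0 phi0 1 (psiO y) (phi y) star_psi0 apsi aphi psiT phiT1).
- apply/funext; exact: (@star_tab_eq R (phi y) E (g y) (vol y) aphi phiT ip vf gp 4 3 erefl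
    dphi0 chi0 lam (dphiO y) (chiO y) star_dphi0 adphi achi dphiT chiT).
exact: (@wedge_tab_eq0 R (phi y) E (g y) (vol y) aphi phiT ip vf gp (phi y) (dphiO y)
  phi0 dphi0 lam wedge_phi0_dphi0 aphi adphi phiT dphiT).
Qed.

Lemma star_form0 k l (Ekl : (k + l)%N = 7%N) y : star Ekl (g y) (vol y) (fun=> 0) = (fun=> 0).
Proof.
apply/funext => v; rewrite /star big1 ?mulr0// => f _; rewrite big1// => h _.
by rewrite mulr0 mul0r.
Qed.

Lemma extd_form0 k (y : W) : extd (fun _ : W => (fun=> 0) : kform R R 7 k) y = (fun=> 0).
Proof. by apply/funext => v; rewrite /extd big1// => i _; rewrite derive_cst mulr0. Qed.

Lemma extd_phiO y : O y -> extd phi y = dphiO y.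
Proof.
move=> Oy; have Dy := OD Oy; apply/funext => v; rewrite (eq_extd oO v Oy phiE).
by apply: (extd_phi7 oD sw sUr norm_smooth nu0 norm_derive lognorm_smooth dw0 dUr0 v Dy).
Qed.

Lemma extd_psiO y : O y -> extd psiO y = (fun=> 0).
Proof.
move=> Oy; have Dy := OD Oy; apply/funext => v.
by apply: (extd_psi7 oD sw sUi dw0 dUi0 v Dy).
Qed.

Lemma flow_rhs A y v : O y ->
  let psi p := @star R 7 3 4 erefl (g p) (vol p) (phi p) in
  extd (@codiff R 7 3 3 erefl erefl g vol psi) y v +
    @codiff R 7 4 2 erefl erefl g vol (extd psi) y v +
    extd (fun p u => (A - 7 / 2 * (7^-1 * @star R 7 7 0 erefl (g p) (vol p)
      (wedge (phi p) (extd phi p)) (fun=> 0))) * phi p u) y v =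
  extd chiO y v + A * dphiO y v.
Proof.
move=> Oy psi; have psiE p (Op : O p) : psi p = psiO p by have [] := stars Op.
have cE p : O p -> @codiff R 7 3 3 erefl erefl g vol psi p = chiO p.
  (* The exponent of the sign is [7 * 5 + 1], which is even. *)
  move=> Op; apply/funext => u; rewrite /codiff -signr_odd mul1r.
  suff -> : extd (fun q => @star R 7 4 3 erefl (g q) (vol q) (psi q)) p = dphiO p.
    by have [_ _ -> _] := stars Op.
  rewrite -extd_phiO//; apply/funext => z; apply: (eq_extd oO) => // q Oq.
  by rewrite psiE//; have [_ -> _ _] := stars Oq.
have dpsi0 p : O p -> extd psi p = (fun=> 0).
  by move=> Op; rewrite -(extd_psiO Op); apply/funext => u; exact: (eq_extd oO).
congr (_ + _); last first.
  have -> : extd (fun p u => (A - 7 / 2 * (7^-1 * @star R 7 7 0 erefl (g p) (vol p)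
      (wedge (phi p) (extd phi p)) (fun=> 0))) * phi p u) y v = extd (fun p u => A * phi p u) y v.
    apply: (eq_extd oO) => // p Op; apply/funext => u.
    have -> : wedge (phi p) (extd phi p) = (fun=> 0).
      by apply/funext => z; rewrite extd_phiO//; have [_ _ _ ->] := stars Op.
    by rewrite star_form0 !mulr0 subr0.
  rewrite -(extd_phiO Oy) /extd mulr_sumr; apply: eq_bigr => i _.
  rewrite mulrCA; congr (_ * _).
  exact: derive_ptZ (sphi _ Oy).
rewrite (eq_extd oO _ Oy cE) -[RHS]addr0; congr (_ + _).
(* The other half of the Laplacian vanishes because [psi] is closed throughout [O]. *)
rewrite /codiff (_ : extd _ y = (fun=> 0)) ?star_form0 ?mulr0//.
rewrite -(extd_form0 2 y); apply/funext => u; apply: (eq_extd oO) => // p Op.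
by rewrite dpsi0// star_form0.
Qed.

End Circle.

End CalabiYauChart.

(** * Time derivatives and types *)

Section TimeDerivative.
Variables (R : realType) (I : set R) (t : R).
Hypothesis It : I t.
Implicit Types f g : R -> R.

Let near_ddt (P : R -> Prop) : (forall s, I s -> s != t -> P s) -> \forall s \near within I t^', P s.
Proof. by move=> IP; do 2!rewrite near_withinE; apply: filterE => s st Is; exact: IP. Qed.

Lemma has_ddt_ext f g l : (forall s, I s -> f s = g s) -> has_ddt I f t l -> has_ddt I g t l.
Proof.
move=> fg; apply: cvg_trans; apply: near_eq_cvg.
by apply: near_ddt => s Is _; rewrite !fg.
Qed.

(** Limits are unique along a proper filter only; here it is proper because [I] contains the segment
    between [t] and another time. *)
Lemma has_ddt_unique f l l' : is_interval I -> (exists s, I s /\ s <> t) ->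
  has_ddt I f t l -> has_ddt I f t l' -> l = l'.
Proof.
move=> itI [s0 [Is0 /eqP s0t]] fl fl'.
have pf : ProperFilter (within I t^').
  apply: Build_ProperFilter_ex => P /nbhs_ballP[r /= r0 h].
  have [lt|lt|/eqP] := ltgtP s0 t; last by rewrite (negPf s0t).
    (* A point of [I] on the side of [s0], distinct from [t] and less than [r] away. *)
    have yt : Num.max s0 (t - r / 2) < t by rewrite gt_max lt ltrBlDr ltrDl divr_gt0.
    exists (Num.max s0 (t - r / 2)); apply: h; last first.
    - by apply: (itI _ _ Is0 It); rewrite le_max lexx /= ltW.
    - by rewrite lt_eqF.
    rewrite /ball /= ger0_norm ?subr_ge0 ?ltW// ltrBlDr -ltrBlDl lt_max; apply/orP; right.
    by rewrite ltrD2l ltrN2 ltr_pdivrMr// ltr_pMr// ltr1n.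
  have yt : t < Num.min s0 (t + r / 2) by rewrite lt_min lt ltrDl divr_gt0.
  exists (Num.min s0 (t + r / 2)); apply: h; last first.
  - by apply: (itI _ _ It Is0); rewrite ltW /= ?ge_min ?lexx.
  - by rewrite gt_eqF.
  rewrite /ball /= ler0_norm ?subr_le0 ?ltW// opprB ltrBlDl gt_min; apply/orP; right.
  by rewrite ltrD2l ltr_pdivrMr// ltr_pMr// ltr1n.
exact: (cvg_unique _ fl fl').
Qed.

Lemma has_ddtD f g l m : has_ddt I f t l -> has_ddt I g t m ->
  has_ddt I (fun s => f s + g s) t (l + m).
Proof.
move=> fl gm; apply: cvg_trans (cvgD fl gm); apply: near_eq_cvg.
by apply: near_ddt => s _ _; rewrite /= !fctE; ring.
Qed.

Lemma has_ddtN f l : has_ddt I f t l -> has_ddt I (fun s => - f s) t (- l).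
Proof.
move=> fl; apply: cvg_trans (cvgN fl); apply: near_eq_cvg.
by apply: near_ddt => s _ _; rewrite /= !fctE; ring.
Qed.

Lemma has_ddt_continuous f l : has_ddt I f t l -> f @ within I t^' --> f t.
Proof.
move=> fl; have idt : (fun s => s - t) @ within I t^' --> (0 : R).
  have c : (fun s : R => s - t) @ t --> t - t by apply: cvgB; [exact: cvg_id|exact: cvg_cst].
  rewrite -(subrr t); apply: cvg_trans c; apply: cvg_app.
  exact: cvg_trans (cvg_within _) (cvg_within _).
have -> : f t = l * 0 + f t by rewrite mulr0 add0r.
apply: cvg_trans (cvgD (cvgM fl idt) (cvg_cst (f t))); apply: near_eq_cvg.
by apply: near_ddt => s _ st; rewrite /= !fctE /= mulfVK ?subr_eq0 ?subrK.
Qed.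

Lemma has_ddtM f g l m : has_ddt I f t l -> has_ddt I g t m ->
  has_ddt I (fun s => f s * g s) t (l * g t + f t * m).
Proof.
move=> fl gm; have gc := has_ddt_continuous gm.
apply: cvg_trans (cvgD (cvgM fl gc) (cvgM (cvg_cst (f t)) gm)).
by apply: near_eq_cvg; apply: near_ddt => s _ _; rewrite /= !fctE /=; ring.
Qed.

End TimeDerivative.

(** * Consequences of type for the two remaining terms *)

Section Types.
Variables (R : realType) (J : 'M[R]_6) (w : kform R R 6 2).
Local Notation V := 'rV[R]_6.
Hypothesis J2 : J *m J = - 1%:M.
Hypothesis aw : alternating w.
Hypothesis w11 : forall u v, w (tv [:: u *m J; v *m J]) = w (tv [:: u; v]).

Let JJ u : (u *m J) *m J = - u :> V.
Proof. by rewrite -mulmxA J2 mulmxN mulmx1. Qed.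

Let wN u v : w (tv [:: - u; v]) = - w (tv [:: u; v]).
Proof. by rewrite -scaleN1r multilinear_headZ ?mulN1r//; case: aw. Qed.

(* A [(1,0) + (0,1)]-form times a [(1,1)]-form has no [(3,0)] or [(0,3)] part. *)
Lemma component_lefschetz (c : kform R R 6 3) (al : V -> R) : alternating c ->
  (forall p q s, c (tv [:: p; q; s]) =
     al p * w (tv [:: q; s]) - al q * w (tv [:: p; s]) + al s * w (tv [:: p; q])) ->
  (forall u, al (- u) = - al u) ->
  forall v, component J 0 3 (cx c) v + component J 3 0 (cx c) v = 0.
Proof.
move=> ac cE alN v; rewrite [v]tv_codom 3!enum_ordSl (size0nil (size_enum_ord 0)) /=.
set p := v _; set q := v _; set s := v _; have mc : mlC (cx c) by apply: mlC_cx; case: ac.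
rewrite component03// component30//.
(* In the sum of the two components the terms with [i] cancel, and this identity disposes of the
   rest. *)
have h : c (tv [:: p; q; s]) = c (tv [:: p *m J; q *m J; s]) + c (tv [:: p *m J; q; s *m J])
    + c (tv [:: p; q *m J; s *m J]).
  have wJ a b : w (tv [:: a *m J; b]) = - w (tv [:: a; b *m J]) by rewrite -w11 JJ wN.
  by rewrite !cE !w11 !wJ; ring.
rewrite -mulrDr /cx h !rmorphD; apply/eqP; rewrite mulf_eq0; apply/orP; right; apply/eqP.
by ring.
Qed.

Variables (e : nat -> V) (lam nu k : R) (Ur : kform R R 6 3) (b : kform R R 6 2) (al : V -> R).
Hypothesis eJ : forall r, (r < 3)%N -> e r.*2.+1 = e r.*2 *m J.
Hypothesis ebas : forall v : V, exists c : 'I_6 -> R, v = \sum_i c i *: e i.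
Hypothesis we : {in words 2 7, forall l, w (tv (map e l)) = zr (omega0 l)}.
Hypothesis Ure : {in words 3 7, forall l, Ur (tv (map e l)) = nu * zr (re0 l)}.
Hypothesis ale : forall i, (i < 7)%N -> al (e i) = lam * zr (ind0 0 i).
Hypothesis ab : alternating b.
Hypothesis bw : forall p q s t,
  b (tv [:: p; q]) * w (tv [:: s; t]) - b (tv [:: p; s]) * w (tv [:: q; t]) +
  b (tv [:: p; t]) * w (tv [:: q; s]) + w (tv [:: p; q]) * b (tv [:: s; t]) -
  w (tv [:: p; s]) * b (tv [:: q; t]) + w (tv [:: p; t]) * b (tv [:: q; s]) =
  k * (al p * Ur (tv [:: q; s; t]) - al q * Ur (tv [:: p; s; t]) +
       al s * Ur (tv [:: p; q; t]) - al t * Ur (tv [:: p; q; s])).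

(** The hypothesis on [b] is [b /\ w = k al /\ Ur], whose right side has types (3,1) and (1,3). In
    the frame it is a linear system for the 15 entries of [b], which forces the (1,1) part to
    vanish. *)
Lemma component11_eq0 v : component J 1 1 (cx b) v = 0.
Proof.
pose B i j := b (tv [:: e i; e j]).
have wE i j : (i < 7)%N -> (j < 7)%N -> w (tv [:: e i; e j]) = zr (omega0 [:: i; j]).
  move=> i7 j7; apply: (we (x := [:: i; j])); apply/wordsP; split=> // c.
  by rewrite !inE => /orP[]/eqP->.
have UE i j m : (i < 7)%N -> (j < 7)%N -> (m < 7)%N ->
    Ur (tv [:: e i; e j; e m]) = nu * zr (re0 [:: i; j; m]).
  move=> i7 j7 m7; apply: (Ure (x := [:: i; j; m])); apply/wordsP; split=> // c.
  by rewrite !inE => /or3P[]/eqP->.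
have eq4 p q s t : (p < 7)%N -> (q < 7)%N -> (s < 7)%N -> (t < 7)%N ->
  B p q * zr (omega0 [:: s; t]) - B p s * zr (omega0 [:: q; t]) +
  B p t * zr (omega0 [:: q; s]) + zr (omega0 [:: p; q]) * B s t -
  zr (omega0 [:: p; s]) * B q t + zr (omega0 [:: p; t]) * B q s =
  (k * lam * nu) * (zr (ind0 0 p) * zr (re0 [:: q; s; t]) - zr (ind0 0 q) * zr (re0 [:: p; s; t]) +
       zr (ind0 0 s) * zr (re0 [:: p; q; t]) - zr (ind0 0 t) * zr (re0 [:: p; q; s])).
  move=> p7 q7 s7 t7; have := bw (e p) (e q) (e s) (e t).
  by rewrite !wE// !UE// !ale// -/(B p q) -/(B p s) -/(B p t) -/(B s t) -/(B q t) -/(B q s) => ->; ring.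
have BC i j : B i j = - B j i by rewrite /B (alternating_swap01 _ _ ab).
have B0 i : B i i = 0 by have := BC i i => h; lra.
(* Twice the (1,1) part of [b]. *)
pose b' : kform R R 6 2 := fun v => b v + b (fun j => v j *m J).
have ab' : alternating b'.
  apply: alternatingD => //.
  by apply: (alternating_pull (L := fun u => u *m J)) => // c u z; rewrite mulmxDl scalemxAl.
have Z := (zr0, zr1, zrm1, mul0r, mulr0, mul1r, mulr1, mulN1r, mulrN1, add0r, addr0, sub0r, subr0, oppr0).
(* One equation for each of the 15 increasing quadruples of frame indices. *)
move: (eq4 0 1 2 3 isT isT isT isT) (eq4 0 1 2 4 isT isT isT isT) (eq4 0 1 2 5 isT isT isT isT)
  (eq4 0 1 3 4 isT isT isT isT) (eq4 0 1 3 5 isT isT isT isT) (eq4 0 1 4 5 isT isT isT isT)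
  (eq4 0 2 3 4 isT isT isT isT) (eq4 0 2 3 5 isT isT isT isT) (eq4 0 2 4 5 isT isT isT isT)
  (eq4 0 3 4 5 isT isT isT isT) (eq4 1 2 3 4 isT isT isT isT) (eq4 1 2 3 5 isT isT isT isT)
  (eq4 1 2 4 5 isT isT isT isT) (eq4 1 3 4 5 isT isT isT isT) (eq4 2 3 4 5 isT isT isT isT).
rewrite /omega0 /re0 /ind0 /tab /= !Z => q0123 q0124 q0125 q0134 q0135 q0145 q0234 q0235
  q0245 q0345 q1234 q1235 q1245 q1345 q2345.
have bJ i j : b (fun m => tv [:: e i; e j] m *m J) = b (tv [:: e i *m J; e j *m J]).
  by congr b; apply/funext => -[[|[|]]].
have bN u z : b (tv [:: - u; z]) = - b (tv [:: u; z]).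
  by rewrite -(scaleN1r u) multilinear_headZ ?mulN1r//; case: ab.
have bN' u z : b (tv [:: u; - z]) = - b (tv [:: u; z]).
  by rewrite (alternating_swap01 u (- z) ab)// bN -(alternating_swap01 u z ab).
have J0 := esym (eJ (isT : 0 < 3)%N); have J1 := esym (eJ (isT : 1 < 3)%N).
have J2' := esym (eJ (isT : 2 < 3)%N); rewrite /= in J0 J1 J2'.
have eJJ : (e 1%N *m J = - e 0%N) * (e 3 *m J = - e 2) * (e 5 *m J = - e 4).
  by rewrite -J0 -J1 -J2' !JJ.
have Bs : (B 1 0 = - B 0 1) * (B 2 0 = - B 0 2) * (B 3 0 = - B 0 3) * (B 4 0 = - B 0 4) *
    (B 5 0 = - B 0 5) * (B 2 1 = - B 1 2) * (B 3 1 = - B 1 3) * (B 4 1 = - B 1 4) *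
    (B 5 1 = - B 1 5) * (B 3 2 = - B 2 3) * (B 4 2 = - B 2 4) * (B 5 2 = - B 2 5) *
    (B 4 3 = - B 3 4) * (B 5 3 = - B 3 5) * (B 5 4 = - B 4 5) by do !split; exact: BC.
have b'0 : forall v, b' v = 0.
  apply: (form_words_eq (E := e) ab'.1 _ ebas); first exact: (@alternating0 R 6 2).1.
  move=> l /wordsP[]; case: l => [|i [|j []]]//= _ h.
  have i6 : (i < 6)%N by apply: h; rewrite !inE eqxx.
  have j6 : (j < 6)%N by apply: h; rewrite !inE eqxx orbT.
  rewrite /b' bJ {h}; move: i6 j6.
  do 6?[case: i => [|i]] => //; do 6?[case: j => [|j]] => // _ _;
    (* The right side cancels in pairs: for instance [B 2 5] and [B 3 4] both equal
       [- k * lam * nu], and [b'] takes their difference. *)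
    rewrite ?(J0, J1, J2', eJJ, bN, bN') -?[b _]/(B _ _) ?(B0, Bs); lra.
have mb : mlC (cx b) by apply: mlC_cx; case: ab.
rewrite [v]tv_codom 2!enum_ordSl (size0nil (size_enum_ord 0)) /= component11//.
set p := v _; set q := v _; have := b'0 (tv [:: p; q]).
rewrite /b' (_ : (fun j => _) = tv [:: p *m J; q *m J]); last by apply/funext => -[[|[|]]].
by move=> h; rewrite /cx -rmorphD h mulr0.
Qed.

End Types.

Lemma kahler_metricE (R : realType) n (J : 'M[R]_n) (w : kform R R n 2) u v :
  kahler_metric J w u v = w (tv [:: u; v *m J]).
Proof.
by rewrite /kahler_metric tv_cons_vcons; congr (w (vcons u _)); apply/funext => j; rewrite ord1.
Qed.

Lemma smooth_map_on_cst (R : realType) n m (D : set 'rV[R]_n) (u : 'rV[R]_m) :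
  smooth_map_on D (fun=> u).
Proof.
move=> j; exists setT; split; [exact: openT|by []|exists (fun=> u 0 j) => // k].
exact: classC_cst.
Qed.

(** * Passage to the charts of the manifold *)

Section Chart.
Variables (R : realType) (N : atlas R 6).
Local Notation V := 'rV[R]_6.
Variables (J : field N 'M[R]_6) (w : field N (kform R R 6 2)).
Variables (U : field N (kform R R[i] 6 3)) (nu : field N R).
Hypothesis smN : smooth_manifold N.
Hypothesis cy : calabi_yau J w U.
Hypothesis nrm : is_norm w U nu.
Variable i : idx N.
Local Notation D := (dom i).

Lemma open_dom : open D.
Proof. by case: smN => /(_ i)[]. Qed.

Lemma form_sform k (a : field N (kform R R 6 k)) : is_form a -> sform D (a i).
Proof.
by move=> [aa sa _] x Dx; split; [exact: aa|move=> v; exact: smooth_on_at open_dom (sa i v) Dx].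
Qed.

Let oD := open_dom.
Let J2 x : D x -> J i x *m J i x = - 1%:M.
Proof. by case: cy => -[[h _ _] _] _ _; exact: h. Qed.
Let sJ x a b : D x -> smooth_at x (fun y => J i y a b).
Proof. by case: cy => -[[_ h _] _] _ _; exact: smooth_on_at oD (h i a b). Qed.
Let nij x a b : D x -> nijenhuis (J i) (fun=> a) (fun=> b) x = 0.
Proof. by case: cy => -[_ h] _ _; apply: h; exact: smooth_map_on_cst. Qed.
Let sw : sform D (w i).
Proof. by case: cy => _ [h _] _; exact: form_sform. Qed.
Let w11 x u v : D x -> w i x (tv [:: u *m J i x; v *m J i x]) = w i x (tv [:: u; v]).
Proof.
move=> Dx; case: cy => _ [_ /(_ i x Dx)[h _ _]] _.
have mw : mlC (cx (w i x)) by apply: mlC_cx; case: (sw Dx) => -[].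
have := congr1 (fun f => complex.Re (f (tv [:: u; v]))) h.
rewrite component11// (_ : (2^-1 : R[i]) = (2^-1)%:C); last by rewrite fmorphV rmorph_nat.
by rewrite /cx -rmorphD -rmorphM /= => h2; lra.
Qed.
Let wpos x u : D x -> u != 0 -> 0 < w i x (tv [:: u; u *m J i x]).
Proof.
by move=> Dx; case: cy => _ [_ /(_ i x Dx)[_ h _]] _; rewrite -kahler_metricE; exact: h.
Qed.
Let dw0 x v : D x -> extd (w i) x v = 0.
Proof. by move=> Dx; case: cy => _ [_ /(_ i x Dx)[_ _ h]] _; exact: h. Qed.
Let sUr : sform D (fun x => re (U i x)).
Proof. by case: cy => _ _ [[h _] _]; exact: (form_sform h). Qed.
Let sUi : sform D (fun x => im (U i x)).
Proof. by case: cy => _ _ [[_ h] _]; exact: (form_sform h). Qed.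
Let U30 x : D x -> component (J i x) 3 0 (U i x) = U i x.
Proof. by move=> Dx; case: cy => _ _ [_ /(_ i x Dx)[h _ _]]. Qed.
Let dbarU x v : D x -> dbar (J i) 3 0 (U i) x v = 0.
Proof. by move=> Dx; case: cy => _ _ [_ /(_ i x Dx)[_ h _]]; exact: h. Qed.
Let nu0 x : D x -> 0 < nu i x.
Proof. by move=> /nrm[]. Qed.
Let normU x (v : 'I_6 -> V) : D x ->
  (3`!%:R)^-1 * wedge (cx (w i x)) (wedge (cx (w i x)) (cx (w i x))) v =
  'i%C / 8 * ((nu i x ^+ 2)^-1)%:C * wedge (U i x) (conjf (U i x)) v.
Proof. by move=> /nrm[_]; exact. Qed.

Let X := grad (J i) (w i) (nu i).

Lemma lie_gradE k (a : field N (kform R R 6 k)) :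
  lie_grad J w (fun i x => ln (nu i x)) a i = lie X (a i).
Proof.
have E : (fun x => kahler_metric (J i x) (w i x)) = metric (J i) (w i).
  by apply/funext => x; apply/funext => u; apply/funext => v; exact: kahler_metricE.
by rewrite /lie_grad E.
Qed.

(** In the frame adapted to the gradient at [x], the differential of [ln nu] is [lam] times the
    first covector, the shape assumed in [component11_eq0]. *)
Lemma chart_component11 x (b : kform R R 6 2) k v : D x -> alternating b ->
  let al u := 'D_u (lognorm (nu i)) x in
  (forall p q s t,
    b (tv [:: p; q]) * w i x (tv [:: s; t]) - b (tv [:: p; s]) * w i x (tv [:: q; t]) +
    b (tv [:: p; t]) * w i x (tv [:: q; s]) + w i x (tv [:: p; q]) * b (tv [:: s; t]) -
    w i x (tv [:: p; s]) * b (tv [:: q; t]) + w i x (tv [:: p; t]) * b (tv [:: q; s]) =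
    k * (al p * re (U i x) (tv [:: q; s; t]) - al q * re (U i x) (tv [:: p; s; t]) +
      al s * re (U i x) (tv [:: p; q; t]) - al t * re (U i x) (tv [:: p; q; s]))) ->
  component (J i x) 1 1 (cx b) v = 0.
Proof.
move=> Dx ab al bw.
have [e [lam [[_ _ we Ure _] [eJ ebas me]]]] :=
  frame_at J2 sw w11 wpos sUr sUi U30 nu0 normU (X x) Dx.
apply: (component11_eq0 (J2 Dx) eJ ebas we Ure _ ab bw) => j j7.
rewrite /al -(metric_grad oD J2 sw w11 wpos sUr sUi U30 nu0 normU)//; exact: me.
Qed.

Lemma chart_component30 x (c : kform R R 6 3) k v : D x -> alternating c ->
  let al u := 'D_u (lognorm (nu i)) x in
  (forall p q s, c (tv [:: p; q; s]) = k * (al p * w i x (tv [:: q; s]) -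
     al q * w i x (tv [:: p; s]) + al s * w i x (tv [:: p; q]))) ->
  component (J i x) 0 3 (cx c) v + component (J i x) 3 0 (cx c) v = 0.
Proof.
move=> Dx ac al cE; have aw := (sw Dx).1.
have w11x := fun u v => @w11 x u v Dx.
apply: (component_lefschetz (J2 Dx) aw w11x (al := fun u => k * al u) ac).
  by move=> p q s; rewrite cE mulrDr mulrBr !mulrA.
move=> u; rewrite /al -scaleN1r derive_dirZ ?mulN1r ?mulrN//.
exact: smooth_at_derivable (lognorm_smooth oD J2 sw w11 wpos sUr sUi U30 nu0 normU Dx).
Qed.

Section Flow.
Local Notation W := 'rV[R]_(6 + 1).
Local Notation M := (prod_atlas N (circle R)).
Variables (g : field M (W -> W -> R)) (vol : field M (kform R R 7 7)).
Let phi := product_phi w U nu : field M (kform R R 7 3).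
Hypothesis G2 : @G2_structure R M phi g vol.

Let p : idx M := (i, 0 : R).
Let O : set W := dom p.

Let oO : open O.
Proof.
have co : continuous (fun y : W => rsubmx y 0 0).
  have -> : (fun y : W => rsubmx y 0 0) = (fun y : W => y 0 (rshift 6 0)).
    by apply/funext => y; rewrite mxE.
  exact: coord_continuous.
have -> : O = [set y : W | D (lsubmx y)] `&` (fun y : W => rsubmx y 0 0) @^-1` `]0, 0 + 2 * pi[%classic.
  by apply/seteqP; split=> y /=; rewrite in_itv.
apply: openI; first exact: open_lsubmx oD.
by apply: (continuousP _).1 co _ _; exact: interval_open.
Qed.

Let OD y : O y -> D (lsubmx y).
Proof. by case. Qed.

Let phiE y : O y -> phi p y = phi7 (w i (lsubmx y)) (re (U i (lsubmx y))) (nu i (lsubmx y)).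
Proof.
move=> Oy; apply/funext => v; rewrite /phi /product_phi /phi7; congr (_ + _).
by rewrite /pull1 /re /pull6; case: (U _ _ _) => a b /=; rewrite mul0r subr0.
Qed.

Let sphi y v : O y -> smooth_at y (fun q => phi p q v).
Proof. by case: G2 => -[_ /(_ p v) h _] _ /(smooth_on_at oO h). Qed.
Let gip y : O y -> inner_product (g p y).
Proof. by move=> Oy; case: G2 => _ /(_ p y Oy)[]. Qed.
Let gvol y : O y -> volume_form (g p y) (vol p y).
Proof. by move=> Oy; case: G2 => _ /(_ p y Oy)[]. Qed.
Let gphi y : O y -> forall (X Y : W) (v : 'I_7 -> W),
  wedge (contract X (phi p y)) (wedge (contract Y (phi p y)) (phi p y)) v = 6 * g p y X Y * vol p y v.
Proof. by move=> Oy; case: G2 => _ /(_ p y Oy)[]. Qed.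

Lemma dual4E y : O y -> dual4 phi g vol p y = psi7 (w i (lsubmx y)) (im (U i (lsubmx y))).
Proof.
move=> Oy; have [h _ _ _] := stars oD J2 sw w11 wpos sUr sUi U30 nu0 normU OD phiE gip gvol gphi Oy.
exact: h.
Qed.

Variable A : R.
Let rhs y v := laplacian4 g vol (dual4 phi g vol) p y v +
  extd (fun z u => (A - 7 / 2 * tau0 phi g vol p z) * phi p z u) y v.

Let df u x := 'D_u (lognorm (nu i)) x.

Let rhsE y v : O y -> rhs y v =
  extd (fun q => chi7 (w i (lsubmx q)) (im (U i (lsubmx q))) (X (lsubmx q))) y v +
  A * dphi7 (w i (lsubmx y)) (re (U i (lsubmx y))) (nu i (lsubmx y)) (df^~ (lsubmx y)) v.
Proof.
move=> Oy; exact: (flow_rhs oD J2 sJ nij sw w11 wpos dw0 sUr sUi U30 dbarU nu0 normU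
  oO OD phiE sphi gip gvol gphi).
Qed.

Variable x : V.
Hypothesis Dx : D x.
(** The angle [pi] is the midpoint of the circle chart with parameter 0. By invariance along the
    circle one point above each [x] suffices. *)
Definition chart_point : W := row_mx x (const_mx pi).
Local Notation y := chart_point.

Let Oy : O y.
Proof.
rewrite /O /= /chart_point row_mxKl row_mxKr mxE; split=> //.
by rewrite pi_gt0 add0r ltr_pMl ?pi_gt0 ?ltr1n.
Qed.

Let Ly : lsubmx y = x.
Proof. exact: row_mxKl. Qed.

Let aw := (sw Dx).1.
Let aUr := (sUr Dx).1.

Lemma rhs_hor a b c d : rhs y (tv (map (@hor R) [:: a; b; c; d])) =
  let Lw p q := lie X (w i) x (tv [:: p; q]) in let W2 p q := w i x (tv [:: p; q]) in
  - (Lw a b * W2 c d - Lw a c * W2 b d + Lw a d * W2 b c +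
     W2 a b * Lw c d - W2 a c * Lw b d + W2 a d * Lw b c) -
  A * (nu i x)^-1 * (df a x * re (U i x) (tv [:: b; c; d]) - df b x * re (U i x) (tv [:: a; c; d]) +
    df c x * re (U i x) (tv [:: a; b; d]) - df d x * re (U i x) (tv [:: a; b; c])).
Proof.
have sX : svec D X := grad_smooth oD J2 sJ sw w11 wpos sUr sUi U30 nu0 normU.
rewrite rhsE// (extd_chi7_hor oD sw sUi sX dw0)// ?Ly// /=.
have dl c1 u v : df (c1 *: u + v) x = c1 * df u x + df v x.
  exact: derive_linear (lognorm_smooth oD J2 sw w11 wpos sUr sUi U30 nu0 normU Dx).
congr (_ + _); rewrite dphi7E// /hor !row_mxKl !row_mxKr !mxE /= !mul0r !subr0 !addr0 !mulr0 !sub0r.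
move: (df a x) (df b x) (df c x) (df d x) (re _ _) (re _ _) (re _ _) (re _ _) (nu i x)^-1.
by clear=> *; ring.
Qed.

Lemma rhs_ver a b c : rhs y (tv (ver R :: map (@hor R) [:: a; b; c])) =
  - lie X (fun x => im (U i x)) x (tv [:: a; b; c]) -
  A * nu i x * (df a x * w i x (tv [:: b; c]) - df b x * w i x (tv [:: a; c]) +
    df c x * w i x (tv [:: a; b])).
Proof.
have sX : svec D X := grad_smooth oD J2 sJ sw w11 wpos sUr sUi U30 nu0 normU.
have dl c1 u v : df (c1 *: u + v) x = c1 * df u x + df v x.
  exact: derive_linear (lognorm_smooth oD J2 sw w11 wpos sUr sUi U30 nu0 normU Dx).
have dUi : forall x v, D x -> extd (fun z => im (U i z)) x v = 0.
  exact: (dUi0 oD J2 sJ nij sw w11 wpos sUr sUi U30 dbarU nu0 normU).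
rewrite rhsE// (extd_chi7_ver oD sw sUi sX dUi)// ?Ly// /=.
have d0 : df 0 x = 0 by have := dl (-1) 0 0; rewrite scaler0 addr0 mulN1r addNr.
have U0 u v : re (U i x) (tv [:: 0; u; v]) = 0 by rewrite multilinear_head0//; case: aUr.
congr (_ + _); rewrite dphi7E// /hor /ver !row_mxKl !row_mxKr !mxE eqxx /= d0 !U0.
rewrite !(mul0r, subr0, addr0, mulr0, mul1r) !sub0r.
move: (df a x) (df b x) (df c x) (w _ _ _) (w _ _ _) (w _ _ _) (nu i x).
by clear=> *; ring.
Qed.

Lemma dual4_hor a b c d : dual4 phi g vol p y (tv (map (@hor R) [:: a; b; c; d])) =
  w i x (tv [:: a; b]) * w i x (tv [:: c; d]) - w i x (tv [:: a; c]) * w i x (tv [:: b; d]) +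
  w i x (tv [:: a; d]) * w i x (tv [:: b; c]).
Proof.
have aUi := (sUi Dx).1; rewrite dual4E// Ly psi7E// /hor !row_mxKl !row_mxKr !mxE /=.
by rewrite !mul0r !subr0 addr0 subr0.
Qed.

Lemma dual4_ver a b c : dual4 phi g vol p y (tv (ver R :: map (@hor R) [:: a; b; c])) =
  - im (U i x) (tv [:: a; b; c]).
Proof.
have aUi := (sUi Dx).1; rewrite dual4E// Ly psi7E// /hor /ver !row_mxKl !row_mxKr !mxE eqxx /=.
have w0 u : w i x (tv [:: 0; u]) = 0 by rewrite multilinear_head0//; case: aw.
by rewrite !w0; ring.
Qed.

End Flow.
End Chart.

Theorem corollary2p4 (R : realType) (N : atlas R 6)
    (J : field N 'M[R]_6) (omega : field N (kform R R 6 2))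
    (Upsilon : field N (kform R R[i] 6 3)) (A : R)
    (I : set R)
    (Jt : R -> field N 'M[R]_6) (omegat : R -> field N (kform R R 6 2))
    (Upsilont : R -> field N (kform R R[i] 6 3)) (normt : R -> field N R)
    (beta : R -> field N (kform R R 6 2))
    (gamma : R -> field N (kform R R[i] 6 3)) :
  smooth_manifold N ->
  compact [set: mspace N] ->
  calabi_yau J omega Upsilon ->
  (* the times: an interval containing 0, not reduced to a point *)
  is_interval I -> I 0 -> (exists t, I t /\ t <> 0) ->
  smooth_family I omegat -> smooth_cfamily I Upsilont ->
  (forall t, I t -> calabi_yau (Jt t) (omegat t) (Upsilont t)) ->
  eq_field (omegat 0) omega -> eq_field (Upsilont 0) Upsilon ->
  (forall t, I t -> is_norm (omegat t) (Upsilont t) (normt t)) ->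
  (forall t, I t -> is_form (beta t)) ->
  (forall t, I t -> is_cform (gamma t)) ->
  let lognorm t : field N R := fun i x => ln (normt t i x) in
  (forall t, I t -> evolves I omegat t (fun i x v =>
     - lie_grad (Jt t) (omegat t) (lognorm t) (omegat t) i x v
     + beta t i x v)) ->
  (forall t, I t -> evolvesC I Upsilont t (fun i x v =>
     lie_gradC (Jt t) (omegat t) (lognorm t) (Upsilont t) i x v
     + gamma t i x v)) ->
  @modified_laplacian_coflow R (prod_atlas N (circle R)) I A
    (fun t => product_phi (omegat t) (Upsilont t) (normt t)) ->
  (forall t, I t -> eq_field (Jt t) J) ->
  forall t, I t -> forall i x, dom i x ->
    (forall v, component (J i x) 1 1 (cx (beta t i x)) v = 0) /\
    (forall v, component (J i x) 0 3 (cx (im (gamma t i x))) v +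
               component (J i x) 3 0 (cx (im (gamma t i x))) v = 0).
Proof.
move=> smN _ _ itI I0 Ine _ _ cy _ _ nrm fbeta fgamma lognorm dom dU.
move=> [g [vol [G2 flow]]] JtJ t It i x Dx; rewrite -(JtJ t It i x Dx).
have Ine' : exists s, I s /\ s <> t.
  (* The hypothesis gives a second time when [t] is 0; for any other [t] the time 0 is one. *)
  have [->|/eqP t0] := eqVneq t 0; first exact: Ine.
  by exists 0; split=> // /esym.
have ab : alternating (beta t i x) by case: (fbeta t It) => h _ _; exact: h.
have ac : alternating (im (gamma t i x)) by case: (fgamma t It) => _ [h _ _]; exact: h.
have cyt := cy t It; have nrmt := nrm t It.
have Op : @Defs.dom _ _ (prod_atlas N (circle R)) (i, 0) (chart_point x).
  split; rewrite /= /chart_point ?row_mxKl// row_mxKr mxE.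
  by rewrite pi_gt0 add0r ltr_pMl ?pi_gt0 ?ltr1n.
have {}flow v := flow t It (i, 0 : R) (chart_point x) v Op.
split=> v.
  (* Horizontal components: [k] is the coefficient of [df /\ Re U] in [A d phi]. *)
  apply: (chart_component11 smN cyt nrmt (k := - A * (normt t i x)^-1) v Dx ab) => a b c d.
  have := flow (tv (map (@hor R) [:: a; b; c; d])).
  rewrite (rhs_hor smN cyt nrmt (G2 t It) A Dx) => h1.
  have {}h1 := has_ddt_ext It (fun s Is => dual4_hor smN (cy s Is) (nrm s Is) (G2 s Is) Dx a b c d) h1.
  have dw p q := dom t It i x (tv [:: p; q]) Dx.
  have h2 := has_ddtD (has_ddtD (has_ddtM (dw a b) (dw c d))
    (has_ddtN (has_ddtM (dw a c) (dw b d)))) (has_ddtM (dw a d) (dw b c)).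
  (* The derivative of [w^2 / 2], once by the flow and once by the product rule; the terms in
     [L_X w] agree and drop out. *)
  move: (has_ddt_unique It itI Ine' h1 h2); rewrite /lognorm !lie_gradE.
  set l := lie _ _ x.
  move: (l _) (l _) (l _) (l _) (l _) (l _).
  set wt := omegat t i x; set bt := beta t i x.
  move: (wt _) (wt _) (wt _) (wt _) (wt _) (wt _).
  move: (bt _) (bt _) (bt _) (bt _) (bt _) (bt _).
  move: (re _ _) (re _ _) (re _ _) (re _ _)
    ('D_a _ x) ('D_b _ x) ('D_c _ x) ('D_d _ x) (normt t i x)^-1.
  (* Six values each of [L_X w], [w] and [beta], and nine other scalars, have become variables of a
     polynomial identity. *)
  clear; do 27!move=> ?; move=> h; apply/eqP; rewrite -subr_eq0; apply/eqP.
  by move/eqP: h; rewrite -subr_eq0 => /eqP h; rewrite -[RHS]oppr0 -[in RHS]h; ring.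
(* Vertical components: the derivative of [- Im U] computed in two ways leaves
   [Im gamma = A nu df /\ w]. *)
apply: (chart_component30 smN cyt nrmt (k := A * normt t i x) v Dx ac) => a b c.
have := flow (tv (ver R :: map (@hor R) [:: a; b; c])).
rewrite (rhs_ver smN cyt nrmt (G2 t It) A Dx) => h1.
have {}h1 := has_ddt_ext It (fun s Is => dual4_ver smN (cy s Is) (nrm s Is) (G2 s Is) Dx a b c) h1.
have h2 := has_ddtN ((dU t It).2 i x (tv [:: a; b; c]) Dx).
have := has_ddt_unique It itI Ine' h1 h2; rewrite /im /lie_gradC /lognorm !lie_gradE.
by case: (gamma t i x _) => p q /=; clear; rewrite [RHS]opprD => /addrI/oppr_inj/esym.
Qed.
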